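(* The category $\mathbf{PC}$, whose objects are groups with a Polish cover and whose morphisms are Borel-definable group homomorphisms, is an exact homological category.
   Context: A subgroup $N$ of a Polish group $G$ is a Polish subgroup if it carries a (necessarily unique) Polish group topology for which the inclusion $N\to G$ is continuous. A group with a Polish cover is a quotient group $G/N$ where $G$ is a Polish group and $N$ is a normal Polish subgroup of $G$ (the pair $(G,N)$ is part of the data). A group homomorphism $f:G/N\to H/M$ between groups with a Polish cover is Borel-definable if there is a Borel function $\tilde f:G\to H$ with $f(gN)=\tilde f(g)M$ for all $g\in G$. A finitely complete category is regular if kernel pairs have coequalizers and regular epimorphisms are stable under pullback. A regular category is exact (Barr-exact) if every internal equivalence relation is the kernel pair of some morphism. A category $\mathcal E$ is pointed if it has an object that is both initial and terminal. It is protomodular if it has pullbacks of split epimorphisms along arbitrary morphisms and all inverse image (pullback) functors $\mathrm{Pt}_I(\mathcal E)\to \mathrm{Pt}_J(\mathcal E)$ along morphisms $J\to I$ reflect isomorphisms, where $\mathrm{Pt}_I(\mathcal E)$ is the category of split epimorphisms onto $I$ with a chosen splitting, and morphisms over $I$ commuting with the split epimorphisms and the splittings. A category is homological if it is pointed, regular, and protomodular; it is exact homological if it is homological and exact. *)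

(* Defs.v *)
From HB Require Import structures.
From mathcomp Require Import all_boot all_order ssralg ssrnum.
From mathcomp Require Import boolp classical_sets functions cardinality reals.
From mathcomp Require Import topology measurable_structure.

Set Implicit Arguments.
Unset Strict Implicit.
Unset Printing Implicit Defensive.

Local Open Scope classical_set_scope.
Local Open Scope group_scope.
Local Open Scope quotient_scope.

Record category := Category {
  obj :> Type;
  hom : obj -> obj -> Type;
  idm : forall A, hom A A;
  comp_hom : forall A B C, hom B C -> hom A B -> hom A C;
  comp_idl : forall A B (f : hom A B), comp_hom (idm B) f = f;
  comp_idr : forall A B (f : hom A B), comp_hom f (idm A) = f;
  compA : forall A B C D (h : hom C D) (g : hom B C) (f : hom A B),
    comp_hom h (comp_hom g f) = comp_hom (comp_hom h g) f }.

Arguments hom {c}.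
Arguments idm {c}.
Arguments comp_hom {c A B C}.

Declare Scope cat_scope.
Notation "g ∘ f" := (comp_hom g f) (at level 40, left associativity) : cat_scope.
Local Open Scope cat_scope.

Record functor (C D : category) := Functor {
  fobj :> C -> D;
  fmor : forall A B, hom A B -> hom (fobj A) (fobj B);
  fmor_id : forall A, fmor (idm A) = idm (fobj A);
  fmor_comp : forall A B E (g : hom B E) (f : hom A B),
    fmor (g ∘ f) = fmor g ∘ fmor f }.

Arguments fmor {C D} _ {A B}.

Definition is_iso (C : category) (A B : C) (f : hom A B) : Prop :=
  exists g : hom B A, g ∘ f = idm A /\ f ∘ g = idm B.

Definition reflects_isos (C D : category) (F : functor C D) : Prop :=
  forall (A B : C) (f : hom A B), is_iso (fmor F f) -> is_iso f.

Definition finite_category (J : category) : Prop :=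
  finite_set [set: J] /\ forall i j : J, finite_set [set: hom i j].

Record cone (J C : category) (D : functor J C) := Cone {
  apex : C;
  leg : forall j : J, hom apex (D j);
  leg_nat : forall (i j : J) (u : hom i j), fmor D u ∘ leg i = leg j }.

Definition is_limit (J C : category) (D : functor J C) (L : cone D) : Prop :=
  forall K : cone D, exists! h : hom (apex K) (apex L),
    forall j, leg L j ∘ h = leg K j.

Definition finitely_complete (C : category) : Prop :=
  forall J : category, finite_category J ->
  forall D : functor J C, exists L : cone D, is_limit L.

Section Shapes.
Context {C : category}.

Definition is_pullback (A B I P : C) (f : hom A I) (g : hom B I)
    (p : hom P A) (q : hom P B) : Prop :=
  f ∘ p = g ∘ q /\
  forall (W : C) (u : hom W A) (v : hom W B), f ∘ u = g ∘ v ->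
    exists! h : hom W P, p ∘ h = u /\ q ∘ h = v.

Record pullback (A B I : C) (f : hom A I) (g : hom B I) := Pullback {
  pb_obj : C;
  pb_fst : hom pb_obj A;
  pb_snd : hom pb_obj B;
  pb_spec : is_pullback f g pb_fst pb_snd }.

Definition is_kernel_pair (A B R : C) (f : hom A B) (r1 r2 : hom R A) : Prop :=
  is_pullback f f r1 r2.

Definition is_coequalizer (A B Q : C) (f g : hom A B) (q : hom B Q) : Prop :=
  q ∘ f = q ∘ g /\
  forall (W : C) (u : hom B W), u ∘ f = u ∘ g -> exists! h : hom Q W, h ∘ q = u.

Definition regular_epi (B Q : C) (q : hom B Q) : Prop :=
  exists (A : C) (f g : hom A B), is_coequalizer f g q.

Definition is_initial (Z : C) : Prop :=
  forall A : C, exists! f : hom Z A, True.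

Definition is_terminal (Z : C) : Prop :=
  forall A : C, exists! f : hom A Z, True.

Definition split_epi (A I : C) (p : hom A I) : Prop :=
  exists s : hom I A, p ∘ s = idm I.

Definition jointly_monic (R A B : C) (r1 : hom R A) (r2 : hom R B) : Prop :=
  forall (W : C) (u v : hom W R), r1 ∘ u = r1 ∘ v -> r2 ∘ u = r2 ∘ v -> u = v.

(* In transitivity [P] is the object of composable pairs [R x_X R]; in a
   finitely complete category the condition does not depend on its choice. *)
Definition internal_equivalence (R X : C) (r1 r2 : hom R X) : Prop :=
  [/\ jointly_monic r1 r2,
      exists d : hom X R, r1 ∘ d = idm X /\ r2 ∘ d = idm X,
      exists s : hom R R, r1 ∘ s = r2 /\ r2 ∘ s = r1 &
      forall (P : C) (p1 p2 : hom P R), is_pullback r2 r1 p1 p2 ->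
        exists t : hom P R, r1 ∘ t = r1 ∘ p1 /\ r2 ∘ t = r2 ∘ p2].

End Shapes.

Definition regular (C : category) : Prop :=
  [/\ finitely_complete C,
      forall (A B R : C) (f : hom A B) (r1 r2 : hom R A),
        is_kernel_pair f r1 r2 ->
        exists (Q : C) (q : hom A Q), is_coequalizer r1 r2 q &
      forall (A B I P : C) (f : hom A I) (g : hom B I)
          (p : hom P A) (q : hom P B),
        is_pullback f g p q -> regular_epi f -> regular_epi q].

Definition barr_exact (C : category) : Prop :=
  regular C /\
  forall (R X : C) (r1 r2 : hom R X), internal_equivalence r1 r2 ->
    exists (Y : C) (f : hom X Y), is_kernel_pair f r1 r2.

Definition pointed (C : category) : Prop :=
  exists Z : C, is_initial Z /\ is_terminal Z.

Section Points.
Variables (C : category) (I : C).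

Record point := Point {
  pt_obj : C;
  pt_proj : hom pt_obj I;
  pt_sect : hom I pt_obj;
  pt_split : pt_proj ∘ pt_sect = idm I }.

Record point_hom (X Y : point) := PointHom {
  pt_mor :> hom (pt_obj X) (pt_obj Y);
  pt_mor_proj : pt_proj Y ∘ pt_mor = pt_proj X;
  pt_mor_sect : pt_mor ∘ pt_sect X = pt_sect Y }.

Lemma point_hom_ext X Y (f g : point_hom X Y) :
  pt_mor f = pt_mor g -> f = g.
Proof.
case: f g => [f f1 f2] [g g1 g2] /= e; case: _ / e g1 g2 => g1 g2.
by rewrite (Prop_irrelevance f1 g1) (Prop_irrelevance f2 g2).
Qed.

Definition point_id X : point_hom X X :=
  @PointHom X X (idm (pt_obj X)) (comp_idr _) (comp_idl _).

Definition point_comp X Y Z (g : point_hom Y Z) (f : point_hom X Y) :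
  point_hom X Z.
Proof.
apply: (@PointHom _ _ (pt_mor g ∘ pt_mor f)).
- by rewrite compA !pt_mor_proj.
- by rewrite -compA !pt_mor_sect.
Defined.

Definition Pt : category.
Proof.
apply: (@Category point point_hom point_id point_comp).
- by move=> X Y f; apply: point_hom_ext; apply: comp_idl.
- by move=> X Y f; apply: point_hom_ext; apply: comp_idr.
- by move=> X Y Z W h g f; apply: point_hom_ext; apply: compA.
Defined.

End Points.

Section PullbackLift.
Variables (C : category) (A B I : C) (f : hom A I) (g : hom B I).
Variables (P : pullback f g) (W : C) (u : hom W A) (v : hom W B).
Hypothesis e : f ∘ u = g ∘ v.

Definition pb_lift : hom W (pb_obj P) := projT1 (cid (proj2 (pb_spec P) W u v e)).

Lemma pb_lift_fst : pb_fst P ∘ pb_lift = u.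
Proof. by rewrite /pb_lift; case: cid => h /= -[] []. Qed.

Lemma pb_lift_snd : pb_snd P ∘ pb_lift = v.
Proof. by rewrite /pb_lift; case: cid => h /= -[] []. Qed.

End PullbackLift.

Lemma pb_comm (C : category) (A B I : C) (f : hom A I) (g : hom B I)
  (P : pullback f g) : f ∘ pb_fst P = g ∘ pb_snd P.
Proof. exact: (proj1 (pb_spec P)). Qed.

Lemma pb_ext (C : category) (A B I : C) (f : hom A I) (g : hom B I)
    (P : pullback f g) (W : C) (h k : hom W (pb_obj P)) :
  pb_fst P ∘ h = pb_fst P ∘ k -> pb_snd P ∘ h = pb_snd P ∘ k -> h = k.
Proof.
move=> e1 e2; have e : f ∘ (pb_fst P ∘ k) = g ∘ (pb_snd P ∘ k).
  by rewrite !compA pb_comm.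
have [l [_ lU]] := proj2 (pb_spec P) W _ _ e.
by rewrite -(lU h) ?(lU k).
Qed.

Section InverseImage.
Variables (C : category) (I J : C) (f : hom J I).
Variable pb : forall X : Pt I, pullback (pt_proj X) f.

Lemma inv_sect_subproof (X : Pt I) :
  pt_proj X ∘ (pt_sect X ∘ f) = f ∘ idm J.
Proof. by rewrite compA pt_split comp_idl comp_idr. Qed.

Definition inv_obj (X : Pt I) : Pt J :=
  @Point C J (pb_obj (pb X)) (pb_snd (pb X))
    (pb_lift (pb X) (inv_sect_subproof X)) (pb_lift_snd _ _).

Lemma inv_mor_subproof (X Y : Pt I) (h : hom X Y) :
  pt_proj Y ∘ (pt_mor h ∘ pb_fst (pb X)) = f ∘ pb_snd (pb X).
Proof. by rewrite compA pt_mor_proj pb_comm. Qed.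

Definition inv_mor (X Y : Pt I) (h : hom X Y) : hom (inv_obj X) (inv_obj Y).
Proof.
apply: (@PointHom C J (inv_obj X) (inv_obj Y)
  (pb_lift (pb Y) (inv_mor_subproof h))).
- exact: pb_lift_snd.
- apply: pb_ext => /=.
  + rewrite compA !pb_lift_fst -compA pb_lift_fst compA.
    by rewrite pt_mor_sect.
  + by rewrite compA !pb_lift_snd.
Defined.

Definition inverse_image : functor (Pt I) (Pt J).
Proof.
apply: (@Functor (Pt I) (Pt J) inv_obj inv_mor).
- move=> X; apply: point_hom_ext; apply: pb_ext => /=.
  + by rewrite pb_lift_fst comp_idl comp_idr.
  + by rewrite pb_lift_snd comp_idr.
- move=> X Y Z g h; apply: point_hom_ext; apply: pb_ext => /=.
  + by rewrite pb_lift_fst compA pb_lift_fst -!compA pb_lift_fst.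
  + by rewrite pb_lift_snd compA !pb_lift_snd.
Defined.

End InverseImage.

(* The inverse image functor depends on a choice of pullbacks; we ask that it
   reflects isomorphisms for every choice. *)
Definition protomodular (C : category) : Prop :=
  (forall (A I J : C) (p : hom A I) (f : hom J I),
    split_epi p -> inhabited (pullback p f)) /\
  (forall (I J : C) (f : hom J I)
    (pb : forall X : Pt I, pullback (pt_proj X) f),
    reflects_isos (inverse_image pb)).

Definition homological (C : category) : Prop :=
  [/\ pointed C, regular C & protomodular C].

Definition exact_homological (C : category) : Prop :=
  homological C /\ barr_exact C.

Definition complete_space (T : uniformType) : Prop :=
  forall F : set_system T, ProperFilter F -> cauchy F -> exists x : T, F --> x.

Definition homeomorphic (S T : topologicalType) : Prop :=
  exists (h : S -> T) (k : T -> S),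
    [/\ cancel h k, cancel k h, continuous h & continuous k].

Definition completely_metrizable (R : realType) (T : topologicalType) : Prop :=
  exists2 M : metricType R, complete_space M & homeomorphic T M.

Definition separable (T : topologicalType) : Prop :=
  exists2 D : set T, countable D & dense D.

HB.mixin Record isTopologicalGroup G & Topological G & Group G := {
  mulg_continuous : continuous (fun x : G * G => x.1 * x.2);
  invg_continuous : continuous (fun x : G => x^-1) }.

#[short(type="topologicalGroupType")]
HB.structure Definition TopologicalGroup :=
  { G of Topological G & Group G & isTopologicalGroup G }.

HB.mixin Record isPolish (R : realType) T & Topological T := {
  polish_separable : separable T;
  polish_metrizable : completely_metrizable R T }.

#[short(type="polishGroupType")]
HB.structure Definition PolishGroup (R : realType) :=
  { G of TopologicalGroup G & isPolish R G }.

Definition borel_function (S T : topologicalType) (f : S -> T) : Prop :=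
  forall B : set T, <<s open >> B -> <<s open >> (f @^-1` B).

Definition normal_subgroup (G : groupType) (N : set G) : Prop :=
  [/\ N 1, forall x y, N x -> N y -> N (x / y) &
      forall x g, N x -> N (x ^ g)].

(* A Polish group topology on [N] making the inclusion continuous is given up to
   transport as a Polish group [P] with a continuous injective homomorphism
   into [G] whose image is [N]. *)
Definition polish_subgroup (R : realType) (G : polishGroupType R) (N : set G) :
    Prop :=
  exists (P : polishGroupType R) (i : {multiplicative P -> G}),
    [/\ injective i, continuous i & range i = N].

Record polish_cover (R : realType) := PolishCover {
  cover : polishGroupType R;
  cover_ker : set cover;
  cover_ker_normal : normal_subgroup cover_ker;
  cover_ker_polish : polish_subgroup cover_ker }.

Arguments cover_ker {R} _ _ : rename.

Section Quotient.
Variables (R : realType) (X : polish_cover R).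
Local Notation G := (cover X).
Local Notation N := (cover_ker X).

Definition coset_rel : rel G := fun g h => `[< N (g^-1 * h) >].

Lemma cover_ker1 : N 1. Proof. by case: (cover_ker_normal X). Qed.

Lemma cover_kerV x : N x -> N x^-1.
Proof.
case: (cover_ker_normal X) => N1 Nd _ Nx.
by rewrite -[x^-1]mul1g; apply: Nd.
Qed.

Lemma cover_kerM x y : N x -> N y -> N (x * y).
Proof.
case: (cover_ker_normal X) => N1 Nd _ Nx /cover_kerV Ny.
by rewrite -[y]invgK; apply: Nd.
Qed.

Lemma cover_kerJ x g : N x -> N (x ^ g).
Proof. by case: (cover_ker_normal X) => _ _; apply. Qed.

Lemma coset_rel_refl : reflexive coset_rel.
Proof. by move=> x; apply/asboolP; rewrite mulVg; apply: cover_ker1. Qed.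

Lemma coset_rel_sym : symmetric coset_rel.
Proof.
move=> x y; apply: asbool_equiv_eq.
by split=> /cover_kerV; rewrite invgM invgK.
Qed.

Lemma coset_rel_trans : transitive coset_rel.
Proof.
move=> y x z /asboolP Nxy /asboolP Nyz; apply/asboolP.
by have := cover_kerM Nxy Nyz; rewrite mulgA mulgK.
Qed.

Canonical coset_equiv :=
  EquivRel coset_rel coset_rel_refl coset_rel_sym coset_rel_trans.

Definition quotient := {eq_quot coset_equiv}.

HB.instance Definition _ := Choice.on quotient.
HB.instance Definition _ := Quotient.on quotient.
HB.instance Definition _ := EqQuotient.on quotient.

Definition quot_pi (g : G) : quotient := \pi_quotient g.

Lemma quot_piP g h : quot_pi g = quot_pi h <-> N (g^-1 * h).
Proof.
split=> [/eqP|H]; last first.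
  by apply/eqP; rewrite /quot_pi eqmodE; apply/asboolP.
by rewrite /quot_pi eqmodE => /asboolP.
Qed.

Definition quot_mul (x y : quotient) : quotient :=
  quot_pi (repr x * repr y).
Definition quot_inv (x : quotient) : quotient := quot_pi (repr x)^-1.

Lemma quot_piK (x : quotient) : quot_pi (repr x) = x.
Proof. exact: reprK. Qed.

Lemma quot_piM g h : quot_mul (quot_pi g) (quot_pi h) = quot_pi (g * h).
Proof.
apply/quot_piP.
have /quot_piP Ng := quot_piK (quot_pi g).
have /quot_piP Nh := quot_piK (quot_pi h).
have := cover_kerM (cover_kerJ h Ng) Nh.
have := cover_kerM (cover_kerJ (repr (quot_pi h)) Ng) Nh.
by rewrite /conjg invgM !mulgA mulgK.
Qed.

Lemma quot_piV g : quot_inv (quot_pi g) = quot_pi g^-1.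
Proof.
apply/quot_piP; have /quot_piP Ng := quot_piK (quot_pi g).
have := cover_kerJ g^-1 (cover_kerV Ng).
by rewrite /conjg invgM !invgK !mulgA mulgV mul1g.
Qed.

Lemma quot_mulA : associative quot_mul.
Proof.
move=> x y z; rewrite -[x]quot_piK -[y]quot_piK -[z]quot_piK.
by rewrite !quot_piM mulgA.
Qed.

Lemma quot_mul1 : left_id (quot_pi 1) quot_mul.
Proof. by move=> x; rewrite -[x]quot_piK quot_piM mul1g. Qed.

Lemma quot_mulr1 : right_id (quot_pi 1) quot_mul.
Proof. by move=> x; rewrite -[x]quot_piK quot_piM mulg1. Qed.

Lemma quot_mulV : left_inverse (quot_pi 1) quot_inv quot_mul.
Proof. by move=> x; rewrite -[x]quot_piK quot_piV quot_piM mulVg. Qed.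

Lemma quot_mulrV : right_inverse (quot_pi 1) quot_inv quot_mul.
Proof. by move=> x; rewrite -[x]quot_piK quot_piV quot_piM mulgV. Qed.

HB.instance Definition _ := isGroup.Build quotient
  quot_mulA quot_mul1 quot_mulr1 quot_mulV quot_mulrV.

End Quotient.

Arguments quot_pi {R} X g.

Section Morphisms.
Variable R : realType.
Implicit Types X Y Z : polish_cover R.

Definition borel_definable X Y (f : quotient X -> quotient Y) : Prop :=
  exists2 ft : cover X -> cover Y,
    borel_function ft & forall g, f (quot_pi X g) = quot_pi Y (ft g).

Record pc_hom X Y := PCHom {
  pc_fun :> {multiplicative quotient X -> quotient Y};
  pc_borel : borel_definable pc_fun }.

Lemma pc_hom_ext X Y (f g : pc_hom X Y) : f =1 g -> f = g.
Proof.
case: f g => [[f [[fM]]] bf] [[g [[gM]]] bg] /= /funext e.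
case: _ / e gM bg => gM bg.
by rewrite (Prop_irrelevance fM gM) in bf *; rewrite (Prop_irrelevance bf bg).
Qed.

Lemma pc_id_subproof X : borel_definable (@idfun (quotient X)).
Proof. by exists idfun. Qed.

Definition pc_id X : pc_hom X X := @PCHom X X idfun (pc_id_subproof X).

Lemma pc_comp_subproof X Y Z (g : pc_hom Y Z) (f : pc_hom X Y) :
  borel_definable (g \o f).
Proof.
case: (pc_borel f) (pc_borel g) => ft bf ef [gt bg eg].
exists (gt \o ft) => [B /bg/bf //|x /=]; by rewrite ef eg.
Qed.

Definition pc_comp X Y Z (g : pc_hom Y Z) (f : pc_hom X Y) : pc_hom X Z :=
  @PCHom X Z (pc_fun g \o pc_fun f) (pc_comp_subproof g f).

Definition PC : category.
Proof.
apply: (@Category (polish_cover R) pc_hom pc_id pc_comp).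
- by move=> X Y f; apply: pc_hom_ext.
- by move=> X Y f; apply: pc_hom_ext.
- by move=> X Y Z W h g f; apply: pc_hom_ext.
Defined.

End Morphisms.

(* Main.v *)
(** A Borel-definable homomorphism [phi : G/N -> H/M] has a Polish graph: the
    subgroup of pairs [(g, h)] with [phi (g N) = h M] is an extension of [G] by [M]
    with the Borel section [s g = (g, f g)], [f] a Borel lift of [phi]. On a dense
    G_delta set [C] of points [x] the cocycle of [s] is continuous in the generic
    sense, and the charts [(x, y, m) |-> s y * m * (s x)^-1], with [x] and [y] in
    [C], then have continuous transition maps; the resulting quotient topology is a
    Hausdorff second countable group topology that is complete for the two-sided
    uniformity, because it is an open image of the Polish space [C * C * M].
    Conversely, a continuous surjective homomorphism of Polish groups is open and has
    a Borel section, so that the morphisms of [PC] are exactly those induced by spans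
    of continuous homomorphisms [cover X <- P -> cover Y] with surjective left leg.
    Fibre products and images of Polish groups then yield finite limits, kernels and
    quotients computed as for abstract groups; in particular bijective morphisms are
    isomorphisms and regular epimorphisms are the surjective morphisms. *)

From HB Require Import structures.
From mathcomp Require Import all_boot all_order ssralg ssrnum.
From mathcomp Require Import boolp classical_sets functions cardinality reals.
From mathcomp Require Import topology measurable_structure.
From Stdlib Require List.
Require Import Defs.

Set Implicit Arguments.
Unset Strict Implicit.
Unset Printing Implicit Defensive.

Local Open Scope classical_set_scope.

(** * Baire category *)

Section Comeager.
Context {T : topologicalType}.
Implicit Types A B O : set T.

(** Three obstacles shape the proof. (1) The lift [f] is only Borel, so no chart (g, m) built on one
    section is continuous around every g. But a comeager set meets each of its translates, so every
    g is y x^-1 with x and y generic, and the section is evaluated only at points where it behaves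
    well. The same remark, applied to finitely or countably many translates, recurs whenever generic
    information has to become global. (2) [M] may carry a strictly finer topology than its image in
    [H], so continuity into [H] says nothing directly about [M]. The bridge is
    [comeager_cont_on_lift]: a lift through a continuous injection is continuous on a comeager set.
    Applied to the inverse of P/ker f -> H, it also yields the open mapping theorem. (3) A Polish
    group can fail to be complete for its left or right uniformity, whence the two-sided one.
    Classically a dense G_delta subgroup of its completion is everything, since two comeager cosets
    must meet; here that argument is run inside the group, factoring the missing limit as a product
    of two elements. *)

Definition comeager A := exists2 U : nat -> set T,
  forall n, open (U n) /\ dense (U n) & \bigcap_n U n `<=` A.

Lemma comeagerS A B : A `<=` B -> comeager A -> comeager B.
Proof. by move=> AB [U HU sU]; exists U => // x /sU/AB. Qed.

Lemma open_dense_comeager O : open O -> dense O -> comeager O.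
Proof. by move=> oO dO; exists (fun=> O) => // x /(_ 0%N I). Qed.

Lemma dense_setT : dense [set: T].
Proof. by move=> O O0 _; rewrite setIT. Qed.

Lemma comeagerT : comeager [set: T].
Proof. exact: open_dense_comeager openT dense_setT. Qed.

Lemma comeager_bigcap (A : nat -> set T) :
  (forall n, comeager (A n)) -> comeager (\bigcap_n A n).
Proof.
move=> cA.
have /choice[U HU] : forall n, exists U : nat -> set T,
    (forall k, open (U k) /\ dense (U k)) /\ \bigcap_k U k `<=` A n.
  by move=> n; have [U ? ?] := cA n; exists U.
exists (fun n => if @unpickle (nat * nat)%type n is Some p then U p.1 p.2 else
  setT).
  move=> n; case: unpickle => [[i j]|] /=; first exact: (HU i).1.
  by split; [exact: openT|exact: dense_setT].
move=> x Ux n _; apply: (HU n).2 => k _.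
by have := Ux (pickle (n, k)) I; rewrite pickleK.
Qed.

Lemma comeager_forall (J : countType) (A : J -> set T) :
  (forall i, comeager (A i)) -> comeager [set x | forall i, A i x].
Proof.
move=> cA; have [|U HU sU] := @comeager_bigcap
  (fun n => if unpickle n is Some i then A i else setT).
  by move=> n; case: unpickle => [i|] //; exact: comeagerT.
by exists U => // x /sU H i; have := H (pickle i) I; rewrite pickleK.
Qed.

Lemma comeagerI A B : comeager A -> comeager B -> comeager (A `&` B).
Proof.
move=> cA cB; have := @comeager_forall bool (fun b => if b then A else B).
move=> H; apply: (comeagerS _ (H _)); last by case.
by move=> x /= Hx; split; [apply: (Hx true)|apply: (Hx false)].
Qed.

Lemma dense_or_interiorC O : dense (O `|` (~` O)°).
Proof.
move=> V [x Vx] oV.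
have [[y [Vy Oy]]|VO] := pselect (V `&` O !=set0).
  by exists y; split=> //; left.
exists x; split=> //; right; rewrite /interior nbhsE; exists V => // y Vy Oy.
by apply: VO; exists y.
Qed.

Lemma comeager_or_interiorC O : open O -> comeager (O `|` (~` O)°).
Proof.
by move=> oO; apply: open_dense_comeager (dense_or_interiorC O);
  apply: openU => //; apply: open_interior.
Qed.

End Comeager.

Lemma comeager_preimage (S T : topologicalType) (h : S -> T) (A : set T) :
  continuous h -> (forall O, open O -> open (h @` O)) ->
  comeager A -> comeager (h @^-1` A).
Proof.
move=> ch oh [U HU sU]; exists (fun n => h @^-1` U n) => [n|x Ux]; last first.
  by apply: sU => n _; apply: Ux.
split=> [|O [x Ox] oO].
  by apply: open_comp => [y _|]; [exact: ch|exact: (HU n).1].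
have [|y [[z Oz <-] Uy]] := (HU n).2 (h @` O) _ (oh _ oO).
  by exists (h x), x.
by exists z.
Qed.

(** Continuity of the restriction to [D] for the relative topology, phrased with neighbourhoods in
    [S] so that [D] need not become a type. *)
Definition cont_on (S T : topologicalType) (D : set S) (f : S -> T) :=
  forall x, D x -> forall O, nbhs (f x) O -> nbhs x [set y | D y -> O (f y)].

Lemma cont_onS (S T : topologicalType) (D E : set S) (f : S -> T) :
  E `<=` D -> cont_on D f -> cont_on E f.
Proof.
move=> ED cf x Ex O fO; apply: filterS (cf x (ED _ Ex) O fO) => y Dy Ey.
exact/Dy/ED.
Qed.

Lemma nat_basis (T : topologicalType) : @second_countable T ->
  exists B : nat -> set T, (forall n, open (B n)) /\
    forall x O, nbhs x O -> exists n, B n x /\ B n `<=` O.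
Proof.
move=> [B /pfcard_geP[->|/unsquash f]] [Bo Bb].
  by exists (fun=> setT); split=> [_|x O /Bb[U []]//]; exact: openT.
exists f; split=> [n|x O /Bb[U [BU Ux] UO]]; first by apply/Bo/funS.
by have [n _ fU] := @surj _ _ _ _ f U BU; exists n; rewrite fU.
Qed.

Section Everywhere_nonmeager.
Context {T : topologicalType}.
Implicit Types A O : set T.

Definition nonmeager_in A O := ~ comeager (~` (A `&` O)).

(** An open stand-in for [A] up to meager sets. It makes sense for every [A], so the Baire property
    of [A] never has to be established. *)
Definition locally_nonmeager A := \bigcup_(O in [set O | open O /\
  forall O', open O' -> O' !=set0 -> O' `<=` O -> nonmeager_in A O']) O.

Lemma open_locally_nonmeager A : open (locally_nonmeager A).
Proof. by apply: bigcup_open => O []. Qed.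

Lemma nonmeager_inS A O O' : O `<=` O' -> nonmeager_in A O -> nonmeager_in A O'.
Proof.
move=> OO' nA cA; apply: nA; apply: comeagerS cA => x nx [Ax Ox].
by apply: nx; split=> //; apply: OO'.
Qed.

Lemma locally_nonmeagerP A O : open O -> O `&` locally_nonmeager A !=set0 ->
  nonmeager_in A O.
Proof.
move=> oO [x [Ox [O' [oO' nO'] O'x]]].
apply: (@nonmeager_inS _ (O `&` O')); first by move=> y [].
by apply: nO' => [||y []//]; [exact: openI|exists x].
Qed.

Hypothesis sc : @second_countable T.

(** Let [Z] be the union of the basic open sets in which [A] is meager. There are countably many of
    them, so [A] is meager in [Z]; the interior of the complement of [Z] lies in
    [locally_nonmeager A]; the remaining boundary of [Z] is nowhere dense. *)
Lemma comeager_locally_nonmeager A :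
  comeager [set x | A x -> locally_nonmeager A x].
Proof.
have [B [Bo Bb]] := nat_basis sc.
pose Z := \bigcup_(n in [set n | comeager (~` (A `&` B n))]) B n.
have oZ : open Z by apply: bigcup_open => n _; exact: Bo.
have cAZ : comeager [set x | forall n,
    comeager (~` (A `&` B n)) -> ~ (A `&` B n) x].
  apply: comeager_forall => n.
  have [c|nc] := pselect (comeager (~` (A `&` B n))).
    by apply: comeagerS c => x.
  by apply: comeagerS comeagerT => x _ /nc.
apply: comeagerS (comeagerI (comeager_or_interiorC oZ) cAZ) => x [].
move=> [[n cn Bx] /(_ n cn) nx Ax|Zx _ Ax]; first by case: nx.
exists (~` Z)° => //; split=> [|O' oO' [y O'y] O'Z c];
  first exact: open_interior.
have [n [Bny BnO']] := Bb y O' (open_nbhs_nbhs (conj oO' O'y)).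
have : (~` Z) y := interior_subset (O'Z _ O'y).
case; exists n => //=; apply: comeagerS c => z nz [Az Bz].
by apply: nz; split=> //; apply: BnO'.
Qed.

(** An open set that avoids every [locally_nonmeager (A_ n)] meets each [A_ n], hence [A], in a
    meager set, and so cannot meet [locally_nonmeager A]. *)
Lemma comeager_locally_nonmeager_cover A (A_ : nat -> set T) :
  A `<=` \bigcup_n A_ n ->
  comeager [set x | locally_nonmeager A x -> exists n, locally_nonmeager (A_ n)
    x].
Proof.
move=> AA; pose E := \bigcup_n locally_nonmeager (A_ n).
have oE : open E by apply: bigcup_open => n _; exact: open_locally_nonmeager.
have : comeager (E `|` (~` locally_nonmeager A)°).
  apply: open_dense_comeager.
    by apply: openU => //; apply: open_interior.
  move=> O [x Ox] oO; apply: contrapT => H.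
  have OE : forall y, O y -> ~ E y by move=> y Oy Ey; apply: H; exists y;
    split=> //; left.
  have [z [Oz Az]] : O `&` locally_nonmeager A !=set0.
    apply: contrapT => H'; apply: H; exists x; split=> //; right.
    rewrite /interior nbhsE; exists O => // y Oy Ay; apply: H'; by exists y.
  have : nonmeager_in A O by apply: locally_nonmeagerP => //; exists z.
  apply; apply: (comeagerS _ (comeager_forall (fun n =>
    comeager_locally_nonmeager (A_ n)))).
  move=> y /= Hy [/AA[n _ Any] Oy]; apply: (OE y Oy); exists n => //; exact: Hy.
apply: comeagerS => x [[n _ ?] _|]; first by exists n.
by move=> /interior_subset nx /nx.
Qed.

Lemma not_locally_nonmeager0 x : ~ locally_nonmeager (set0 : set T) x.
Proof.
move=> [O [oO H] Ox]; apply: (H O oO) => //; first by exists x.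
by apply: comeagerS comeagerT => y _; rewrite set0I.
Qed.

End Everywhere_nonmeager.

(** * Polish spaces *)

(* [S n] plays the role of the sets of diameter less than [1 / n] for a complete
   metric; unlike a metric, it passes to G_delta subsets without change of
   distance. *)
Definition sieve (T : topologicalType) (S : nat -> set (set T)) :=
  [/\ forall n x O, nbhs x O ->
        exists W, [/\ open W, W x, closure W `<=` O & S n W],
      forall n A B, A `<=` B -> S n B -> S n A &
      forall W : nat -> set T, (forall n, S n (W n)) ->
        (forall n, W n.+1 `<=` W n) -> (forall n, W n !=set0) ->
        exists x : T, forall O, nbhs x O -> exists n, W n `<=` O].

Definition polish_space (T : topologicalType) :=
  [/\ hausdorff_space T, @second_countable T & exists S, @sieve T S].

Lemma nested_le (T : Type) (W : nat -> set T) :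
  (forall n, W n.+1 `<=` W n) -> forall m n, (m <= n)%N -> W n `<=` W m.
Proof.
move=> H m n /subnK <-; elim: (n - m)%N => // k IH.
by rewrite addSn => x /H/IH.
Qed.

Lemma sieve_limit_closure (T : topologicalType) (W : nat -> set T) x :
  (forall n, W n.+1 `<=` W n) -> (forall n, W n !=set0) ->
  (forall O, nbhs x O -> exists n, W n `<=` O) -> forall n, closure (W n) x.
Proof.
move=> Wd W0 Wx n O /Wx[k WO].
have [y Wy] := W0 (maxn n k); exists y; split.
  by apply: (nested_le Wd) Wy; rewrite leq_maxl.
by apply: WO; apply: (nested_le Wd) Wy; rewrite leq_maxr.
Qed.

Lemma dependent_choice (T : Type) (P : nat -> T -> Prop)
    (R : nat -> T -> T -> Prop) (x0 : T) : P 0%N x0 ->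
  (forall n x, P n x -> exists y, P n.+1 y /\ R n x y) ->
  exists f : nat -> T, [/\ f 0%N = x0, forall n, P n (f n) &
    forall n, R n (f n) (f n.+1)].
Proof.
move=> P0 H.
have /choice[g Hg] : forall p : nat * T, exists y, P p.1 p.2 ->
    P p.1.+1 y /\ R p.1 p.2 y.
  move=> [n x] /=; have [/H[y Hy]|nP] := pselect (P n x); first by exists y.
  by exists x.
pose f := fix f n := if n is m.+1 then g (m, f m) else x0.
have fP n : P n (f n) by elim: n => // n /(Hg (n, f n))[].
by exists f; split=> // n; have [] := Hg (n, f n) (fP n).
Qed.

Lemma baire (T : topologicalType) (A : set T) :
  polish_space T -> comeager A -> dense A.
Proof.
move=> [_ _ [S [S1 S2 S3]]] [U HU UA] O [x Ox] oO.
have step n (W : set T) : open W -> W !=set0 -> exists W', [/\ open W',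
    W' !=set0, S n W' & closure W' `<=` W `&` U n].
  move=> oW W0; have [y [Wy Uy]] := (HU n).2 _ W0 oW.
  have [|W' [? ? ? ?]] := S1 n y (W `&` U n).
    by apply: open_nbhs_nbhs; split=> //; apply: openI => //; exact: (HU n).1.
  by exists W'; split=> //; exists y.
have [W0 [oW0 W00 SW0 W0s]] := step 0%N O oO (ex_intro _ x Ox).
have [|n W [oW Wn SW WU]|W [eW HW RW]] := @dependent_choice _
    (fun n W => [/\ open W, W !=set0, S n W & closure W `<=` U n])
    (fun n W W' => closure W' `<=` W) W0.
- by split=> // y /W0s[].
- have [W' [? ? ? W's]] := step n.+1 W oW Wn.
  by exists W'; split; [split=> // y /W's[]|move=> y /W's[]].
have Wd n : W n.+1 `<=` W n by move=> y /subset_closure/RW.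
have Wne n : W n !=set0 by have [] := HW n.
have [|y Wy] := S3 W _ Wd Wne; first by move=> n; have [] := HW n.
have cWy := sieve_limit_closure Wd Wne Wy.
exists y; split; first by have := cWy 0%N; rewrite eW => /W0s[].
by apply: UA => n _; have [_ _ _] := HW n; apply.
Qed.

Lemma comeager_nonempty (T : topologicalType) (A : set T) (x : T) :
  polish_space T -> comeager A -> A !=set0.
Proof.
move=> pT cA; have [||y [_ Ay]] := baire pT cA (O := setT); last by exists y.
- by exists x.
- exact: openT.
Qed.

(* The graph of [phi] over [D] is closed in [D * M]; a nested sequence argument
   in [M] replaces the Baire property of its analytic projections. *)
Lemma comeager_cont_on_lift (Q M H : topologicalType) (i : M -> H)
    (phi : Q -> M) (D : set Q) :
  @second_countable Q -> polish_space M -> hausdorff_space H ->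
  continuous i -> injective i -> comeager D -> cont_on D (i \o phi) ->
  exists C, [/\ comeager C, C `<=` D & cont_on C phi].
Proof.
move=> scQ [_ scM [S [S1 S2 S3]]] hH ci ii cD cphi.
have [B [Bo Bb]] := nat_basis scM.
pose ev n := locally_nonmeager (phi @^-1` B n).
pose good k n j := S k (B j) /\ closure (B j) `<=` B n.
(* For [x] in [C], membership of [phi x] in [B n] is certified by [ev n x], and a certificate
   [ev n x] always refines to some [ev j x] with [B j] small of order [k] and well inside [B n].
   These are countably many conditions, each failing only on a meager set. *)
pose C := D `&` [set x | forall n, B n (phi x) -> ev n x] `&`
  [set x | forall kn : nat * nat, ev kn.2 x -> exists j, good kn.1 kn.2 j /\
    ev j x].
have evD n x O : ev n x -> nbhs x O -> exists y, [/\ O y, D y & B n (phi y)].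
  move=> evx; rewrite nbhsE => -[O' [oO' O'x] O'O].
  have nm : nonmeager_in (phi @^-1` B n) O'.
    by apply: locally_nonmeagerP => //; exists x.
  apply: contrapT => H'; apply: nm; apply: comeagerS cD => y Dy [By O'y].
  by apply: H'; exists y; split=> //; apply: O'O.
(* The converse certificate, which makes the preimage of [B n] agree on [C] with the open set
   [ev n]. Refining forever produces a limit [m] in [B n]; points [y] of [D] near [x] have [phi y]
   near [m], so [i (phi x)] and [i m] cannot be separated in [H]. *)
have key n x : C x -> ev n x -> B n (phi x).
  move=> [[Dx Cx1] Cx2] evx.
  have [j0 [[Sj0 cj0] ej0]] := Cx2 (0%N, n) evx.
  have [//|k j [_ ej]|J [J0 HJ RJ]] := @dependent_choice _
    (fun k j => S k (B j) /\ ev j x)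
    (fun k j j' => closure (B j') `<=` B j) j0.
    by have [j' [[Sj' cj'] ej']] := Cx2 (k.+1, j) ej; exists j'.
  have Wd k : B (J k.+1) `<=` B (J k) by move=> y /subset_closure/RJ.
  have Wne k : B (J k) !=set0.
    have [_ e] := HJ k; have [y [_ _ By]] := evD _ _ setT e filterT.
    by exists (phi y).
  have [|m Wm] := S3 (B \o J) _ Wd Wne; first by move=> k; have [] := HJ k.
  have cWm := sieve_limit_closure Wd Wne Wm.
  have Bm : B n m by apply: cj0; have := cWm 0%N; rewrite /= J0.
  suff -> : phi x = m by [].
  apply: ii; apply: hH => O1 O2 O1x O2m.
  have [k /= BO2] := Wm (i @^-1` O2) (ci _ _ O2m).
  have [_ e] := HJ k.
  have [y [/= O1y Dy By]] := evD _ _ _ e (cphi x Dx O1 O1x).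
  by exists (i (phi y)); split; [exact: O1y|exact: BO2].
exists C; split; [|by move=> x [[]]|].
- apply: comeagerI; first apply: comeagerI => //.
    by apply: comeager_forall => n; exact: comeager_locally_nonmeager.
  apply: comeager_forall => -[k n] /=.
  apply: (comeagerS _ (@comeager_locally_nonmeager_cover _ scQ
    (phi @^-1` B n) (fun j => [set x | good k n j /\ B j (phi x)]) _)).
    move=> x /= Hx /Hx[j ej]; exists j.
    have [gj|ngj] := pselect (good k n j).
      by split=> //; move: ej; congr (locally_nonmeager _ x);
        apply/seteqP; split=> y //= [].
    exfalso; apply: (@not_locally_nonmeager0 _ x); move: ej.
    by congr (locally_nonmeager _ x); apply/seteqP; split=> y //= [].
  move=> x /= Bx.
  have [W [oW Wx cW SW]] := S1 k (phi x) (B n) (open_nbhs_nbhs (conj (Bo n)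
    Bx)).
  have [j [Bjx BjW]] := Bb _ _ (open_nbhs_nbhs (conj oW Wx)).
  exists j => //; split=> //; split; first exact: S2 SW.
  by apply: subset_trans cW; apply: closure_subset.
- move=> x Cx O /Bb[n [Bx BO]].
  have evx : ev n x by case: Cx => -[_ H1] _; apply: H1.
  rewrite nbhsE; exists (ev n); first by split=> //;
    exact: open_locally_nonmeager.
  by move=> y evy Cy; apply/BO/key.
Qed.

(** The sets that agree with an open set off a meager set form a sigma-algebra containing the open
    sets. Hence each preimage of a basic open set is open up to a meager set, and countably many
    exceptional sets are discarded. *)
Lemma borel_cont_on (Q H : topologicalType) (f : Q -> H) :
  @second_countable H -> borel_function f ->
  exists2 D, comeager D & cont_on D f.
Proof.
move=> scH bf; have [B [Bo Bb]] := nat_basis scH.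
pose bp := [set A : set Q | exists2 U, open U & comeager [set x | A x <-> U x]].
have sbp : sigma_algebra setT bp.
  split.
  - by exists set0; [exact: open0|apply: comeagerS comeagerT => x _].
  - move=> A [U oU cU]; exists (~` U)°; first exact: open_interior.
    apply: (comeagerS _ (comeagerI (comeager_or_interiorC oU) cU)).
    move=> x [UU AU] /=; split=> [[_ nAx]|nUx].
      by case: UU => // Ux; case: nAx; apply/AU.
    by split=> // /AU Ux; apply: (interior_subset nUx).
  - move=> A bA; have /choice[U HU] : forall n, exists U, open U /\
        comeager [set x | A n x <-> U x].
      by move=> n; have [U ? ?] := bA n; exists U.
    exists (\bigcup_n U n); first by apply: bigcup_open => n _; exact: (HU n).1.
    apply: (comeagerS _ (comeager_forall (fun n => (HU n).2))) => x /= Hx.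
    by split=> -[n _ /Hx]; exists n.
have open_bp : <<s open >> `<=` bp.
  apply: smallest_sub => // U oU; exists U => //.
  by apply: comeagerS comeagerT.
have /choice[U HU] : forall n, exists U, open U /\
    comeager [set x | B n (f x) <-> U x].
  move=> n; have [|U ? ?] := open_bp (f @^-1` B n); last by exists U.
  by apply: bf; apply: sub_sigma_algebra.
exists [set x | forall n, B n (f x) <-> U n x].
  by apply: comeager_forall => n; exact: (HU n).2.
move=> x /= Dx O /Bb[n [/Dx Ux BO]]; rewrite nbhsE; exists (U n).
  by split=> //; exact: (HU n).1.
by move=> y Uy Dy; apply/BO/Dy.
Qed.

Lemma open_setX (S T : topologicalType) (A : set S) (B : set T) :
  open A -> open B -> open (A `*` B).
Proof.
move=> oA oB; rewrite openE => -[x y] [/= Ax By].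
by exists (A, B) => //; split; apply: open_nbhs_nbhs.
Qed.

(** The elementary half of the Kuratowski-Ulam theorem: for [U] open and dense and [B k] a nonempty
    basic set, the points [x] whose slice of [U] meets [B k] form an open dense set. *)
Lemma comeager_slices (S T : topologicalType) (E : set (S * T)) :
  @second_countable T -> comeager E ->
  comeager [set x | comeager [set t | E (x, t)]].
Proof.
move=> scT [U HU UE]; have [B [Bo Bb]] := nat_basis scT.
apply: (@comeagerS _ [set x | forall n k, B k !=set0 ->
    exists2 t, B k t & U n (x, t)]).
  move=> x /= Hx; exists (fun n => [set t | U n (x, t)]); last first.
    by move=> t Ut; apply: UE => n _; exact: Ut.
  move=> n; split.
    apply: (@open_comp _ _ (fun t => (x, t))); last exact: (HU n).1.
    by move=> t _; apply: cvg_pair; [exact: cvg_cst|exact: cvg_id].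
  move=> O [t Ot] oO; have [k [Bt BO]] := Bb t O (open_nbhs_nbhs (conj oO Ot)).
  have [|s Bs Us] := Hx n k; first by exists t.
  by exists s; split=> //; apply: BO.
apply: comeager_forall => n; apply: comeager_forall => k.
have [Bk|nBk] := pselect (B k !=set0); last first.
  by apply: comeagerS comeagerT => x _ /nBk.
have oU := (HU n).1.
apply: (@comeagerS _ [set x | exists2 t, B k t & U n (x, t)]) => //.
apply: open_dense_comeager.
  rewrite openE => x [t Bt Ut].
  have [[V W] /= [Vx Wt] VW] : nbhs (x, t) (U n) by apply: open_nbhs_nbhs.
  by apply: filterS Vx => y Vy; exists t => //; apply: VW; split=> //;
    exact: nbhs_singleton.
move=> O O0 oO.
have [||[x t] [[Ox Bt] Ut]] := (HU n).2 (O `*` B k).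
- by case: O0 Bk => x Ox [t Bt]; exists (x, t).
- exact: open_setX.
by exists x; split=> //; exists t.
Qed.

Lemma second_countable_of_basis (T : topologicalType) (J : countType)
    (B : J -> set T) : (forall n, open (B n)) ->
  (forall x O, nbhs x O -> exists n, B n x /\ B n `<=` O) ->
  @second_countable T.
Proof.
move=> Bo Bb; exists (range B).
  by apply: sub_countable (card_image_le _ _) _; exact: countableP.
split=> [_ [n _ <-]//|x O /Bb[n [Bx BO]]].
by exists (B n) => //; split=> //; exists n.
Qed.

Lemma polish_space_prod (S T : topologicalType) :
  polish_space S -> polish_space T -> polish_space (S * T)%type.
Proof.
move=> [hS scS [SS [SS1 SS2 SS3]]] [hT scT [ST [ST1 ST2 ST3]]]; split.
- move=> [x y] [x' y'] xy; congr (_, _).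
    apply: hS => A B Ax Bx'; have [||[a b] [[/= Aa _] [/= Ba _]]] :=
      xy (A `*` setT) (B `*` setT); last by exists a.
    + by exists (A, setT) => //; split=> //; exact: filterT.
    + by exists (B, setT) => //; split=> //; exact: filterT.
  apply: hT => A B Ay By'; have [||[a b] [[/= _ Ab] [/= _ Bb]]] :=
    xy (setT `*` A) (setT `*` B); last by exists b.
  + by exists (setT, A) => //; split=> //; exact: filterT.
  + by exists (setT, B) => //; split=> //; exact: filterT.
- have [B [Bo Bb]] := nat_basis scS; have [C [Co Cb]] := nat_basis scT.
  apply: (@second_countable_of_basis _ (nat * nat)%type
    (fun p => B p.1 `*` C p.2)) => [[m n]|[x y] O [[U V] /= [Ux Vy] UVO]].
    exact: open_setX.
  have [m [Bx BU]] := Bb _ _ Ux; have [n [Cy CV]] := Cb _ _ Vy.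
  by exists (m, n); split=> // -[a b] /= [/BU ? /CV ?]; apply: UVO.
- exists (fun n W => exists A B, [/\ SS n A, ST n B & W `<=` A `*` B]); split.
  + move=> n [x y] O [[U V] /= [Ux Vy] UVO].
    have [A [oA Ax cA SA]] := SS1 n x U Ux.
    have [B [oB By cB SB]] := ST1 n y V Vy.
    exists (A `*` B); split=> //; [exact: open_setX| |by exists A, B; split].
    move=> [a b] cab; apply: UVO; split=> /=.
      apply: cA => Z Za; have [|[a' b'] [[/= ? _] [/= ? _]]] :=
        cab (Z `*` setT).
        by exists (Z, setT) => //; split=> //; exact: filterT.
      by exists a'.
    apply: cB => Z Zb; have [|[a' b'] [[/= _ ?] [/= _ ?]]] := cab (setT `*` Z).
      by exists (setT, Z) => //; split=> //; exact: filterT.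
    by exists b'.
  + by move=> n A B AB [A' [B' [? ? s]]]; exists A', B'; split=> // x /AB/s.
  + move=> W SW Wd Wne.
    have [|||x Wx] := SS3 (fun n => fst @` W n).
    * move=> n; have [A [B [SA _ WAB]]] := SW n.
      by apply: SS2 SA => _ [z /WAB[? _] <-].
    * by move=> n _ [z /Wd Wz <-]; exists z.
    * by move=> n; have [z Wz] := Wne n; exists z.1; exists z.
    have [|||y Wy] := ST3 (fun n => snd @` W n).
    * move=> n; have [A [B [_ SB WAB]]] := SW n.
      by apply: ST2 SB => _ [z /WAB[_ ?] <-].
    * by move=> n _ [z /Wd Wz <-]; exists z.
    * by move=> n; have [z Wz] := Wne n; exists z.2; exists z.
    exists (x, y) => O [[U V] /= [/Wx[m WU] /Wy[n WV]] UVO].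
    exists (maxn m n) => z Wz; apply: UVO; split.
      by apply: WU; exists z => //; apply: (nested_le Wd) Wz; exact: leq_maxl.
    by apply: WV; exists z => //; apply: (nested_le Wd) Wz; exact: leq_maxr.
Qed.

Lemma nbhs_set_type (T : topologicalType) (A : set T) (x : set_type A)
    (O : set (set_type A)) :
  nbhs x O <-> exists2 V, open_nbhs (set_val x) V & set_val @^-1` V `<=` O.
Proof.
rewrite nbhsE; split=> [[_ [[V oV <-] Vx] VO]|[V [oV Vx] VO]].
  by exists V.
by exists (set_val @^-1` V) => //; split=> //; exists V.
Qed.

Lemma set_valK (T : Type) (A : set T) x (Ax : A x) :
  exists y : set_type A, set_val y = x.
Proof. by exists (exist _ x (mem_set Ax)). Qed.

(** * Closed and G_delta subspaces of Polish spaces *)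

Section SubPolish.
Variables (T : topologicalType) (A : set T).
Hypothesis pT : polish_space T.

Lemma hausdorff_set_type : hausdorff_space (set_type A).
Proof.
have [hT _ _] := pT; move=> x y xy; apply: val_inj; apply: hT => U V.
rewrite !nbhsE => -[U' U'x U'U] [V' V'y V'V].
have [||z [Uz Vz]] := xy (set_val @^-1` U') (set_val @^-1` V').
- by apply/nbhs_set_type; exists U'.
- by apply/nbhs_set_type; exists V'.
by exists (set_val z); split; [apply: U'U|apply: V'V].
Qed.

Lemma second_countable_set_type : @second_countable (set_type A).
Proof.
have [_ scT _] := pT; have [B [Bo Bb]] := nat_basis scT.
apply: (@second_countable_of_basis _ nat (fun n => set_val @^-1` B n)).
  by move=> n; exists (B n).
move=> x O /nbhs_set_type[V /open_nbhs_nbhs/Bb[n [Bx BV]] VO].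
by exists n; split=> // y /BV/VO.
Qed.

(** A limit exists in the ambient space; [P n] is the extra smallness imposed at stage [n] to force
    that limit back into [A]. It is void for a closed set, and for the intersection of the [U n] it
    says that the closure lies in [U n]. *)
Lemma polish_space_subset (P : nat -> set T -> Prop) :
  (forall n x, A x -> exists2 V, nbhs x V & P n V) ->
  (forall n V W, W `<=` V -> P n V -> P n W) ->
  (forall (W : nat -> set T) x, (forall n, W n `<=` A) -> (forall n, P n (W n))
    ->
    (forall n, closure (W n) x) -> A x) ->
  polish_space (set_type A).
Proof.
move=> P1 Ph P2; split; first exact: hausdorff_set_type.
  exact: second_countable_set_type.
have [_ _ [S [S1 S2 S3]]] := pT.
exists (fun n W => S n (set_val @` W) /\ P n (set_val @` W)); split.
- move=> n x O /nbhs_set_type[V Vx VO].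
  have Ax : A (set_val x) := set_mem (valP x).
  have [V' V'x PV'] := P1 n _ Ax.
  have [|W [oW Wx cW SW]] := S1 n (set_val x) (V `&` V').
    by apply: filterI => //; exact: open_nbhs_nbhs.
  have sW : set_val @` (@set_val _ A @^-1` W) `<=` W by move=> _ [z Wz <-].
  exists (set_val @^-1` W); split=> //; [by exists W| |].
    move=> y cy; apply: VO; suff : closure W (set_val y) by move=> /cW[].
    move=> Z; rewrite nbhsE => -[Z' Z'y Z'Z].
    have [|z [Wz Z'z]] := cy (set_val @^-1` Z').
      by apply/nbhs_set_type; exists Z'.
    by exists (set_val z); split=> //; apply: Z'Z.
  split; first exact: S2 SW.
  by apply: Ph PV' => z /sW/subset_closure/cW[].
- by move=> n B C BC [SC PC]; split; [apply: S2 SC|apply: Ph PC];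
    move=> _ [y /BC Cy <-]; exists y.
- move=> W SW Wd Wne.
  pose V n := set_val @` W n.
  have Vd n : V n.+1 `<=` V n by move=> _ [y /Wd Wy <-]; exists y.
  have Vne n : V n !=set0 by have [y Wy] := Wne n; exists (set_val y), y.
  have [|x Vx] := S3 V _ Vd Vne; first by move=> n; have [] := SW n.
  have Ax : A x.
    apply: (P2 V) => [n _ [y _ <-]|n|]; first exact: set_mem (valP y).
      by have [] := SW n.
    exact: sieve_limit_closure.
  have [y yx] := set_valK Ax.
  exists y => O /nbhs_set_type[U oU UO].
  rewrite yx in oU; have [n VU] := Vx U (open_nbhs_nbhs oU).
  by exists n => z Wz; apply/UO/VU; exists z.
Qed.

Lemma polish_space_closed : closed A -> polish_space (set_type A).
Proof.
move=> cA; apply: (polish_space_subset (P := fun _ _ => True)) => //.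
  by move=> n x _; exists setT => //; exact: filterT.
by move=> W x WA _ /(_ 0%N)/(closureS (WA 0%N)); apply: cA.
Qed.

Lemma polish_space_Gdelta (U : nat -> set T) : (forall n, open (U n)) ->
  A = \bigcap_n U n -> polish_space (set_type A).
Proof.
move=> oU AU.
apply: (polish_space_subset (P := fun n W => closure W `<=` U n)).
- move=> n x; rewrite AU => Ux; have [_ _ [S [S1 _ _]]] := pT.
  have [|W [oW Wx cW _]] := S1 0%N x (U n).
    by apply: open_nbhs_nbhs; split=> //; apply: Ux.
  by exists W => //; exact: open_nbhs_nbhs.
- by move=> n V W WV; apply: subset_trans; exact: closureS.
- by move=> W x _ WU Wx; rewrite AU => n _; apply: (WU n).
Qed.

End SubPolish.

Section CompleteMetric.
Import Order.TTheory GRing.Theory Num.Theory numFieldTopology.Exports.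
Local Open Scope ring_scope.

(** In the sieve, a set is small of order [n] when [h] sends it into a ball of radius 1/(n+1); a
    decreasing sequence of nonempty small sets then generates a Cauchy filter. *)
Lemma polish_space_metrizable (R : realType) (T : topologicalType) :
  separable T -> completely_metrizable R T -> polish_space T.
Proof.
move=> [D cD dD] [M cM [h [k [hk kh ch ck]]]].
have nbhsh x O : nbhs x O -> exists n : nat,
    h @^-1` ball (h x) (n.+1%:R^-1) `<=` O.
  move=> xO; have : nbhs (h x) (k @^-1` O) by apply: ck; rewrite hk.
  rewrite -nbhs_ballE => -[e /= e0 eO].
  have [n ne] : exists n : nat, n.+1%:R^-1 < e.
    by have [n] := ltr_add_invr e0; rewrite add0r; exists n.
  exists n => y hy; rewrite -[y]hk; apply: eO.
  by apply: le_ball hy; exact: ltW.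
have nbhsb x e : 0 < e -> nbhs x (h @^-1` ball (h x) e).
  by move=> e0; apply: ch; apply: nbhsx_ballx.
have inv0 (n : nat) : 0 < (n.+1%:R : R)^-1 by rewrite invr_gt0.
have half (n : nat) : ((n.*2.+1).+1%:R : R)^-1 = n.+1%:R^-1 / 2.
  rewrite -invfM; congr (_^-1); rewrite -natrM; congr (_%:R).
  by rewrite muln2 doubleS.
split.
- move=> x y xy; rewrite -[x]hk -[y]hk; congr k; apply: (@metric_hausdorff _ M).
  move=> A B /ch hA /ch hB; have [z [Az Bz]] := xy _ _ hA hB.
  by exists (h z).
- have /pfcard_geP[D0|/unsquash f] := cD.
    exists set0 => //; split=> // x.
    have [||y] := dD setT; [by exists x|exact: openT|].
    by rewrite D0 setI0 => -[].
  apply: (@second_countable_of_basis _ (nat * nat)%type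
    (fun p => (h @^-1` ball (h (f p.1)) (p.2.+1%:R^-1))°)).
    by move=> p; exact: open_interior.
  move=> x O /nbhsh[n nO].
  (* [r.+1] is 4(n+1). For a dense point [z] within that quarter radius of [x], the ball of half
     radius around [z] contains the quarter ball around [x] and stays inside the ball of radius
     1/(n+1) around [x]. *)
  pose r := (n.*2.+1).*2.+1.
  have r2 : (r.+1%:R : R)^-1 = n.+1%:R^-1 / 2 / 2 by rewrite !half.
  have [||z [/interior_subset/= Bz Dz]] := dD ((h @^-1` ball (h x)
    r.+1%:R^-1)°).
  - by exists x; apply: nbhsb.
  - exact: open_interior.
  have [m _ fm] := @surj _ _ _ _ f z Dz.
  exists (m, n.*2.+1); rewrite /= fm half; split.
    apply: filterS (nbhsb x _ (inv0 r)) => y /= xy.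
    rewrite [_ / 2]splitr -r2; apply: ball_triangle xy.
    exact: ball_sym.
  move=> y /interior_subset/= zy; apply: nO => /=.
  rewrite [_^-1]splitr; apply: ball_triangle zy; apply: le_ball Bz.
  by rewrite r2 -[leRHS]divr1 ler_pM2l ?divr_gt0// lef_pV2 ?posrE// ler1n.
- exists (fun n W => exists x, forall y, W y -> ball x (n.+1%:R^-1 : R) (h y)).
  split.
  + move=> n x O xO; have [m mO] := nbhsh x O xO.
    (* The first bound leaves room for passing to the closure; the second makes the set small of
       order [n]. *)
    pose e : R := Num.min (m.+1%:R^-1 / 2) n.+1%:R^-1.
    have e0 : 0 < e by rewrite lt_min divr_gt0//= inv0.
    exists (h @^-1` ball (h x) e)°; split=> //.
    * exact: open_interior.
    * exact: nbhsb.
    * move=> y cy; apply: mO => /=.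
      have [|z [/interior_subset/= xz yz]] := cy (h @^-1` ball (h y) e).
        exact: nbhsb.
      rewrite [_^-1]splitr; apply: (@ball_triangle _ _ (h z)).
        by apply: le_ball xz; rewrite ge_min lexx.
      by apply: ball_sym; apply: le_ball yz; rewrite ge_min lexx.
    * exists (h x) => y /interior_subset/=; apply: le_ball.
      by rewrite ge_min lexx orbT.
  + by move=> n A B AB [x Bx]; exists x => y /AB/Bx.
  + move=> W SW Wd Wne.
    pose F := filter_from [set: nat] (fun n => h @` W n).
    have FF : ProperFilter F.
      apply: filter_from_proper => [|n _]; last first.
        by have [y Wy] := Wne n; exists (h y), y.
      apply: filter_from_filter; first by exists 0%N.
      move=> i j _ _; exists (maxn i j) => // _ [y Wy <-].
      by split; exists y => //; apply: (nested_le Wd) Wy;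
        rewrite (leq_maxl, leq_maxr).
    have [|x Fx] := cM F FF.
      apply/cauchy_ballP => e e0.
      have [n] := ltr_add_invr e0; rewrite add0r => ne.
      (* The index 2n+1 gives half the radius 1/(n+1), so two points near a common centre are within
         1/(n+1) of each other. *)
      have [x xW] := SW n.*2.+1.
      exists (h @` W n.*2.+1, h @` W n.*2.+1) => /=.
        by split; exists n.*2.+1.
      move=> [a b] [/= [y Wy <-] [z Wz <-]].
      apply: le_ball (ltW ne) _ _; rewrite [_^-1]splitr -half.
      by apply: (@ball_triangle _ _ x); [apply/ball_sym/xW|exact: xW].
    exists (k x) => O xO; have [|n _ WO] := Fx (k @^-1` O).
      exact: ck.
    by exists n => y Wy; rewrite -[y]hk; apply: WO; exists y.
Qed.

End CompleteMetric.

Lemma polish_group_space (R : realType) (G : polishGroupType R)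
  : polish_space G.
Proof.
exact: polish_space_metrizable polish_separable (@polish_metrizable R G).
Qed.

(** * Completeness of topological groups *)

Section Metrized.
Import Order.TTheory GRing.Theory Num.Theory numFieldTopology.Exports.
Local Open Scope ring_scope.
Variables (R : realType) (M : pseudoMetricType R).
Hypothesis bounded : forall x y : M, @ball R M x 2 y.
Hypothesis hM : hausdorff_space M.

(** The [let]s make both hypotheses parameters of the type, so that a metric whose axioms depend on
    them can be attached to it. *)
Definition metrized : Type := let _ := bounded in let _ := hM in M.

(** A pseudometric type provides balls only; the distance is recovered as an infimum of radii, taken
    over a nonempty set thanks to [bounded]. *)
Definition ball_dist (x y : M) : R := inf [set d | 0 < d /\ @ball R M x d y].

Let has_inf_ball x y : has_inf [set d | 0 < d /\ @ball R M x d y].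
Proof. by split; [exists 2|exists 0 => d [/ltW]]. Qed.

Lemma ball_dist_le x y d : 0 < d -> ball x d y -> ball_dist x y <= d.
Proof. by move=> d0 xy; apply: ge_inf => //; have [] := has_inf_ball x y. Qed.

Lemma ball_dist_lt x y d : ball_dist x y < d -> ball x d y.
Proof.
rewrite -subr_gt0 => /(inf_adherent)/(_ (has_inf_ball x y))[e [e0 xe]].
rewrite -/(ball_dist x y) addrC subrK => /ltW ed.
exact: le_ball xe.
Qed.

Let dist_ge0 x y : 0 <= ball_dist x y.
Proof. by apply: lb_le_inf => [|d [/ltW]//]; have [] := has_inf_ball x y. Qed.

Let distxx x : ball_dist x x = 0.
Proof.
apply/eqP; rewrite eq_le dist_ge0 andbT; apply/ler_addgt0Pl => e e0.
by rewrite addr0; apply: ball_dist_le => //; exact: ballxx.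
Qed.

Let dist_positivity x y : ball_dist x y = 0 -> x = y.
Proof.
move=> xy0; apply: hM => A B; rewrite -!nbhs_ballE => -[e /= e0 eA] yB.
exists y; split; last by case: yB => d /= d0; apply; exact: ballxx.
by apply/eA/ball_dist_lt; rewrite xy0.
Qed.

Let dist_sym x y : ball_dist x y = ball_dist y x.
Proof.
by congr inf; apply/seteqP; split=> d [d0 /ball_sym].
Qed.

Let dist_triangle y x z : ball_dist x z <= ball_dist x y + ball_dist y z.
Proof.
apply/ler_addgt0Pl => e e0; rewrite [e]splitr addrACA.
apply: ball_dist_le; first by rewrite addr_gt0// ltr_pwDl// divr_gt0.
by apply: (@ball_triangle _ _ y); apply: ball_dist_lt;
  rewrite ltrDr divr_gt0.
Qed.

HB.instance Definition _ := Choice.copy metrized M.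
HB.instance Definition _ := @isMetric.Build R metrized ball_dist
  distxx dist_positivity dist_sym dist_triangle.

Lemma metrized_ballP x y d : @ball R metrized x d y = (ball_dist x y < d)
  :> Prop.
Proof. by []. Qed.

Lemma metrized_nbhs (x : M) (A : set M) : nbhs x A <-> nbhs (x : metrized) A.
Proof.
rewrite -!nbhs_ballE; split=> -[e /= e0 eA]; last first.
  (* Lying in a ball of radius d only bounds the infimum by d in the weak sense; halving restores
     the strict inequality. *)
  exists (e / 2) => /=; first by rewrite divr_gt0.
  move=> y xy; apply: eA; rewrite metrized_ballP.
  by apply: le_lt_trans (ball_dist_le _ xy) _;
    rewrite ?divr_gt0// ltr_pdivrMr// ltr_pMr// ltr1n.
by exists e => // y xy; apply/eA/ball_dist_lt.
Qed.

Lemma metrized_complete : complete_space M -> complete_space metrized.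
Proof.
move=> cM F FF cF; have [|x Fx] := cM F FF.
  apply/cauchy_ballP => e e0; have /cauchy_ballP/(_ e e0) := cF.
  apply: filterS => -[a b]; exact: ball_dist_lt.
by exists x => A /metrized_nbhs/Fx.
Qed.

End Metrized.

Local Open Scope group_scope.

(** * The two-sided uniformity and its completeness *)

Section TopologicalGroup.
Variable K : topologicalGroupType.
Implicit Types (x y : K) (V O : set K).

Lemma nbhs_mulg x y O : nbhs (x * y) O ->
  exists V W, [/\ nbhs x V, nbhs y W & forall a b, V a -> W b -> O (a * b)].
Proof.
move=> /(@mulg_continuous K (x, y))[[V W] /= [Vx Wy] VW].
by exists V, W; split=> // a b Va Wb; apply: (VW (a, b)).
Qed.

Lemma mulg_cvg (T : Type) (F : set_system T) (FF : Filter F) (f g : T -> K)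
  x y :
  f @ F --> x -> g @ F --> y -> (fun t => f t * g t) @ F --> x * y.
Proof.
by move=> fx gy; apply: continuous2_cvg fx gy; exact: (@mulg_continuous K (x,
  y)).
Qed.

Lemma invg_cvg (T : Type) (F : set_system T) (FF : Filter F) (f : T -> K) x :
  f @ F --> x -> (fun t => (f t)^-1) @ F --> x^-1.
Proof. by move=> fx; apply: continuous_cvg fx; exact: invg_continuous. Qed.

Lemma mulgl_continuous x : continuous (fun y => x * y).
Proof. by move=> y; apply: mulg_cvg; [exact: cvg_cst|exact: cvg_id]. Qed.

Lemma mulgr_continuous x : continuous (fun y => y * x).
Proof. by move=> y; apply: mulg_cvg; [exact: cvg_id|exact: cvg_cst]. Qed.

Lemma nbhs1_mull x O : nbhs x O -> nbhs (1 : K) [set v | O (x * v)].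
Proof. by move=> xO; apply: mulgl_continuous; rewrite mulg1. Qed.

Lemma nbhs1_mulr x O : nbhs x O -> nbhs (1 : K) [set v | O (v * x)].
Proof. by move=> xO; apply: mulgr_continuous; rewrite mul1g. Qed.

Lemma nbhs_mulVl x V : nbhs (1 : K) V -> nbhs x [set y | V (x^-1 * y)].
Proof. by move=> V1; apply: mulgl_continuous; rewrite mulVg. Qed.

Lemma nbhs_mulVr x V : nbhs (1 : K) V -> nbhs x [set y | V (y * x^-1)].
Proof. by move=> V1; apply: mulgr_continuous; rewrite mulgV. Qed.

Lemma nbhs1_square V : nbhs (1 : K) V ->
  exists2 W, nbhs (1 : K) W & forall a b, W a -> W b -> V (a * b).
Proof.
rewrite -{1}[1]mulg1 => /nbhs_mulg[A [B [A1 B1 AB]]].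
by exists (A `&` B) => [|a b [Aa _] [_ Bb]]; [exact: filterI|exact: AB].
Qed.

Lemma nbhs1_inv V : nbhs (1 : K) V -> nbhs (1 : K) [set x | V x^-1].
Proof. by move=> V1; apply: invg_continuous; rewrite invg1. Qed.

Definition two_sided : Type := K.

HB.instance Definition _ := Topological.on two_sided.

(** The common refinement of the left and right uniformities: closeness is required on both sides at
    once. *)
Definition two_sided_ent : set_system (K * K) := [set E | exists2 V,
  nbhs (1 : K) V &
  forall x y, V (x^-1 * y) -> V (y * x^-1) -> E (x, y)].

Let ent_filter : Filter two_sided_ent.
Proof.
split.
- by exists setT => //; exact: filterT.
- move=> A B [V V1 VA] [W W1 WB]; exists (V `&` W); first exact: filterI.
  by move=> x y [? ?] [? ?]; split; [exact: VA|exact: WB].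
- by move=> A B AB [V V1 VA]; exists V => // x y *; apply/AB/VA.
Qed.

Let ent_diagonal (A : set (K * K)) : two_sided_ent A ->
  (diagonal `<=` A)%classic.
Proof.
move=> [V V1 VA] [x y] xy; have {xy}-> : x = y := xy; apply: VA;
  rewrite ?mulVg ?mulgV;
  exact: nbhs_singleton.
Qed.

Let ent_inv (A : set (K * K)) : two_sided_ent A ->
  two_sided_ent (A^-1)%relation.
Proof.
move=> [V V1 VA]; exists [set x | V x^-1]; first exact: nbhs1_inv.
by move=> x y /=; rewrite !invgM !invgK; exact: VA.
Qed.

Let ent_split (A : set (K * K)) : two_sided_ent A ->
  exists2 B, two_sided_ent B & ((B \; B)%relation `<=` A)%classic.
Proof.
move=> [V V1 VA]; have [W W1 WV] := nbhs1_square V1.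
exists [set xy | W (xy.1^-1 * xy.2) /\ W (xy.2 * xy.1^-1)]; first by exists W.
move=> [x z] [y /= [Wxy Wyx] [Wyz Wzy]]; apply: VA.
  by have := WV _ _ Wxy Wyz; rewrite mulgA mulgK.
by have := WV _ _ Wzy Wyx; rewrite mulgA mulgVK.
Qed.

Let ent_nbhs : (nbhs : two_sided -> set_system two_sided) = nbhs_ two_sided_ent.
Proof.
apply/funext => x; apply/seteqP; split=> A.
  move=> xA; exists [set yz | yz.1 = x -> A yz.2]; last first.
    by move=> y /xsectionP/(_ erefl).
  exists [set v | A (x * v)]; first exact: nbhs1_mull.
  by move=> y z /= + _ yx; rewrite yx mulgA mulgV mul1g.
move=> [E [V V1 VE] EA].
have : nbhs (x : K) A; last by [].
by apply: filterS (filterI (nbhs_mulVl x V1) (nbhs_mulVr x V1)) => y [Vxy Vyx];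
  apply/EA/xsectionP/VE.
Qed.

HB.instance Definition _ := Nbhs_isUniform_mixin.Build two_sided
  ent_filter ent_diagonal ent_inv ent_split ent_nbhs.

Lemma two_sided_countable : @second_countable K ->
  countable_uniformity two_sided.
Proof.
move=> /nat_basis[B [Bo Bb]]; apply/countable_uniformityP.
(* The guard [B n 1] turns [E n] into the full relation when [B n] is not a neighbourhood of 1. *)
pose E n : set (K * K) :=
  [set xy | B n 1 -> B n (xy.1^-1 * xy.2) /\ B n (xy.2 * xy.1^-1)].
exists E => [A [V /Bb[n [B1 BV]] VA]|n].
  by exists n => -[x y] /(_ B1)[/= ? ?]; apply: VA; exact: BV.
have [B1|nB1] := pselect (B n 1); last first.
  by exists setT => [|x y _ _ /nB1//]; exact: filterT.
by exists (B n) => //; exact: open_nbhs_nbhs.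
Qed.

Definition two_sided_cauchy (F : set_system K) := forall V, nbhs (1 : K) V ->
  exists A, F A /\ forall x y, A x -> A y -> V (x^-1 * y) /\ V (x * y^-1).

Lemma cauchy_two_sided (F : set_system two_sided) : Filter F ->
  cauchy F -> two_sided_cauchy F.
Proof.
move=> FF cF V V1; have [|[A B] /= [FA FB] AB] :=
    cF [set xy | V (xy.1^-1 * xy.2) /\ V (xy.1 * xy.2^-1)].
  have V1' := filterI V1 (nbhs1_inv V1).
  exists (V `&` [set x | V x^-1]); first exact: V1'.
  by move=> x y [Vxy _] [_ /=]; rewrite invgM invgK.
exists (A `&` B); split; first exact: filterI.
by move=> x y [Ax _] [_ By]; apply: (AB (x, y)).
Qed.

Variables (Y : topologicalType) (q : Y -> K).
Hypotheses (pY : polish_space Y) (cq : continuous q).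
Hypothesis open_q : forall U : set Y, open U -> open (q @` U).

(* A two-sided Cauchy filter [F] is written as [q y * q y'] by shrinking
   neighbourhoods of [y] and [y'] alternately: [factors_r] says that
   [lim F = w * w'] for some [w] in [O] and some ideal [w'] well inside [O'], and
   [factors_l] exchanges the roles of [O] and [O']. *)
Section Factors.
Variable F : set_system K.
Hypotheses (FF : ProperFilter F) (cF : two_sided_cauchy F).

Definition factors_r O O' := exists2 w, O w & exists2 V, nbhs (1 : K) V &
  F [set z | forall v, V v -> O' (w^-1 * z * v)].

Definition factors_l O O' := exists2 w, O' w & exists2 V, nbhs (1 : K) V &
  F [set z | forall v, V v -> O (v * z * w^-1)].

(** The new factor is w^-1 z0 for one sample [z0] of the filter. Then v z (w^-1 z0)^-1 = v (z z0^-1)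
    w stays in [O], because z z0^-1 is small: this uses one side of the Cauchy condition. *)
Lemma factors_rl O O' : open O -> factors_r O O' -> factors_l O O'.
Proof.
move=> oO [w Ow [V V1 FV]].
have /nbhs1_square[W W1 WW] := nbhs1_mulr (open_nbhs_nbhs (conj oO Ow)).
have [A [FA AW]] := cF W1.
have [z0 [Az0 Oz0]] := filter_ex (filterI FA FV).
exists (w^-1 * z0); first by have := Oz0 1 (nbhs_singleton V1); rewrite mulg1.
exists W => //; apply: filterS FA => z Az v Wv.
have [_ Wz] := AW _ _ Az Az0.
by have := WW _ _ Wv Wz; rewrite /= invgM invgK !mulgA.
Qed.

(** Symmetric to [factors_rl], now through the smallness of z0^-1 z, which is the other side of the
    Cauchy condition. *)
Lemma factors_lr O O' : open O' -> factors_l O O' -> factors_r O O'.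
Proof.
move=> oO [w Ow [V V1 FV]].
have /nbhs1_square[W W1 WW] := nbhs1_mull (open_nbhs_nbhs (conj oO Ow)).
have [A [FA AW]] := cF W1.
have [z0 [Az0 Oz0]] := filter_ex (filterI FA FV).
exists (z0 * w^-1); first by have := Oz0 1 (nbhs_singleton V1); rewrite mul1g.
exists W => //; apply: filterS FA => z Az v Wv.
have [Wz _] := AW _ _ Az0 Az.
by have := WW _ _ Wz Wv; rewrite /= invgM invgK !mulgA.
Qed.

Hypothesis surj_q : forall x : K, exists y : Y, q y = x.

Lemma two_sided_limit : exists x : K, F --> x.
Proof.
have [_ _ [S [S1 S2 S3]]] := pY.
(* One round: shrink [W] around a preimage of the left factor, exchange roles, shrink [W'] around a
   preimage of the new right factor, and exchange back. Openness of [q] keeps both images open, as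
   the exchanges require. *)
have step n (W W' : set Y) : open W -> open W' -> factors_r (q @` W) (q @` W')
  ->
    exists W1 W1', [/\ [/\ open W1, W1 `<=` W & S n W1],
      [/\ open W1', W1' `<=` W' & S n W1'] & factors_r (q @` W1) (q @` W1')].
  move=> oW oW' [_ [y Wy <-] Hy].
  have [W1 [oW1 W1y cW1 SW1]] := S1 n y W (open_nbhs_nbhs (conj oW Wy)).
  have [|_ [y' Wy' <-] Hy'] := factors_rl (open_q oW1) (O' := q @` W').
    by exists (q y) => //; exists y.
  have [W1' [oW1' W1y' cW1' SW1']] := S1 n y' W' (open_nbhs_nbhs (conj oW'
    Wy')).
  exists W1, W1'; split.
  - by split=> //; apply: subset_trans cW1; exact: subset_closure.
  - by split=> //; apply: subset_trans cW1'; exact: subset_closure.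
  - apply: factors_lr; first exact: open_q.
    by exists (q y') => //; exists y'.
have qT : q @` setT = setT.
  by apply/seteqP; split=> // x _; have [y <-] := surj_q x; exists y.
have [|W0 [W0' [[oW0 _ SW0] [oW0' _ SW0'] f0]]] :=
  step 0%N setT setT openT openT.
  rewrite qT; exists 1 => //; exists setT; first exact: filterT.
  by apply: filterS (@filterT _ F _).
have [|n [W W'] /= [oW oW' SW SW' f]|WW [_ HW RW]] := @dependent_choice _
  (fun n (p : set Y * set Y) => [/\ open p.1, open p.2, S n p.1, S n p.2 &
    factors_r (q @` p.1) (q @` p.2)])
  (fun n p p' => p'.1 `<=` p.1 /\ p'.2 `<=` p.2) (W0, W0').
- by [].
- have [W1 [W1' [[? ? ?] [? ? ?] ?]]] := step n.+1 W W' oW oW' f.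
  by exists (W1, W1').
have d1 n : (WW n.+1).1 `<=` (WW n).1 by have [] := RW n.
have d2 n : (WW n.+1).2 `<=` (WW n).2 by have [] := RW n.
have [|||y Hy] := S3 (fun n => (WW n).1).
- by move=> n; have [] := HW n.
- exact: d1.
- by move=> n; have [_ _ _ _ [_ [y Wy _] _]] := HW n; exists y.
have [|||y' Hy'] := S3 (fun n => (WW n).2).
- by move=> n; have [] := HW n.
- exact: d2.
- move=> n; have [o1 o2 _ _ /(factors_rl (open_q o1))] := HW n.
  by move=> [_ [z Wz _] _]; exists z.
(* At every stage the filter contains a set of products q u * q u' with [u] and [u'] in the two
   current sets, and these shrink to [y] and [y']. *)
exists (q y * q y') => O /nbhs_mulg[A [A' [yA yA' AA']]].
have [m mA] := Hy _ (cq yA); have [k kA'] := Hy' _ (cq yA').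
have [_ _ _ _ [_ [u Wu <-] [V V1 FV]]] := HW (maxn m k).
rewrite nbhs_simpl; apply: filterS FV => z /(_ 1 (nbhs_singleton V1)).
rewrite mulg1 => -[u' Wu' e].
have -> : z = q u * q u' by rewrite e mulgA mulgV mul1g.
apply: AA'; [apply: mA; apply: (nested_le d1) Wu|
             apply: kA'; apply: (nested_le d2) Wu'].
  exact: leq_maxl.
exact: leq_maxr.
Qed.

End Factors.

End TopologicalGroup.

Lemma second_countable_separable (T : topologicalType) :
  @second_countable T -> separable T.
Proof.
move=> /nat_basis[B [Bo Bb]].
have /choice[f Hf] : forall n, exists A : set T, A `<=` B n /\
    (B n !=set0 -> exists2 x, A = [set x] & B n x).
  move=> n; have [[x Bx]|nB] := pselect (B n !=set0).
    exists [set x]; split=> [_ -> //|_]; by exists x.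
  by exists set0; split=> // /nB.
exists (\bigcup_n f n).
  apply: bigcup_countable => // n _; have [fB Hn] := Hf n.
  have [/Hn[x -> _]|nB] := pselect (B n !=set0); first exact: countable1.
  suff -> : f n = set0 by exact: countable0.
  by apply/seteqP; split=> // x /fB Bx; apply: nB; exists x.
move=> O [x Ox] oO; have [n [Bx BO]] := Bb x O (open_nbhs_nbhs (conj oO Ox)).
have [_ [|y fy By]] := Hf n; first by exists x.
by exists y; split; [exact: BO|exists n => //; rewrite fy].
Qed.

(** * Groups that are open images of Polish spaces *)

Section OpenImage.
Variables (R : realType) (K : topologicalGroupType).
Variables (Y : topologicalType) (q : Y -> K).
Hypotheses (pY : polish_space Y) (hK : hausdorff_space K) (cq : continuous q).
Hypothesis open_q : forall U : set Y, open U -> open (q @` U).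
Hypothesis surj_q : forall x : K, exists y : Y, q y = x.

Lemma second_countable_open_image : @second_countable K.
Proof.
have [_ /nat_basis[B [Bo Bb]] _] := pY.
apply: (@second_countable_of_basis _ nat (fun n => q @` B n)).
  by move=> n; apply: open_q.
move=> x O; have [y <-] := surj_q x => /cq/Bb[n [By BO]].
by exists n; split; [exists y|move=> _ [z Bz <-]; exact: BO].
Qed.

Lemma separable_open_image : separable K.
Proof. exact: second_countable_separable second_countable_open_image. Qed.

(** Second countability gives the two-sided uniformity a countable base, hence a pseudometric whose
    balls of radius 2 are everything; Hausdorffness makes it a metric and [two_sided_limit] makes it
    complete. *)
Lemma completely_metrizable_open_image : completely_metrizable R K.
Proof.
have cu := two_sided_countable second_countable_open_image.
pose M : pseudoMetricType R := @countable_uniform.type (two_sided K) cu.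
have bM (x y : M) : @ball R M x 2 y :=
  countable_uniform.countable_uniform_bounded cu x y.
exists (metrized bM hK).
  apply: metrized_complete => F FF cF.
  exact: (two_sided_limit pY cq open_q FF (cauchy_two_sided _ cF) surj_q).
by exists id, id; split=> // x A; have [] := metrized_nbhs bM hK x A.
Qed.

End OpenImage.

(** * Polish subgroups *)

Definition subgroup_set (G : groupType) (N : set G) :=
  N 1 /\ forall x y, N x -> N y -> N (x / y).

Lemma subgroup_setV (G : groupType) (N : set G) x :
  subgroup_set N -> N x -> N x^-1.
Proof. by move=> [N1 Nd] /(Nd _ _ N1); rewrite mul1g. Qed.

Lemma subgroup_setM (G : groupType) (N : set G) x y :
  subgroup_set N -> N x -> N y -> N (x * y).
Proof. by move=> sN Nx /(subgroup_setV sN) Ny; rewrite -[y]invgK;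
  apply: sN.2. Qed.

Section Image.
Variables (G : topologicalGroupType) (Y : topologicalType) (q : Y -> G).
Hypotheses (hG : hausdorff_space G) (pY : polish_space Y) (cq : continuous q).
Hypothesis sub_q : subgroup_set (range q).
Hypothesis sat_q : forall (U : set Y) y z, open U -> U y -> q y = q z ->
  nbhs z [set z' | exists2 y', U y' & q y' = q z'].
(** One well chosen triple of representatives per pair is enough: [img_pi] is open, so continuity at
    these representatives descends to the quotient. *)
Hypothesis mul_q : forall a b, range q a -> range q b -> exists y1 y2 y3,
  [/\ q y1 = a, q y2 = b, q y3 = a * b & forall O, nbhs y3 O ->
    exists V1 V2, [/\ nbhs y1 V1, nbhs y2 V2 & forall z1 z2, V1 z1 -> V2 z2 ->
      exists2 z3, O z3 & q z3 = q z1 * q z2]].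
Hypothesis inv_q : forall a, range q a -> exists y1 y2,
  [/\ q y1 = a, q y2 = a^-1 & forall O, nbhs y2 O ->
    exists2 V, nbhs y1 V & forall z1, V z1 -> exists2 z2, O z2 &
      q z2 = (q z1)^-1].

(* The carrier is a bare [sig] because [set_type] lives in a universe above that
   of the carriers of [polishGroupType]. *)
Definition img : Type :=
  let _ := (hG, pY, cq, sub_q, sat_q, mul_q, inv_q) in {x : G | x \in range q}.

HB.instance Definition _ := Choice.copy img {x : G | x \in range q}.

Definition img_val (x : img) : G := sval (x : {x : G | x \in range q}).

Lemma img_val_inj : injective img_val.
Proof. by move=> x y; apply: val_inj. Qed.

Lemma img_valP (x : img) : range q (img_val x).
Proof. exact: set_mem (svalP (x : {x : G | x \in range q})). Qed.

Definition to_img a (qa : range q a) : img := exist _ a (mem_set qa).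

Definition img_mul (x y : img) : img :=
  to_img (subgroup_setM sub_q (img_valP x) (img_valP y)).
Definition img_inv (x : img) : img := to_img (subgroup_setV sub_q (img_valP x)).
Definition img_one : img := to_img sub_q.1.

Let mulA : associative img_mul.
Proof. by move=> x y z; apply: img_val_inj; apply: mulgA. Qed.
Let mul1 : left_id img_one img_mul.
Proof. by move=> x; apply: img_val_inj; apply: mul1g. Qed.
Let mulr1 : right_id img_one img_mul.
Proof. by move=> x; apply: img_val_inj; apply: mulg1. Qed.
Let mulV : left_inverse img_one img_inv img_mul.
Proof. by move=> x; apply: img_val_inj; apply: mulVg. Qed.
Let mulrV : right_inverse img_one img_inv img_mul.
Proof. by move=> x; apply: img_val_inj; apply: mulgV. Qed.

HB.instance Definition _ := isGroup.Build img mulA mul1 mulr1 mulV mulrV.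

Definition img_pi (y : Y) : img := to_img (ex_intro2 _ _ y I erefl).

(** The quotient topology along [img_pi], which may be strictly finer than the topology induced from
    [G]. *)
Definition img_open : set_system img := [set O | open (img_pi @^-1` O)].

Let img_openT : img_open setT. Proof. exact: openT. Qed.
Let img_openI A B : img_open A -> img_open B -> img_open (A `&` B).
Proof. exact: openI. Qed.
Let img_open_bigU (J : Type) (f : J -> set img) :
  (forall i, img_open (f i)) -> img_open (\bigcup_i f i).
Proof. by move=> fo; apply: (bigcup_open (D := setT)) => i _; apply: fo. Qed.

HB.instance Definition _ := isOpenTopological.Build img
  img_openT img_openI img_open_bigU.

Lemma img_pi_continuous : continuous img_pi.
Proof. by apply/continuousP. Qed.

Lemma img_pi_open (U : set Y) : open U -> open (img_pi @` U).
Proof.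
move=> oU; suff : open (img_pi @^-1` (img_pi @` U)) by [].
rewrite openE => z [y Uy yz].
apply: filterS (sat_q oU Uy (congr1 img_val yz)) => z' [y' Uy' y'z'].
by exists y' => //; apply: img_val_inj.
Qed.

Lemma img_pi_surj (x : img) : exists y, img_pi y = x.
Proof. by have [y _ yx] := img_valP x; exists y; apply: img_val_inj. Qed.

Lemma img_pi_nbhs y (V : set Y) : nbhs y V -> nbhs (img_pi y) (img_pi @` V).
Proof.
rewrite nbhsE => -[U [oU Uy] UV].
rewrite nbhsE; exists (img_pi @` U); first by split;
  [exact: img_pi_open|exists y].
by move=> _ [z Uz <-]; exists z => //; apply: UV.
Qed.

Lemma img_val_continuous : continuous img_val.
Proof. by apply/continuousP => A oA; move/continuousP : cq => /(_ A oA). Qed.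

Let img_mulg_continuous : continuous (fun x : img * img => x.1 * x.2).
Proof.
move=> [a b] O /= abO.
have [y1 [y2 [y3 [qa qb qab Hq]]]] := mul_q (img_valP a) (img_valP b).
have ea : img_pi y1 = a by apply: img_val_inj.
have eb : img_pi y2 = b by apply: img_val_inj.
have eab : img_pi y3 = a * b by apply: img_val_inj.
rewrite -eab in abO; have [V1 [V2 [yV1 yV2 VO]]] :=
  Hq _ (img_pi_continuous abO).
exists (img_pi @` V1, img_pi @` V2).
  by split; rewrite /= -?ea -?eb; exact: img_pi_nbhs.
move=> [_ _] [/= [z1 Vz1 <-] [z2 Vz2 <-]].
have [z3 Oz3 e3] := VO _ _ Vz1 Vz2.
suff e : img_pi z3 = img_pi z1 * img_pi z2 by rewrite /= -e.
exact: img_val_inj.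
Qed.

Let img_invg_continuous : continuous (fun x : img => x^-1).
Proof.
move=> a O /= aO; have [y1 [y2 [qa qaV Hq]]] := inv_q (img_valP a).
have ea : img_pi y1 = a by apply: img_val_inj.
have eaV : img_pi y2 = a^-1 by apply: img_val_inj.
rewrite -eaV in aO; have [V yV VO] := Hq _ (img_pi_continuous aO).
rewrite -ea; apply: filterS (img_pi_nbhs yV) => _ [z Vz <-].
have [z2 Oz2 e2] := VO z Vz.
suff e : img_pi z2 = (img_pi z)^-1 by rewrite /= -e.
exact: img_val_inj.
Qed.

HB.instance Definition _ := isTopologicalGroup.Build img
  img_mulg_continuous img_invg_continuous.

Lemma img_hausdorff : hausdorff_space img.
Proof.
move=> x y xy; apply: img_val_inj; apply: hG => A B.
move=> /(@img_val_continuous x) xA /(@img_val_continuous y) yB.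
by have [z [Az Bz]] := xy _ _ xA yB; exists (img_val z).
Qed.

HB.instance Definition _ (R : realType) := isPolish.Build R img
  (separable_open_image pY img_pi_continuous img_pi_open img_pi_surj)
  (completely_metrizable_open_image R pY img_hausdorff img_pi_continuous
    img_pi_open img_pi_surj).

Lemma img_val_morph : {morph img_val : x y / x * y >-> x * y}.
Proof. by []. Qed.

HB.instance Definition _ := isMultiplicative.Build img G img_val img_val_morph.

End Image.

Lemma polish_group_hausdorff (R : realType) (G : polishGroupType R) :
  hausdorff_space G.
Proof. by have [] := polish_group_space G. Qed.

(* [N] is given the quotient topology along [q]. *)
Lemma polish_subgroup_image (R : realType) (G : polishGroupType R)
    (Y : topologicalType) (q : Y -> G) (N : set G) :
  polish_space Y -> continuous q -> range q = N -> subgroup_set N ->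
  (forall (U : set Y) y z, open U -> U y -> q y = q z ->
    nbhs z [set z' | exists2 y', U y' & q y' = q z']) ->
  (forall a b, N a -> N b -> exists y1 y2 y3,
    [/\ q y1 = a, q y2 = b, q y3 = a * b & forall O, nbhs y3 O ->
      exists V1 V2, [/\ nbhs y1 V1, nbhs y2 V2 & forall z1 z2, V1 z1 -> V2 z2 ->
        exists2 z3, O z3 & q z3 = q z1 * q z2]]) ->
  (forall a, N a -> exists y1 y2,
    [/\ q y1 = a, q y2 = a^-1 & forall O, nbhs y2 O ->
      exists2 V, nbhs y1 V & forall z1, V z1 ->
        exists2 z2, O z2 & q z2 = (q z1)^-1]) ->
  polish_subgroup N.
Proof.
move=> pY cq <- sub_q sat_q mul_q inv_q.
have hG := @polish_group_hausdorff R G.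
exists (PolishGroup.clone R (img hG pY cq sub_q sat_q mul_q inv_q) _).
exists (@img_val _ _ _ hG pY cq sub_q sat_q mul_q inv_q).
split; [exact: img_val_inj|exact: img_val_continuous|].
apply/seteqP; split=> [_ [x _ <-]|_ [y _ <-]]; first exact: img_valP.
by exists (img_pi hG pY cq sub_q sat_q mul_q inv_q y).
Qed.

Section PolishSubgroups.
Variables (R : realType) (G : polishGroupType R).
Implicit Type N : set G.

Lemma polish_subgroup_closed N : subgroup_set N -> closed N ->
  polish_subgroup N.
Proof.
move=> sN cN; have pY := polish_space_closed (polish_group_space G) cN.
pose q : set_type N -> G := set_val.
have rq : range q = N.
  apply/seteqP; split=> [_ [x _ <-]|x Nx]; first exact: set_mem (valP x).
  by have [y <-] := set_valK Nx; exists y.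
have cq : continuous q by exact: initial_continuous.
have Nq y : N (q y) by rewrite -rq; exists y.
apply: (polish_subgroup_image pY cq rq sN).
- move=> U y z oU Uy /val_inj <-.
  apply: filterS (open_nbhs_nbhs (conj oU Uy)) => y' Uy'.
  by exists y'.
- move=> a b; rewrite -{1 2}rq => -[y1 _ <-] [y2 _ <-].
  have [y3 e3] := set_valK (subgroup_setM sN (Nq y1) (Nq y2)).
  exists y1, y2, y3; split=> // O /nbhs_set_type[V oV VO].
  have : nbhs (q y1 * q y2) V by rewrite -e3; exact: open_nbhs_nbhs.
  move=> /nbhs_mulg[V1 [V2 [nV1 nV2 V12]]].
  exists (q @^-1` V1), (q @^-1` V2); split; [exact: cq|exact: cq|].
  move=> z1 z2 Vz1 Vz2.
  have [z3 e] := set_valK (subgroup_setM sN (Nq z1) (Nq z2)).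
  by exists z3 => //; apply: VO; rewrite /= e; exact: V12.
- move=> a; rewrite -{1}rq => -[y1 _ <-].
  have [y2 e2] := set_valK (subgroup_setV sN (Nq y1)).
  exists y1, y2; split=> // O /nbhs_set_type[V oV VO].
  have : nbhs (q y1)^-1 V by rewrite -e2; exact: open_nbhs_nbhs.
  move=> /invg_continuous nV; exists (q @^-1` [set x | V x^-1]);
    first exact: cq.
  move=> z Vz; have [z2 e] := set_valK (subgroup_setV sN (Nq z)).
  by exists z2 => //; apply: VO; rewrite /= e.
Qed.

Lemma mult1 (P Q : groupType) (f : {multiplicative P -> Q}) : f 1 = 1.
Proof. by apply: (mulgI (f 1)); rewrite -gmulfM !mulg1. Qed.

Lemma multV (P Q : groupType) (f : {multiplicative P -> Q})
  x : f x^-1 = (f x)^-1.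
Proof. by apply: (mulgI (f x)); rewrite -gmulfM !mulgV mult1. Qed.

Lemma subgroup_set_range (P Q : groupType) (f : {multiplicative P -> Q}) :
  subgroup_set (range f).
Proof.
split=> [|_ _ [x _ <-] [y _ <-]]; first by exists 1 => //; exact: mult1.
by exists (x * y^-1) => //; rewrite gmulfM multV.
Qed.

Section Range.
Variables (P : polishGroupType R) (f : {multiplicative P -> G}).

(** The points [y] and [z] differ by an element of the kernel, so a point z' near [z] is matched by
    y z^-1 z', which is near [y]. *)
Lemma range_saturated (U : set P) y z : open U -> U y -> f y = f z ->
  nbhs z [set z' | exists2 y', U y' & f y' = f z'].
Proof.
move=> oU Uy yz; have := nbhs_mulVl z (nbhs1_mull (open_nbhs_nbhs (conj oU
  Uy))).
apply: filterS => z' Uz'; exists (y * (z^-1 * z')) => //.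
by rewrite !gmulfM multV yz mulgA mulgV mul1g.
Qed.

Lemma range_mul a b : range f a -> range f b -> exists y1 y2 y3,
  [/\ f y1 = a, f y2 = b, f y3 = a * b & forall O, nbhs y3 O ->
    exists V1 V2, [/\ nbhs y1 V1, nbhs y2 V2 & forall z1 z2, V1 z1 -> V2 z2 ->
      exists2 z3, O z3 & f z3 = f z1 * f z2]].
Proof.
move=> [y1 _ <-] [y2 _ <-]; exists y1, y2, (y1 * y2); split=> //.
  exact: gmulfM.
move=> O /nbhs_mulg[V1 [V2 [nV1 nV2 V12]]].
exists V1, V2; split=> // z1 z2 Vz1 Vz2; exists (z1 * z2); first exact: V12.
exact: gmulfM.
Qed.

Lemma range_inv a : range f a -> exists y1 y2,
  [/\ f y1 = a, f y2 = a^-1 & forall O, nbhs y2 O ->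
    exists2 V, nbhs y1 V & forall z1, V z1 -> exists2 z2, O z2 &
      f z2 = (f z1)^-1].
Proof.
move=> [y _ <-]; exists y, y^-1; split=> //; first exact: multV.
move=> O /invg_continuous nV; exists [set x | O x^-1] => // z Oz.
by exists z^-1 => //; exact: multV.
Qed.

(** The Polish topology on the range is the one it receives as the quotient of [P] by the kernel of
    [f]. *)
Lemma polish_subgroup_range : continuous f -> polish_subgroup (range f).
Proof.
move=> cf; apply: (polish_subgroup_image (polish_group_space P) cf erefl).
- exact: subgroup_set_range.
- exact: range_saturated.
- exact: range_mul.
- exact: range_inv.
Qed.

End Range.

End PolishSubgroups.

(** * Products of Polish groups *)

Section ProductGroup.
Variables G H : topologicalGroupType.

Let mulg_continuous_prod : continuous (fun x : (G * H) * (G * H) => x.1 * x.2).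
Proof.
move=> [[a b] [c d]] O /= [[A B] /= [Aac Bbd] ABO].
have [A1 [A2 [aA1 cA2 A12]]] := nbhs_mulg Aac.
have [B1 [B2 [bB1 dB2 B12]]] := nbhs_mulg Bbd.
exists (A1 `*` B1, A2 `*` B2) => /=.
  by split; [exists (A1, B1)|exists (A2, B2)].
move=> [[a' b'] [c' d']] [/= [Aa' Bb'] [Ac' Bd']].
by apply: ABO; split; [exact: A12|exact: B12].
Qed.

Let invg_continuous_prod : continuous (fun x : G * H => x^-1).
Proof.
move=> [a b] O /= [[A B] /= [/invg_continuous Aa /invg_continuous Bb] ABO].
exists ([set x | A x^-1], [set x | B x^-1]) => //.
by move=> [a' b'] [/= Aa' Bb']; apply: ABO.
Qed.

HB.instance Definition _ := isTopologicalGroup.Build (G * H)%type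
  mulg_continuous_prod invg_continuous_prod.

Lemma fst_multiplicative : {morph (@fst G H) : x y / x * y >-> x * y}.
Proof. by []. Qed.
Lemma snd_multiplicative : {morph (@snd G H) : x y / x * y >-> x * y}.
Proof. by []. Qed.

HB.instance Definition _ := isMultiplicative.Build (G * H)%type G fst
  fst_multiplicative.
HB.instance Definition _ := isMultiplicative.Build (G * H)%type H snd
  snd_multiplicative.

End ProductGroup.

Section PolishTopologicalGroup.
Variables (R : realType) (G : topologicalGroupType).
Hypothesis pG : polish_space G.

Let open_id (U : set G) : open U -> open (id @` U).
Proof. by rewrite image_id. Qed.

Lemma polish_space_separable : separable G.
Proof. by case: pG => _ /second_countable_separable. Qed.

(** The identity is an open map from a Polish space onto [G], so a mere sieve becomes a complete
    metric by way of the two-sided uniformity. *)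
Lemma polish_space_metrizable_group : completely_metrizable R G.
Proof.
case: (pG) => hG _ _.
apply: (completely_metrizable_open_image R pG hG (q := id)).
- by move=> x; exact: cvg_id.
- exact: open_id.
- by move=> x; exists x.
Qed.

End PolishTopologicalGroup.

HB.instance Definition _ (R : realType) (G H : polishGroupType R) :=
  isPolish.Build R (G * H)%type
  (polish_space_separable
    (polish_space_prod (polish_group_space G) (polish_group_space H)))
  (polish_space_metrizable_group R
    (polish_space_prod (polish_group_space G) (polish_group_space H))).

(** * Open mappings and Borel sections *)

Lemma comeager_mulgl (G : topologicalGroupType) (g : G) (A : set G) :
  comeager A -> comeager [set x | A (g * x)].
Proof.
apply: (comeager_preimage (h := fun x => g * x)); first exact: mulgl_continuous.
move=> O oO; have -> : (fun x => g * x) @` O = (fun x => g^-1 * x) @^-1` O.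
  apply/seteqP; split=> [_ [x Ox <-]|x Ox] /=; first by rewrite mulKg.
  by exists (g^-1 * x); rewrite ?mulVKg.
by apply: open_comp => // x _; exact: mulgl_continuous.
Qed.

Lemma continuous_morphism (G K : topologicalGroupType) (phi : G -> K) :
  {morph phi : x y / x * y} ->
  (forall V, nbhs (1 : K) V -> nbhs (1 : G) [set x | V (phi x)]) ->
    continuous phi.
Proof.
move=> phiM c1 x O /nbhs1_mulr/c1/(nbhs_mulVr x).
by apply: filterS => y /=; rewrite -phiM mulgVK.
Qed.

(** For y near 1, pick z near a fixed point c of [C] with both z and y z in [C]. Then phi y = phi (y
    z) phi(z)^-1, where both factors are controlled by continuity at c. *)
Lemma cont_on_morphism (G K : topologicalGroupType) (phi : G -> K) (C : set G) :
  polish_space G -> {morph phi : x y / x * y} -> comeager C -> cont_on C phi ->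
  continuous phi.
Proof.
move=> pG phiM cC ctC; apply: continuous_morphism => // V V1.
have [W W1 WV] := nbhs1_square V1.
have [c Cc] := comeager_nonempty (1 : G) pG cC.
have WW y : nbhs y [set z | (W `&` [set x | W x^-1]) (z * y^-1)].
  by apply: nbhs_mulVr; apply: filterI => //; exact: nbhs1_inv.
have := ctC c Cc _ (WW (phi c)); rewrite nbhsE => -[O [oO Oc] OW].
apply: filterS (nbhs1_mulr (open_nbhs_nbhs (conj oO Oc))) => y /= Oyc.
have [||z [[Oz Oyz] [Cz Cyz]]] := baire pG (comeagerI cC (comeager_mulgl y cC))
    (O := O `&` [set z | O (y * z)]).
- by exists c.
- by apply: openI => //; apply: open_comp => // z _; exact: mulgl_continuous.
have [_ /= Wz] := OW z Oz Cz; have [/= Wyz _] := OW _ Oyz Cyz.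
by have := WV _ _ Wyz Wz; rewrite phiM !invgM !invgK !mulgA mulgVK mulgK.
Qed.

Section OpenMapping.
Variables (R : realType) (P H : polishGroupType R) (f : {multiplicative P ->
  H}).
Hypotheses (cf : continuous f) (surj_f : forall y, exists x, f x = y).

Local Notation Q := (img (@polish_group_hausdorff R H) (polish_group_space P) cf
  (subgroup_set_range f) (@range_saturated _ _ _ f) (@range_mul _ _ _ f)
  (@range_inv _ _ _ f)).
Local Notation pi := (img_pi (@polish_group_hausdorff R H)
  (polish_group_space P) cf
  (subgroup_set_range f) (@range_saturated _ _ _ f) (@range_mul _ _ _ f)
  (@range_inv _ _ _ f)).

(** Factor [f] through the Polish group [Q] of cosets of its kernel. The inverse [phi] of the
    continuous bijection from [Q] to [H] lifts the identity of [H], so it is continuous on a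
    comeager set; being a homomorphism, it is continuous, and the image of [U] is the preimage under
    [phi] of an open set. *)
Lemma open_mapping (U : set P) : open U -> open (f @` U).
Proof.
have /choice[g gK] : forall y, exists x, f x = y by [].
have piE x x' : f x = f x' -> pi x = pi x' by move=> e; apply: img_val_inj.
pose phi y : Q := pi (g y).
have phiM : {morph phi : x y / x * y}.
  by move=> x y; apply: img_val_inj; rewrite /img_val /= !gK.
have [_ scH _] := polish_group_space H.
have [||||C [cC _ ctC]] := @comeager_cont_on_lift H Q H (@img_val _ _ _ _ _ _ _
  _ _ _)
   phi setT scH (@polish_group_space R Q) (@polish_group_hausdorff R H).
- exact: img_val_continuous.
- exact: img_val_inj.
- exact: comeagerT.
- move=> x _ O; rewrite /= /img_val /= gK => xO.
  by apply: filterS xO => y Oy _ /=; rewrite gK.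
have cphi := cont_on_morphism (polish_group_space H) phiM cC ctC.
move=> oU; have -> : f @` U = phi @^-1` (pi @` U).
  apply/seteqP; split=> [_ [x Ux <-]|y [x Ux /(congr1 (@img_val _ _ _ _ _ _ _ _
    _ _)) e]].
    by exists x => //; apply: piE; rewrite gK.
  by exists x => //; move: e; rewrite /img_val /= gK.
by apply: open_comp => [x _|]; [exact: cphi|exact: img_pi_open].
Qed.

End OpenMapping.

(** * Borel sets and Borel functions *)

Section BorelSets.
Variable T : topologicalType.
Local Notation borel := (<<s @open T >>).

Lemma borel_setC (A : set T) : borel A -> borel (~` A).
Proof.
by move=> bA; rewrite -setTD; have [_ + _] :=
  smallest_sigma_algebra setT (@open T); apply.
Qed.

Lemma borel_bigcup (J : countType) (A : J -> set T) :
  (forall i, borel (A i)) -> borel [set x | exists i, A i x].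
Proof.
have [b0 _ bU] := smallest_sigma_algebra setT (@open T) => bA.
have := bU (fun n => if unpickle n is Some i then A i else set0).
have -> : \bigcup_k match unpickle k with Some i => A i | None => set0 end =
    [set x | exists i, A i x].
  apply/seteqP; split=> [x [n _]|x [i Ax]].
    by case: unpickle => // i Ax; exists i.
  by exists (pickle i) => //; rewrite pickleK.
by apply=> n; case: unpickle => [i|]; [exact: bA|exact: b0].
Qed.

Lemma borel_bigcap (J : countType) (A : J -> set T) :
  (forall i, borel (A i)) -> borel [set x | forall i, A i x].
Proof.
move=> bA; have -> : [set x | forall i, A i x] = ~` [set x | exists i, (~` A i)
  x].
  apply/seteqP; split=> [x Ax [i]|x nA i]; first exact.
  by apply: contrapT => nAi; apply: nA; exists i.
by apply: borel_setC; apply: borel_bigcup => i; apply: borel_setC.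
Qed.

Lemma borel_setI (A B : set T) : borel A -> borel B -> borel (A `&` B).
Proof.
move=> bA bB; have := @borel_bigcap bool (fun b => if b then A else B).
have -> : [set x | forall b : bool, (if b then A else B) x] = A `&` B.
  apply/seteqP; split=> x /= Hx; first by split;
    [exact: (Hx true)|exact: (Hx false)].
  by case: Hx => ? ? [].
by apply=> -[].
Qed.

Lemma borel_open (A : set T) : open A -> borel A.
Proof. by move=> oA; apply: sub_sigma_algebra. Qed.

Lemma borel_prop (A : set T) (p : Prop) : borel A -> borel [set x | p /\ A x].
Proof.
move=> bA; have [Hp|nHp] := pselect p.
  by have -> : [set x | p /\ A x] = A by apply/seteqP; split=> x //= [].
have -> : [set x | p /\ A x] = set0 by apply/seteqP; split=> x //= [].
by apply: borel_open; exact: open0.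
Qed.

End BorelSets.

Lemma borel_function_open (S T : topologicalType) (f : S -> T) :
  (forall U, open U -> <<s @open S >> (f @^-1` U)) -> borel_function f.
Proof.
move=> fo; suff : <<s @open T >> `<=` [set B | <<s @open S >> (f @^-1` B)] by
  [].
apply: smallest_sub => //; split=> /=.
- by rewrite preimage_set0; apply: borel_open; exact: open0.
- by move=> A bA; rewrite setTD preimage_setC; apply: borel_setC.
- move=> A bA; rewrite preimage_bigcup.
  have := @borel_bigcup S nat (fun n => f @^-1` A n) bA.
  by congr (<<s _ >> _); apply/seteqP; split=> x [n]; [exists n|move=> _;
    exists n].
Qed.

Lemma continuous_borel (S T : topologicalType) (f : S -> T) :
  continuous f -> borel_function f.
Proof.
move=> /continuousP cf; apply: borel_function_open => U oU.
by apply: borel_open; exact: cf.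
Qed.

Lemma borel_comp (S T U : topologicalType) (f : S -> T) (g : T -> U) :
  borel_function f -> borel_function g -> borel_function (g \o f).
Proof. by move=> bf bg B /bg/bf. Qed.

(** * Borel selection for open maps *)

Section Selection.
Variables (P H : topologicalType) (f : P -> H).
Hypotheses (pP : polish_space P) (hH : hausdorff_space H) (cf : continuous f).
Hypothesis open_f : forall U : set P, open U -> open (f @` U).
Hypothesis surj_f : forall y, exists x, f x = y.

(** At stage n take the least index of a small basic set, well inside the previous one, whose image
    contains [y]. Images of basic sets are open, so each choice depends on [y] in a Borel way; the
    nested sets converge to the selected preimage. *)
Lemma borel_selection : exists2 s : H -> P, borel_function s & forall y, f (s y)
  = y.
Proof.
have [_ /nat_basis[B [Bo Bb]] [S [S1 S2 S3]]] := pP.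
pose cand n (W : set P) j := S n (B j) /\ closure (B j) `<=` W.
pose ok n W y j := `[< cand n W j /\ (f @` B j) y >].
pose sel n W y := if pselect (exists j, ok n W y j)
  is left e then ex_minn e else 0%N.
have selP n W y : open W -> (f @` W) y ->
    cand n W (sel n W y) /\ (f @` B (sel n W y)) y.
  move=> oW [x Wx xy]; rewrite /sel; case: pselect => [e|[]].
    by case: ex_minnP => j /asboolP.
  have [V [oV Vx cV SV]] := S1 n x W (open_nbhs_nbhs (conj oW Wx)).
  have [j [Bx BV]] := Bb x V (open_nbhs_nbhs (conj oV Vx)).
  exists j; apply/asboolP; split; last by exists x.
  split; first exact: S2 SV.
  by apply: subset_trans cV; exact: closureS.
have bok n W j : <<s @open H >> [set y | ok n W y j].
  have -> : [set y | ok n W y j] = [set y | cand n W j /\ (f @` B j) y].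
    by apply/seteqP; split=> y /= Hy; apply/asboolP.
  by apply: borel_prop; apply: borel_open; exact: open_f.
have bsel n W j : <<s @open H >> [set y | sel n W y = j].
  have bex : <<s @open H >> [set y | exists j, ok n W y j].
    exact: (@borel_bigcup _ _ (fun j => [set y | ok n W y j]) (bok n W)).
  pose least := [set y | ok n W y j] `&` [set y | forall k : nat, k < j ->
    ~ ok n W y k]%N.
  have bl : <<s @open H >> least.
    apply: borel_setI => //.
    apply: (@borel_bigcap _ _ (fun k => [set y | (k < j)%N -> ~ ok n W y k]))
      => k.
    have [kj|nkj] := pselect (k < j)%N.
      have -> : [set y | (k < j)%N -> ~ ok n W y k] = ~` [set y | ok n W y k].
        by apply/seteqP; split=> y /=; [apply|move=> ? _].
      exact: borel_setC.
    have -> : [set y | (k < j)%N -> ~ ok n W y k] = setT.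
      by apply/seteqP; split=> y //= _ /nkj.
    by apply: borel_open; exact: openT.
  have E y : (exists j, ok n W y j) -> (sel n W y = j) <-> least y.
    move=> e; rewrite /sel; case: pselect => // e'.
    case: ex_minnP => m om mmin; split=> [mj|[oj jmin]].
      by rewrite /least -mj; split=> // k km ok'; move: (mmin k ok');
        rewrite leqNgt km.
    apply/eqP; rewrite eqn_leq mmin//= leqNgt; apply/negP => mj.
    exact: (jmin m mj om).
  (* Either some candidate exists and [j] is the least one, or none exists and [j] is the default 0;
     the union is spelled with complements and intersections. *)
  have -> : [set y | sel n W y = j] = ~` (~` (least `&` [set y | exists j,
    ok n W y j]) `&`
      ~` (~` [set y | exists j, ok n W y j] `&` [set _ | j = 0%N])).
    apply/seteqP; split=> y /=.
      move=> sj [n1 n2]; have [e|ne] := pselect (exists j, ok n W y j).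
        by apply: n1; split=> //; apply/E.
      apply: n2; split=> //; rewrite -sj /sel; case: pselect => //.
    move=> nn; have [e|ne] := pselect (exists j, ok n W y j).
      apply/E => //; apply: contrapT => nl; apply: nn; split; first by case.
      by case=> ne; case: ne.
    rewrite /sel; case: pselect => // _.
    apply: contrapT => j0; apply: nn; split; first by case=> _ /ne.
    by case=> _ /= j0'; apply: j0.
  apply: borel_setC; apply: borel_setI; first by apply: borel_setC;
    apply: borel_setI.
  apply: borel_setC; apply: borel_setI; first exact: borel_setC.
  have := @borel_prop H setT (j = 0%N) (borel_open openT).
  by congr (<<s _ >> _); apply/seteqP; split=> y //= -[].
pose J := fix J n y := if n is m.+1 then sel m.+1 (B (J m y))
  y else sel 0%N setT y.
have JP n y : (f @` B (J n y)) y /\ S n (B (J n y)).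
  elim: n => [|n [IH _]] /=.
    by have [||[]] := selP 0%N setT y; [exact: openT|have [x] := surj_f y;
      exists x|].
  by have [[]] := selP n.+1 (B (J n y)) y (Bo _) IH.
have Jc n y : closure (B (J n.+1 y)) `<=` B (J n y).
  by have [[]] := selP n.+1 (B (J n y)) y (Bo _) (JP n y).1.
have bJ n j : <<s @open H >> [set y | J n y = j].
  elim: n j => [|n IH] j; first exact: bsel.
  have -> : [set y | J n.+1 y = j] =
      [set y | exists i, ([set y | J n y = i] `&` [set y | sel n.+1 (B i)
        y = j]) y].
    by apply/seteqP; split=> y /= => [<-|[i [<-]]//]; exists (J n y).
  by apply: borel_bigcup => i; apply: borel_setI.
have Wd y n : B (J n.+1 y) `<=` B (J n y) by move=> x /subset_closure/Jc.
have Wne y n : B (J n y) !=set0 by have [[x Bx _] _] := JP n y; exists x.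
have /choice[s Hs] : forall y, exists x : P, forall O, nbhs x O ->
    exists n, B (J n y) `<=` O.
  by move=> y; apply: S3 => n; [exact: (JP n y).2|exact: Wd|exact: Wne].
have sB y n : B (J n y) (s y).
  apply: Jc; exact: sieve_limit_closure (Wd y) (Wne y) (Hs y) n.+1.
exists s.
  apply: borel_function_open => O oO.
  have -> : s @^-1` O = [set y | exists n, [set y | exists j,
    [set y | B j `<=` O /\ [set y | J n y = j] y] y] y].
    apply/seteqP; split=> y /=.
      by move=> Oy; have [n nO] := Hs y O (open_nbhs_nbhs (conj oO Oy));
        exists n, (J n y).
    by move=> [n [j [BO Jj]]]; apply: BO; rewrite -Jj.
  by apply: borel_bigcup => n; apply: borel_bigcup => j; apply: borel_prop.
move=> y; apply: hH => O1 O2 /cf O1s O2y.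
have [n BO] := Hs y _ O1s; have [[x Bx xy] _] := JP n y.
by exists y; split; [rewrite -xy; exact: BO|exact: nbhs_singleton].
Qed.

End Selection.

Lemma borel_section (R : realType) (P H : polishGroupType R)
    (f : {multiplicative P -> H}) :
  continuous f -> (forall y, exists x, f x = y) ->
  exists2 s : H -> P, borel_function s & forall y, f (s y) = y.
Proof.
move=> cf sf; apply: borel_selection => //.
- exact: polish_group_space.
- exact: polish_group_hausdorff.
- by move=> U; apply: open_mapping.
Qed.

(** * The graph of a Borel-definable homomorphism *)

Definition gsimpl := (@mulgA, @invgM, @invgK, @invg1, @mulgV, @mulVg, @mul1g,
  @mulg1, @mulgK, @mulgVK).

Lemma fst_continuous (S T : topologicalType) : continuous (@fst S T).
Proof. by move=> x; exact: cvg_fst. Qed.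

Lemma snd_continuous (S T : topologicalType) : continuous (@snd S T).
Proof. by move=> x; exact: cvg_snd. Qed.

Lemma continuous_compose (S T U : topologicalType) (f : S -> T) (g : T -> U) :
  continuous f -> continuous g -> continuous (fun x => g (f x)).
Proof. by move=> cf cg x; apply: continuous_comp; [exact: cf|exact: cg]. Qed.

(** A comeager set can meet countably many genericity requirements at once. This suits a sequence
    together with its limit, but not a whole neighbourhood. *)
Lemma seq_continuous (S T : topologicalType) (f : S -> T) :
  @second_countable S ->
  (forall (u : nat -> S) x, u @ \oo --> x -> (f \o u) @ \oo --> f x) ->
  continuous f.
Proof.
move=> /nat_basis[B [Bo Bb]] cf x O fO; apply: contrapT => nO.
pose V n := if `[< B n x >] then B n else setT.
have Vx n : nbhs x (V n).
  rewrite /V; case: asboolP => [Bx|_]; last exact: filterT.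
  exact: open_nbhs_nbhs.
pose W := fix W n := if n is m.+1 then W m `&` V n else V 0%N.
have Wx n : nbhs x (W n) by elim: n => [|n IH] /=; [|exact: filterI].
have WV n k : (k <= n)%N -> W n `<=` V k.
  elim: n => [|n IH]; first by rewrite leqn0 => /eqP->.
  by rewrite leq_eqVlt => /orP[/eqP-> y []//|/IH WV y [/WV]].
have /choice[u Hu] : forall n, exists y, W n y /\ ~ O (f y).
  move=> n; apply: contrapT => H; apply: nO; apply: filterS (Wx n) => y Wy.
  by apply: contrapT => nOy; apply: H; exists y.
have ux : u @ \oo --> x.
  move=> A /Bb[n [Bx BA]]; exists n => // m /= nm; apply: BA.
  by have := WV _ _ nm _ (Hu m).1; rewrite /V; case: asboolP.
by have [n _ /(_ n (leqnn n))] := cf u x ux O fO; exact: (Hu n).2.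
Qed.

Lemma continuous_within (S T : topologicalType) (D : set S) (h : S -> T) p :
  {for p, continuous h} -> h @ within D (nbhs p) --> h p.
Proof.
move=> ch O hO; have {}hO : nbhs p (h @^-1` O) := ch O hO.
suff : nbhs p [set x | D x -> O (h x)] by [].
by apply: filterS hO => y Oy _.
Qed.

Lemma cont_on_cvg (U S T : topologicalType) (F : set_system U) (E : set S)
    (k : S -> T) (h : U -> S) e0 : Filter F -> cont_on E k -> E e0 ->
  h @ F --> e0 -> F [set u | E (h u)] -> (fun u => k (h u)) @ F --> k e0.
Proof.
move=> FF ck Ee he FE O kO; suff : F [set u | O (k (h u))] by [].
have hF : F (h @^-1` [set y | E y -> O (k y)]) := he _ (ck _ Ee _ kO).
by apply: filterS (filterI hF FE) => u [/= H /H].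
Qed.

(** Moving only the second factor already reaches a neighbourhood of the product. With
    [comeager_preimage], this makes [x * t] generic for generic pairs. *)
Lemma mulg_open (G : topologicalGroupType) (O : set (G * G)) :
  open O -> open ((fun x => x.1 * x.2) @` O).
Proof.
move=> oO; rewrite openE => _ [[x t] Oxt <-] /=.
have : nbhs t [set t' | O (x, t')].
  have : nbhs (x, t) O by apply: open_nbhs_nbhs.
  move=> [[A B] /= [Ax Bt] AB]; apply: filterS Bt => t' Bt'.
  by apply: AB; split=> //=; exact: nbhs_singleton.
move=> /nbhs1_mull/(nbhs_mulVl (x * t)); apply: filterS => y /= Oy.
by exists (x, t * ((x * t)^-1 * y)) => //=; rewrite mulgA mulVKg.
Qed.

Section Graph.
Variables (R : realType) (G H M : polishGroupType R).
Variables (i : {multiplicative M -> H}).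
Hypotheses (ci : continuous i) (inj_i : injective i).
Variables (Z : groupType) (p : {multiplicative H -> Z}).
Hypothesis ker_p : forall h, p h = 1 <-> range i h.

Definition ker_lift (h : H) : M :=
  if pselect (exists m, i m = h) is left e then projT1 (cid e) else 1.

Lemma ker_liftK h : p h = 1 -> i (ker_lift h) = h.
Proof.
move=> /ker_p[m _ mh]; rewrite /ker_lift; case: pselect => [e|[]];
  last by exists m.
by case: cid.
Qed.

Lemma p_i m : p (i m) = 1. Proof. by apply/ker_p; exists m. Qed.

(** The right conjugation action of [H] on [M]. Only its composite with [i] is visibly continuous,
    because [i] need not be a homeomorphism onto its range. *)
Definition conj_lift (hm : H * M) : M := ker_lift (hm.1^-1 * i hm.2 * hm.1).

Lemma conj_liftE h m : i (conj_lift (h, m)) = h^-1 * i m * h.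
Proof. by rewrite ker_liftK//= !gmulfM p_i mulg1 -gmulfM mulVg mult1. Qed.

Let pM := polish_group_space M.
Let pH := polish_group_space H.
Let hH := @polish_group_hausdorff R H.
Let scH : @second_countable H. Proof. by case: pH. Qed.
Let pHM := polish_space_prod pH pM.

(** For fixed [h] this is an endomorphism of [M] lifting a continuous map into [H], so it is
    continuous on a comeager set and hence everywhere. *)
Lemma conj_lift_continuousr h : continuous (fun m => conj_lift (h, m)).
Proof.
have cM : {morph (fun m => conj_lift (h, m)) : x y / x * y}.
  by move=> x y; apply: inj_i; rewrite gmulfM !conj_liftE gmulfM !mulgA mulgK.
have scM : @second_countable M by case: pM.
have [||C [cC _ cont]] := @comeager_cont_on_lift M M H i
    (fun m => conj_lift (h, m)) setT scM pM hH ci inj_i.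
- exact: comeagerT.
- move=> m _; rewrite /= conj_liftE => O hO.
  have : nbhs m [set m' | O (h^-1 * i m' * h)].
    exact: (cvg_comp _ _ (cvg_comp _ _ (@ci m) (@mulgl_continuous H h^-1 (i m)))
       (@mulgr_continuous H h (h^-1 * i m))).
  by apply: filterS => m' Om' _ /=; rewrite conj_liftE.
exact: cont_on_morphism cC cont.
Qed.

(** Joint continuity on a comeager set comes from the lifting lemma. A convergent sequence and its
    limit are then translated into that set by one generic pair (g, m'), and the translation is
    undone algebraically. *)
Lemma conj_lift_continuous : continuous conj_lift.
Proof.
have [|||C [cC _ cont]] := @comeager_cont_on_lift (H * M)%type M H i
    conj_lift setT _ pM hH ci inj_i.
- by case: pHM.
- exact: comeagerT.
- move=> [h m] _; rewrite /= conj_liftE => O hO.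
  have : nbhs (h, m) [set x | O (x.1^-1 * i x.2 * x.1)].
    have ch : (fun x : H * M => x.1) @ nbhs (h, m) --> h by exact: cvg_fst.
    have cm : (fun x : H * M => i x.2) @ nbhs (h, m) --> i m.
      by apply: (cvg_comp snd i); [exact: cvg_snd|exact: ci].
    exact: (mulg_cvg _ (mulg_cvg _ (invg_cvg _ ch) cm) ch).
  by apply: filterS => -[h' m'] Om' _; rewrite /= conj_liftE.
apply: seq_continuous; first by case: pHM.
move=> u [h0 m0] uh.
pose good (x : H * M) := [set gm : H * M | C (x * gm) /\ C ((x.1, 1) * gm)].
have cgood x : comeager (good x) by apply: comeagerI; apply: comeager_mulgl.
have [[g m'] [Hn H0]] : (\bigcap_n good (u n) `&` good (h0, m0)) !=set0.
  apply: (comeager_nonempty ((1, 1) : H * M) pHM); apply: comeagerI => //.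
  by apply: comeager_bigcap => n.
(* Conjugation by h g of m m' and of m' gives, by division, the conjugate of m by h g; conjugating
   by g^-1 removes g. That last step only needs continuity in the second variable. *)
have E h m : conj_lift (h, m) =
    conj_lift (g^-1, conj_lift (h * g, m * m') * (conj_lift (h * g, m'))^-1).
  apply: inj_i; rewrite !conj_liftE gmulfM multV !conj_liftE gmulfM.
  by rewrite !gsimpl.
rewrite E; have -> : conj_lift \o u = fun n => conj_lift (g^-1,
   conj_lift (u n * (g, m')) * (conj_lift (((u n).1, 1) * (g, m')))^-1).
  by apply/funext => n /=; case: (u n) => h m; rewrite /= E;
    congr (conj_lift (_, _ * (conj_lift (_, _))^-1)); rewrite mul1g.
have c1 : (fun n => u n * (g, m')) @ \oo --> (h0 * g, m0 * m').
  exact: (cvg_comp _ _ uh (@mulgr_continuous (H * M)%type (g, m') (h0, m0))).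
have e01 : (h0, 1 : M) * (g, m') = (h0 * g, m') := congr1 (pair _) (mul1g m').
have c2 : (fun n => ((u n).1, 1) * (g, m')) @ \oo --> (h0 * g, m').
  have : (fun n => ((u n).1, 1 : M)) @ \oo --> (h0, 1 : M).
    by apply: cvg_pair; [exact: (cvg_comp _ _ uh cvg_fst)|exact: cvg_cst].
  move=> c; rewrite -e01.
  exact: (cvg_comp _ _ c (@mulgr_continuous (H * M)%type (g, m') (h0, 1))).
have [H01 H02] := H0.
have d1 : (fun n => conj_lift (u n * (g, m'))) @ \oo --> conj_lift (h0 * g,
  m0 * m').
  apply: (cont_on_cvg _ cont _ c1); first exact: H01.
  by exists 0%N => // n _; have [] := Hn n I.
have d2 : (fun n => conj_lift (((u n).1, 1) * (g, m'))) @ \oo -->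
  conj_lift (h0 * g, m').
  apply: (cont_on_cvg _ cont _ c2); first by rewrite -e01.
  by exists 0%N => // n _; have [] := Hn n I.
exact: (cvg_comp _ _ (mulg_cvg _ d1 (invg_cvg _ d2))
  (@conj_lift_continuousr g^-1 _)).
Qed.

Variables (phi : {multiplicative G -> Z}) (f : G -> H).
Hypotheses (bf : borel_function f) (phiE : forall g, phi g = p (f g)).

Let pG := polish_group_space G.
Let scG : @second_countable G. Proof. by case: pG. Qed.
Let pGG := polish_space_prod pG pG.

(** The factor set of the extension relative to the section s: f (x t) = f x * f t * i (cocycle (x,
    t)). *)
Definition cocycle (xt : G * G) : M :=
  ker_lift ((f xt.2)^-1 * (f xt.1)^-1 * f (xt.1 * xt.2)).

Lemma cocycleE x t : i (cocycle (x, t)) = (f t)^-1 * (f x)^-1 * f (x * t).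
Proof.
by rewrite ker_liftK//= !gmulfM !multV -!phiE gmulfM !gsimpl.
Qed.

(** Where x, t and x t all lie in [D], the image of the cocycle in [H] is a product of continuously
    varying factors; the lifting lemma transfers this to the topology of [M]. *)
Lemma cocycle_cont_on (D : set G) : comeager D -> cont_on D f -> exists E,
  [/\ comeager E, E `<=` [set xt | [/\ D xt.1, D xt.2 & D (xt.1 * xt.2)]] &
    cont_on E cocycle].
Proof.
move=> cD fD; pose E0 := [set xt : G * G | [/\ D xt.1, D xt.2 &
  D (xt.1 * xt.2)]].
have cE0 : comeager E0.
  have c1 : comeager [set xt : G * G | D xt.1].
    apply: (comeager_preimage (h := fst) _ _ cD); last exact: fst_open.
    by move=> z; exact: cvg_fst.
  have c2 : comeager [set xt : G * G | D xt.2].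
    apply: (comeager_preimage (h := snd) _ _ cD); last exact: snd_open.
    by move=> z; exact: cvg_snd.
  have c3 : comeager [set xt : G * G | D (xt.1 * xt.2)].
    exact: (comeager_preimage (@mulg_continuous G) (@mulg_open G) cD).
  by apply: comeagerS (comeagerI c1 (comeagerI c2 c3)) => xt [? []].
apply: (@comeager_cont_on_lift (G * G)%type M H i cocycle E0) => //.
  by case: pGG.
move=> [x t] [/= Dx Dt Dxt] O; rewrite cocycleE => hO.
have FE0 : within E0 (nbhs (x, t)) E0 by exact: withinT.
have F1 : (fun u : G * G => u.1) @ within E0 (nbhs (x, t)) --> x.
  by apply: (@continuous_within _ _ E0 fst (x, t)); exact: cvg_fst.
have F2 : (fun u : G * G => u.2) @ within E0 (nbhs (x, t)) --> t.
  by apply: (@continuous_within _ _ E0 snd (x, t)); exact: cvg_snd.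
have f1 : (fun u : G * G => f u.1) @ within E0 (nbhs (x, t)) --> f x.
  by apply: (cont_on_cvg _ fD Dx F1); apply: filterS FE0 => u [].
have f2 : (fun u : G * G => f u.2) @ within E0 (nbhs (x, t)) --> f t.
  by apply: (cont_on_cvg _ fD Dt F2); apply: filterS FE0 => u [].
have f3 : (fun u : G * G => f (u.1 * u.2)) @ within E0 (nbhs (x, t)) -->
  f (x * t).
  by apply: (cont_on_cvg _ fD Dxt (mulg_cvg _ F1 F2));
    apply: filterS FE0 => u [].
have FF : Filter (within E0 (nbhs (x, t))) by exact: within_filter.
have c := mulg_cvg FF (mulg_cvg FF (invg_cvg FF f2) (invg_cvg FF f1)) f3.
have W : nbhs (x, t) [set u | E0 u -> O ((f u.2)^-1 * (f u.1)^-1 * f (u.1 *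
  u.2))].
  exact: c _ hO.
apply: filterS W => -[x' t'] W' E0x.
by have := W' E0x; rewrite /= cocycleE.
Qed.

(* The transition map between the charts [(x, y, m) |-> s y * m * (s x)^-1] of the
   graph, where [s x = (x, f x)]. *)
Definition transition (z : (G * G) * (G * G) * M) : M :=
  ker_lift ((f z.1.2.2)^-1 * f z.1.2.1 * i z.2 * (f z.1.1.1)^-1 * f z.1.1.2).

Lemma transitionE x x' y y' m : y * x^-1 = y' * x'^-1 ->
  i (transition (x, x', (y, y'), m)) =
  (f y')^-1 * f y * i m * (f x)^-1 * f x'.
Proof.
move=> e; rewrite ker_liftK//= !gmulfM !multV -!phiE p_i mulg1.
rewrite -!multV -!gmulfM (_ : _ * x' = 1) ?mult1//.
by rewrite -!mulgA [y * _]mulgA e !gsimpl.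
Qed.

(** These are the four pairs at which the cocycle is evaluated when the charts at (x, y) and (x',
    y') are both moved to first coordinate w: right translation by x^-1 w, respectively x'^-1 w,
    does this. *)
Definition translate_cocycles (E : set (G * G)) (w : G) (z : (G * G) * (G * G)
  * M) :=
  [/\ E (z.1.1.1, z.1.1.1^-1 * w), E (z.1.2.1, z.1.1.1^-1 * w),
      E (z.1.1.2, z.1.1.2^-1 * w) & E (z.1.2.2, z.1.1.2^-1 * w)].

Definition good_quad (C : set G) (z : (G * G) * (G * G) * M) :=
  [/\ C z.1.1.1, C z.1.1.2, C z.1.2.1, C z.1.2.2 &
      z.1.2.1 * z.1.1.1^-1 = z.1.2.2 * z.1.1.2^-1].

(* Both charts are compared through a common generic point [w]. *)
Lemma transition_cont_on : exists C, [/\ comeager C, cont_on C f &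
  cont_on (good_quad C) transition].
Proof.
have [D cD fD] := borel_cont_on scH bf.
have [E [cE E0 kE]] := cocycle_cont_on cD fD.
(* For such [x] a generic translate x^-1 w puts the pair (x, x^-1 w) into [E], so finitely many
   points of [C] admit a common generic [w]. *)
pose C := [set x | comeager [set t | E (x, t)]].
have cC : comeager C by apply: comeager_slices.
have CD : C `<=` D.
  by move=> x /(comeager_nonempty (1 : G) pG)[t /E0[]].
exists C; split=> //; first exact: cont_onS CD fD.
have gen z : good_quad C z -> comeager [set w | translate_cocycles E w z].
  case: z => [[[x x'] [y y']] m] [/= Cx Cx' Cy Cy' _].
  apply: (comeagerS _ (comeagerI
    (comeagerI (comeager_mulgl x^-1 Cx) (comeager_mulgl x^-1 Cy))
    (comeagerI (comeager_mulgl x'^-1 Cx') (comeager_mulgl x'^-1 Cy')))).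
  by move=> w [[? ?] [? ?]].
pose T := ((G * G) * (G * G) * M * G)%type.
pose Dom := [set u : T | translate_cocycles E u.2 u.1].
pose x1 (u : T) := u.1.1.1.1; pose x2 (u : T) := u.1.1.1.2.
pose y1 (u : T) := u.1.1.2.1; pose y2 (u : T) := u.1.1.2.2.
pose m1 (u : T) := u.1.2; pose w (u : T) := u.2.
pose r1 u := (x1 u)^-1 * w u; pose r2 u := (x2 u)^-1 * w u.
(* [n] is the coordinate of the same graph element in the chart (w, y x^-1 w), and [Psi] moves it
   back to the chart (x', y'). Both use only the cocycle, the conjugation action and [f], at
   arguments where these are continuous. *)
pose n u := (cocycle (y1 u, r1 u))^-1 * conj_lift (f (r1 u), m1 u) *
  cocycle (x1 u, r1 u).
pose Psi u := conj_lift ((f (r2 u))^-1, cocycle (y2 u, r2 u) * n u *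
  (cocycle (x2 u, r2 u))^-1).
have PsiE (u : T) : good_quad C u.1 -> Psi u = transition u.1.
  move: u => [[[[x x'] [y y']] m] w'] [/= _ _ _ _ e]; apply: inj_i.
  rewrite transitionE//.
  rewrite /Psi conj_liftE /n !gmulfM !multV conj_liftE !cocycleE.
  have e1 : y * (x^-1 * w') = y' * (x'^-1 * w') by rewrite mulgA e mulgA.
  by rewrite /y1 /r1 /x1 /w /y2 /r2 /x2 /m1 /= e1 !gsimpl.
move=> z gz V zV.
have [w0 Dw0] := comeager_nonempty (1 : G) pG (gen z gz).
pose u0 : T := (z, w0).
pose F := within Dom (nbhs u0).
have FF : Filter F by exact: within_filter.
have c (S : topologicalType) (h : T -> S) : continuous h -> h @ F --> h u0.
  by move=> ch; apply: continuous_within; exact: ch.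
have c1 : continuous (fun u : T => u.1) by exact: fst_continuous.
have c11 : continuous (fun u : T => u.1.1) by exact: continuous_compose c1
  (@fst_continuous _ _).
have c111 : continuous (fun u : T => u.1.1.1)
  by exact: continuous_compose c11 (@fst_continuous _ _).
have c112 : continuous (fun u : T => u.1.1.2)
  by exact: continuous_compose c11 (@snd_continuous _ _).
have cw : w @ F --> w u0 by apply: c; exact: snd_continuous.
have cm : m1 @ F --> m1 u0.
  by apply: c; exact: continuous_compose c1 (@snd_continuous _ _).
have cx1 : x1 @ F --> x1 u0.
  by apply: c; exact: continuous_compose c111 (@fst_continuous _ _).
have cx2 : x2 @ F --> x2 u0.
  by apply: c; exact: continuous_compose c111 (@snd_continuous _ _).
have cy1 : y1 @ F --> y1 u0.
  by apply: c; exact: continuous_compose c112 (@fst_continuous _ _).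
have cy2 : y2 @ F --> y2 u0.
  by apply: c; exact: continuous_compose c112 (@snd_continuous _ _).
have cr1 : r1 @ F --> r1 u0 := mulg_cvg FF (invg_cvg FF cx1) cw.
have cr2 : r2 @ F --> r2 u0 := mulg_cvg FF (invg_cvg FF cx2) cw.
have FDom : F Dom by exact: withinT.
have [D1 D2 D3 D4] := Dw0.
have cE' (a b : T -> G) : a @ F --> a u0 -> b @ F --> b u0 ->
    (forall u, Dom u -> E (a u, b u)) -> (fun u => cocycle (a u, b u)) @ F -->
      cocycle (a u0, b u0).
  move=> ca cb HE; apply: (cont_on_cvg FF kE (HE u0 Dw0) (cvg_pair ca cb)).
  by apply: filterS FDom.
have k1 := cE' y1 r1 cy1 cr1 (fun u (Du : Dom u) => let: And4 _ H _ _ :=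
  Du in H).
have k2 := cE' x1 r1 cx1 cr1 (fun u (Du : Dom u) => let: And4 H _ _ _ :=
  Du in H).
have k3 := cE' y2 r2 cy2 cr2 (fun u (Du : Dom u) => let: And4 _ _ _ H :=
  Du in H).
have k4 := cE' x2 r2 cx2 cr2 (fun u (Du : Dom u) => let: And4 _ _ H _ :=
  Du in H).
have fr1 : (fun u => f (r1 u)) @ F --> f (r1 u0).
  apply: (cont_on_cvg FF fD _ cr1); first by case: (E0 _ D1).
  by apply: filterS FDom => u [/E0[]].
have fr2 : (fun u => f (r2 u)) @ F --> f (r2 u0).
  apply: (cont_on_cvg FF fD _ cr2); first by case: (E0 _ D3).
  by apply: filterS FDom => u [_ _ /E0[]].
have cconj (a : T -> H) (b : T -> M) : a @ F --> a u0 -> b @ F --> b u0 ->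
    (fun u => conj_lift (a u, b u)) @ F --> conj_lift (a u0, b u0).
  by move=> ca cb; apply: (cvg_comp _ _ (cvg_pair ca cb));
    exact: conj_lift_continuous.
have cn : n @ F --> n u0.
  exact: (mulg_cvg FF (mulg_cvg FF (invg_cvg FF k1) (cconj _ _ fr1 cm)) k2).
have cPsi : Psi @ F --> Psi u0.
  apply: (cconj (fun u => (f (r2 u))^-1)
    (fun u => cocycle (y2 u, r2 u) * n u * (cocycle (x2 u, r2 u))^-1)).
    exact: invg_cvg.
  exact: (mulg_cvg FF (mulg_cvg FF k3 cn) (invg_cvg FF k4)).
have zV' : nbhs (Psi u0) V by rewrite PsiE.
have [[A B] /= [zA wB] AB] : nbhs u0 [set u | Dom u -> V (Psi u)] := cPsi V zV'.
apply: filterS zA => z' Az' gz'.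
move: wB; rewrite nbhsE => -[B' [oB' B'w] B'B].
have [||w' [Bw' Dw']] := baire pG (gen z' gz') (O := B').
- by exists w0.
- exact: oB'.
have := AB (z', w') (conj Az' (B'B _ Bw')) Dw'.
by rewrite PsiE.
Qed.

Definition graph_chart (C : set G) (z : set_type C * set_type C * M) : G * H :=
  (set_val z.1.2 * (set_val z.1.1)^-1,
   f (set_val z.1.2) * i z.2 * (f (set_val z.1.1))^-1).

Theorem polish_subgroup_graph :
  polish_subgroup [set x : G * H | phi x.1 = p x.2].
Proof.
have [C0 [[U HU UC0] fC0 trC0]] := transition_cont_on.
(* Shrinking to an exact G_delta set makes the subspace [Ct] Polish. *)
pose C := \bigcap_n U n.
have cC : comeager C by exists U.
have fC := cont_onS UC0 fC0.
have trC : cont_on (good_quad C) transition.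
  by apply: cont_onS trC0 => z [? ? ? ? ?]; split=> //; exact: UC0.
pose Ct := set_type C; pose Y := (Ct * Ct * M)%type.
pose q : Y -> G * H := @graph_chart C.
have pC : polish_space Ct.
  by apply: (polish_space_Gdelta pG (U := U)) => // n; exact: (HU n).1.
have pY : polish_space Y by apply: polish_space_prod => //;
  exact: polish_space_prod.
have vC (x : Ct) : C (set_val x) := set_mem (valP x).
have cv : continuous (@set_val _ C) by exact: initial_continuous.
have cf : continuous (fun x : Ct => f (set_val x)).
  move=> x O fO; suff : nbhs x [set y : Ct | O (f (set_val y))] by [].
  have hO : nbhs x (set_val @^-1` [set y | C y -> O (f y)]).
    by apply: cv; exact: (fC _ (vC x) _ fO).
  by apply: filterS hO => y /(_ (vC y)).
have cx : continuous (fun z : Y => z.1.1).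
  exact: continuous_compose (@fst_continuous _ _) (@fst_continuous _ _).
have cy : continuous (fun z : Y => z.1.2).
  exact: continuous_compose (@fst_continuous _ _) (@snd_continuous _ _).
have cvx : continuous (fun z : Y => set_val z.1.1)
  by exact: continuous_compose cx cv.
have cvy : continuous (fun z : Y => set_val z.1.2)
  by exact: continuous_compose cy cv.
have cg : continuous (fun z : Y => set_val z.1.2 * (set_val z.1.1)^-1).
  by move=> z; apply: mulg_cvg; [exact: cvy|apply: invg_cvg; exact: cvx].
have cq : continuous q.
  have cm : continuous (fun z : Y => i z.2).
    exact: continuous_compose (@snd_continuous _ _) ci.
  move=> z; apply: cvg_pair.
    by apply: mulg_cvg; [exact: cvy|apply: invg_cvg; exact: cvx].
  apply: mulg_cvg; last by apply: invg_cvg; exact: continuous_compose cx cf z.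
  by apply: mulg_cvg; [exact: continuous_compose cy cf z|exact: cm].
pose N := [set x : G * H | phi x.1 = p x.2].
have sN : subgroup_set N.
  split=> [|x y Nx Ny]; first by rewrite /N /= !mult1.
  by rewrite /N /= !gmulfM !multV Nx Ny.
have chart (g : G) (h : H) (x y : Ct) : phi g = p h ->
    set_val y = g * set_val x ->
    exists m, q (x, y, m) = (g, h).
  move=> gh yx; exists (ker_lift ((f (set_val y))^-1 * h * f (set_val x))).
  rewrite /q /graph_chart /= yx mulgK; congr (_, _); rewrite ker_liftK.
    by rewrite -!mulgA mulgV mulg1 mulVKg.
  by rewrite !gmulfM multV -!phiE gmulfM gh !gsimpl.
have rq : range q = N.
  apply/seteqP; split=> [_ [[[x y] m] _ <-]|[g h] gh].
    by rewrite /N /q /graph_chart /= !gmulfM !multV p_i mulg1 -!phiE.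
  have [x [Cx Cgx]] := comeager_nonempty (1 : G)
    pG (comeagerI cC (comeager_mulgl g cC)).
  have [x' ex] := set_valK Cx; have [y' ey] := set_valK (Cgx : C (g * x)).
  by have [|m qm] := chart g h x' y' gh; [rewrite ex ey|exists (x', y', m)].
have q_eq (x1 y1 x2 y2 : Ct) m1 : set_val y1 * (set_val x1)^-1 = set_val y2 *
  (set_val x2)^-1 ->
    q (x2, y2, transition (set_val x1, set_val x2, (set_val y1, set_val y2),
      m1)) =
    q (x1, y1, m1).
  move=> e; rewrite /q /graph_chart /= transitionE// e; congr (_, _).
  by rewrite !gsimpl.
(* Continuity of the transition maps in terms of boxes, so that the coordinates can be moved
   independently below. *)
have tr (x1 y1 x2 y2 : Ct) m1 O :
    set_val y1 * (set_val x1)^-1 = set_val y2 * (set_val x2)^-1 ->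
    nbhs (transition (set_val x1, set_val x2, (set_val y1, set_val y2), m1))
      O ->
    exists X1 X2 Y1 Y2 M1, [/\ nbhs (set_val x1) X1, nbhs (set_val x2) X2,
      nbhs (set_val y1) Y1, nbhs (set_val y2) Y2 & nbhs m1 M1 /\
      forall (a1 a2 b1 b2 : Ct) m, X1 (set_val a1) -> X2 (set_val a2) ->
        Y1 (set_val b1) -> Y2 (set_val b2) -> M1 m ->
        set_val b1 * (set_val a1)^-1 = set_val b2 * (set_val a2)^-1 ->
        O (transition (set_val a1, set_val a2, (set_val b1, set_val b2), m))].
  move=> e tO.
  have gz : good_quad C (set_val x1, set_val x2, (set_val y1, set_val y2), m1).
    by split=> //=; exact: vC.
  have [[Q M1] /= [[[QX QY] /= [[[X1 X2] /= [? ?] QXs] [[Y1 Y2] /= [? ?] QYs]]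
    Qs] ?] QM] :=
    trC _ gz _ tO.
  exists X1, X2, Y1, Y2, M1; split=> //; split=> // a1 a2 b1 b2 m *.
  apply: (QM (set_val a1, set_val a2, (set_val b1, set_val b2), m)).
    split=> //=; apply: Qs; split=> /=; first exact: QXs.
    exact: QYs.
  by split=> //=; exact: vC.
have near_set_val (x : Ct) (O : set Ct) : nbhs x O ->
    exists2 V, open_nbhs (set_val x) V & forall a : Ct, V (set_val a) -> O a.
  by move=> /nbhs_set_type.
apply: (polish_subgroup_image pY cq rq sN).
- move=> O [[x y] m] [[x' y'] m'] oO Oxym /= exy.
  have [e e2] : set_val y' * (set_val x')^-1 = set_val y * (set_val x)^-1 /\
      m = transition (set_val x', set_val x, (set_val y', set_val y), m').
    have e : set_val y' * (set_val x')^-1 = set_val y * (set_val x)^-1.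
      by have /(congr1 fst)/= := exy.
    split=> //; apply: inj_i; rewrite transitionE//.
    have := congr1 snd exy; rewrite /= => exy2.
    have -> : i m = (f (set_val y))^-1 * (f (set_val y)
      * i m * (f (set_val x))^-1) *
        f (set_val x) by rewrite !gsimpl.
    by rewrite exy2 !mulgA.
  have [[Q M0] /= [[[X0 Y0] /= [/near_set_val[X0' oX0 X0s] /near_set_val[Y0' oY0
    Y0s]] Qs] M0m] QM] :
    nbhs (x, y, m) O by exact: open_nbhs_nbhs.
  rewrite e2 in M0m.
  have [X1 [X2 [Y1 [Y2 [M1 [nX1 nX2 nY1 nY2 [nM1 tM]]]]]]] :=
    tr _ _ _ _ _ _ e M0m.
  have nX : nbhs (set_val x) (X2 `&` X0') by apply: filterI => //;
    exact: open_nbhs_nbhs.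
  have nY : nbhs (set_val y) (Y2 `&` Y0') by apply: filterI => //;
    exact: open_nbhs_nbhs.
  move: nX nY; rewrite nbhsE => -[AX [oAX AXx] AXs];
    rewrite nbhsE => -[AY [oAY AYy] AYs].
  pose g (z : Y) := set_val z.1.2 * (set_val z.1.1)^-1.
  have ng : nbhs (x', y', m') [set z | AY (g z * set_val x)].
    apply: (continuous_compose cg (@mulgr_continuous G (set_val x))).
    by rewrite /g /= e mulgVK; exact: open_nbhs_nbhs.
  have nX1' : nbhs (x', y', m') [set z : Y | X1 (set_val z.1.1)] by exact: (@cvx
    (x', y', m') _ nX1).
  have nY1' : nbhs (x', y', m') [set z : Y | Y1 (set_val z.1.2)] by exact: (@cvy
    (x', y', m') _ nY1).
  have nM1' : nbhs (x', y', m') [set z : Y | M1 z.2].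
    exact: (@snd_continuous _ _ (x', y', m') _ nM1).
  apply: filterS (filterI (filterI ng nX1') (filterI nY1' nM1')).
  move=> [[x1 y1] m1] [[/= gAY X1x1] [Y1y1 M1m1]].
  (* The nearby element must be re-expressed in the chart around (x, y): a generic x2 near [x] with
     g1 x2 generic and near [y] serves as new base, and the transition supplies the [M]
     coordinate. *)
  pose g1 := set_val y1 * (set_val x1)^-1.
  have [||x2 [[AX2 AY2] [Cx2 Cy2]]] := baire pG (comeagerI cC (comeager_mulgl g1
    cC))
      (O := AX `&` [set v | AY (g1 * v)]).
  + by exists (set_val x).
  + by apply: openI => //; apply: open_comp => // v _; exact: mulgl_continuous.
  have [x2' ex2] := set_valK Cx2; have [y2' ey2] :=
    set_valK (Cy2 : C (g1 * x2)).
  have e3 : set_val y1 * (set_val x1)^-1 = set_val y2' * (set_val x2')^-1.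
    by rewrite ex2 ey2 mulgK.
  have [X2x X0x] := AXs _ AX2; have [Y2y Y0y] := AYs _ AY2.
  exists (x2', y2', transition (set_val x1, set_val x2', (set_val y1,
    set_val y2'), m1)).
    apply: QM; split=> /=.
      by apply: Qs; split=> /=; [apply: X0s; rewrite ex2|apply: Y0s;
        rewrite ey2].
    by apply: tM => //; rewrite ?ex2 ?ey2.
  exact: q_eq.
(* Charts are chosen to be composable: with x, gb x and ga gb x generic, the middle terms s y cancel
   and the [M] coordinates simply multiply. *)
- move=> [ga ha] [gb hb] /= Na Nb.
  have [x [[Cx Cy] Cz]] := comeager_nonempty (1 : G) pG (comeagerI
    (comeagerI cC (comeager_mulgl gb cC)) (comeager_mulgl (ga * gb) cC)).
  have [x' ex] := set_valK Cx; have [y' ey] := set_valK (Cy : C (gb * x)).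
  have [z' ez] := set_valK (Cz : C (ga * gb * x)).
  have [|mb qb] := chart gb hb x' y' Nb; first by rewrite ex ey.
  have [|ma qa] := chart ga ha y' z' Na; first by rewrite ez ey mulgA.
  exists (y', z', ma), (x', y', mb), (x', z', ma * mb); split=> //.
    rewrite -qa -qb /q /graph_chart; congr (_, _);
      rewrite /= ?gmulfM !gsimpl //.
  move=> O [[Q M0] /= [[[X0 Z0] /= [/near_set_val[X0' oX0 X0s]
    /near_set_val[Z0' oZ0 Z0s]] Qs] /nbhs_mulg[Va [Vb [nVa nVb Vab]]]] QM].
  have trid (u v : Ct) m : transition (set_val u, set_val u, (set_val v,
    set_val v), m) = m.
    by apply: inj_i; rewrite transitionE// !gsimpl.
  have [|X1 [X2 [Y1 [Y2 [M1 [nX1 nX2 nY1 nY2 [nM1 tM]]]]]]] :=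
    tr x' y' x' y' mb Vb erefl; first by rewrite trid.
  have [|Y3 [Y4 [Z3 [Z4 [M2 [nY3 nY4 nZ3 nZ4 [nM2 tM']]]]]]] :=
    tr y' z' y' z' ma Va erefl; first by rewrite trid.
  have nX : nbhs (set_val x') (X2 `&` X0') by apply: filterI => //;
    exact: open_nbhs_nbhs.
  have nY : nbhs (set_val y') (Y2 `&` Y4) by exact: filterI.
  have nZ : nbhs (set_val z') (Z4 `&` Z0') by apply: filterI => //;
    exact: open_nbhs_nbhs.
  move: nX nY nZ; rewrite nbhsE => -[AX [oAX AXx] AXs].
  rewrite nbhsE => -[AY [oAY AYy] AYs]; rewrite nbhsE => -[AZ [oAZ AZz] AZs].
  have ng (u v : Ct) (m : M) (A : set G) : nbhs (set_val v) A ->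
      nbhs (u, v, m) [set z : Y | A (set_val z.1.2 * (set_val z.1.1)^-1 *
        set_val u)].
    have c : continuous (fun z : Y => set_val z.1.2 * (set_val z.1.1)^-1 *
      set_val u).
      exact: continuous_compose cg (@mulgr_continuous G _).
    move=> nA; have {}nA : nbhs (set_val v * (set_val u)^-1 * set_val u) A.
      by rewrite mulgVK.
    exact: (@c (u, v, m) A nA).
  have ngV (u v : Ct) (m : M) (A : set G) : nbhs (set_val u) A ->
      nbhs (u, v, m) [set z : Y | A ((set_val z.1.2 * (set_val z.1.1)^-1)^-1 *
        set_val v)].
    have c : continuous (fun z : Y => (set_val z.1.2 * (set_val z.1.1)^-1)^-1 *
      set_val v).
      exact: continuous_compose (continuous_compose cg (@invg_continuous G))
        (@mulgr_continuous G _).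
    move=> nA; have {}nA : nbhs ((set_val v * (set_val u)^-1)^-1 * set_val v) A.
      by rewrite !gsimpl.
    exact: (@c (u, v, m) A nA).
  exists ([set z : Y | AZ (set_val z.1.2 * (set_val z.1.1)^-1 * set_val y')] `&`
    ([set z : Y | Y3 (set_val z.1.1)] `&` [set z : Y | Z3 (set_val z.1.2)] `&`
     [set z : Y | M2 z.2])).
  exists ([set z : Y | AX ((set_val z.1.2 * (set_val z.1.1)^-1)^-1 * set_val
    y')] `&`
    ([set z : Y | X1 (set_val z.1.1)] `&` [set z : Y | Y1 (set_val z.1.2)] `&`
     [set z : Y | M1 z.2])).
  split.
  + apply: filterI; first by apply: ng; exact: open_nbhs_nbhs.
    apply: filterI; last exact: (@snd_continuous _ _ (y', z', ma) _ nM2).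
    apply: filterI; first exact: (@cvx (y', z', ma) _ nY3).
    exact: (@cvy (y', z', ma) _ nZ3).
  + apply: filterI; first by apply: ngV; exact: open_nbhs_nbhs.
    apply: filterI; last exact: (@snd_continuous _ _ (x', y', mb) _ nM1).
    apply: filterI; first exact: (@cvx (x', y', mb) _ nX1).
    exact: (@cvy (x', y', mb) _ nY1).
  move=> [[y2 z2] ma'] [[x1 y1] mb'] [/= AZz2 [[Y3y2 Z3z2] M2m]].
  move=> [AXx1 [[X1x1 Y1y1] M1m]].
  pose g1 := set_val y1 * (set_val x1)^-1; pose g2 :=
    set_val z2 * (set_val y2)^-1.
  (* Two nearby factors come in charts that need not share their middle point. Both are moved to
     charts through a common generic y3, where the product formula applies. *)
  have [||y3 [[[AY3 AX3] AZ3] [[Cy3 Cx3] Cz3]]] := baire pG (comeagerI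
      (comeagerI cC (comeager_mulgl g1^-1 cC)) (comeager_mulgl g2 cC))
      (O := AY `&` [set v | AX (g1^-1 * v)] `&` [set v | AZ (g2 * v)]).
  + by exists (set_val y').
  + by apply: openI; [apply: openI => //|]; apply: open_comp => // v _;
      exact: mulgl_continuous.
  have [y3' ey3] := set_valK Cy3; have [x3' ex3] :=
    set_valK (Cx3 : C (g1^-1 * y3)).
  have [z3' ez3] := set_valK (Cz3 : C (g2 * y3)).
  have e1 : set_val y1 * (set_val x1)^-1 = set_val y3' * (set_val x3')^-1.
    by rewrite ex3 ey3 invgM invgK mulgA mulgV mul1g.
  have e2 : set_val z2 * (set_val y2)^-1 = set_val z3' * (set_val y3')^-1.
    by rewrite ez3 ey3 mulgK.
  have [X2x X0x] := AXs _ AX3; have [Y2y Y4y] := AYs _ AY3.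
  have [Z4z Z0z] := AZs _ AZ3.
  pose tb := transition (set_val x1, set_val x3', (set_val y1, set_val y3'),
    mb').
  pose ta := transition (set_val y2, set_val y3', (set_val z2, set_val z3'),
    ma').
  exists (x3', z3', ta * tb).
    apply: QM; split=> /=.
      by apply: Qs; split=> /=; [apply: X0s; rewrite ex3|apply: Z0s;
        rewrite ez3].
    by apply: Vab; [apply: tM'|apply: tM] => //; rewrite ?ex3 ?ey3 ?ez3.
  rewrite -(q_eq _ _ _ _ mb' e1) -(q_eq _ _ _ _ ma' e2) -/ta -/tb.
  by rewrite /q /graph_chart; congr (_, _); rewrite /= ?gmulfM !gsimpl.
- move=> [g h] /= Ngh.
  have [x [Cx Cy]] := comeager_nonempty (1 : G)
    pG (comeagerI cC (comeager_mulgl g cC)).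
  have [x' ex] := set_valK Cx; have [y' ey] := set_valK (Cy : C (g * x)).
  have [|m qm] := chart g h x' y' Ngh; first by rewrite ex ey.
  have qV (u v : Ct) k : q (v, u, k^-1) = (q (u, v, k))^-1.
    by rewrite /q /graph_chart; congr (_, _); rewrite /= ?multV !gsimpl.
  exists (x', y', m), (y', x', m^-1); split=> //; first by rewrite qV qm.
  move=> O nO; exists [set z : Y | O (z.1.2, z.1.1, z.2^-1)].
    have c : continuous (fun z : Y => (z.1.2, z.1.1, z.2^-1) : Y).
      have cm : continuous (fun z : Y => z.2^-1).
        exact: continuous_compose (@snd_continuous _ _) (@invg_continuous M).
      by move=> z; exact: (cvg_pair (cvg_pair (@cy z) (@cx z)) (@cm z)).
    exact: (@c (x', y', m) _ nO).
  by move=> [[u v] k] /= Ouvk; exists (v, u, k^-1); rewrite ?qV.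
Qed.

End Graph.

(** * Morphisms as spans *)

HB.instance Definition _ (R : realType) (X : polish_cover R) :=
  isMultiplicative.Build (cover X) (quotient X) (quot_pi X)
    (fun g h => esym (quot_piM g h)).

Section Pairing.
Variables P G H : groupType.
Variables (f : {multiplicative P -> G}) (g : {multiplicative P -> H}).

Definition pairing (x : P) : G * H := (f x, g x).

Lemma pairing_multiplicative : {morph pairing : x y / x * y}.
Proof. by move=> x y; rewrite /pairing !gmulfM. Qed.

HB.instance Definition _ := isMultiplicative.Build P (G * H)%type pairing
  pairing_multiplicative.

End Pairing.

Lemma pairing_continuous (P G H : topologicalGroupType)
    (f : {multiplicative P -> G}) (g : {multiplicative P -> H}) :
  continuous f -> continuous g -> continuous (pairing f g).
Proof. by move=> cf cg x; apply: cvg_pair; [exact: cf|exact: cg]. Qed.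

Section Quotients.
Variable R : realType.
Implicit Types (X Y Z W : polish_cover R) (P Q : polishGroupType R).

Lemma quot_pi_surj X (x : quotient X) : exists g, quot_pi X g = x.
Proof. by exists (repr x); exact: quot_piK. Qed.

Lemma quot_pi1 X g : quot_pi X g = 1 <-> cover_ker X g.
Proof.
have -> : 1 = quot_pi X 1 by [].
split=> [/esym/quot_piP|Ng]; first by rewrite invg1 mul1g.
by apply/esym/quot_piP; rewrite invg1 mul1g.
Qed.

Lemma fiber_product P Q (K : polishGroupType R) (a : {multiplicative P -> K})
    (b : {multiplicative Q -> K}) : continuous a -> continuous b ->
  exists (F : polishGroupType R) (u : {multiplicative F -> P})
    (v : {multiplicative F -> Q}),
  [/\ continuous u, continuous v, forall z, a (u z) = b (v z),
    forall x y, a x = b y -> exists2 z, u z = x & v z = y &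
    forall z z', u z = u z' -> v z = v z' -> z = z'].
Proof.
move=> ca cb; pose N := [set x : P * Q | a x.1 = b x.2].
have sN : subgroup_set N.
  split=> [|x y Nx Ny]; first by rewrite /N /= !mult1.
  by rewrite /N /= !gmulfM !multV Nx Ny.
have cN : closed N.
  have c : continuous (fun x : P * Q => a x.1 * (b x.2)^-1).
    move=> x; apply: mulg_cvg; last apply: invg_cvg.
      exact: continuous_compose (@fst_continuous _ _) ca x.
    exact: continuous_compose (@snd_continuous _ _) cb x.
  have -> : N = (fun x : P * Q => a x.1 * (b x.2)^-1) @^-1` [set 1].
    apply/seteqP; split=> x /=; first by rewrite /N /= => ->; rewrite mulgV.
    by move=> /(congr1 (fun z => z * b x.2)); rewrite mulgVK mul1g.
  apply: (closed_comp (fun x _ => c x)).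
  by apply: accessible_closed_set1; apply: hausdorff_accessible;
    exact: polish_group_hausdorff.
have [F [j [ij cj rj]]] := polish_subgroup_closed sN cN.
exists F, (fst \o j), (snd \o j); split.
- exact: continuous_compose cj (@fst_continuous _ _).
- exact: continuous_compose cj (@snd_continuous _ _).
- by move=> z; have : N (j z) by rewrite -rj; exists z.
- move=> x y xy; have : N (x, y) by [].
  by rewrite -rj => -[z _ jz]; exists z; rewrite /= jz.
- by move=> z z' /= e1 e2; apply: ij; rewrite [LHS]surjective_pairing e1 e2
  -surjective_pairing.
Qed.

Lemma hom_graph X Y (f : pc_hom X Y) : exists (P : polishGroupType R)
    (a : {multiplicative P -> cover X}) (b : {multiplicative P -> cover Y}),
  [/\ continuous a, continuous b,
    forall z, f (quot_pi X (a z)) = quot_pi Y (b z) &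
    forall x y, f (quot_pi X x) = quot_pi Y y -> exists2 z, a z = x & b z = y].
Proof.
have [ft bft fE] := pc_borel f.
have [M [i [ii ci ri]]] := cover_ker_polish Y.
have [|h|P [j [_ cj rj]]] := @polish_subgroup_graph R (cover X) (cover Y)
  M i ci ii
  (quotient Y) (quot_pi Y) _ (pc_fun f \o quot_pi X) ft bft.
- by move=> h; rewrite ri quot_pi1.
- exact: fE.
exists P, (fst \o j), (snd \o j); split.
- exact: continuous_compose cj (@fst_continuous _ _).
- exact: continuous_compose cj (@snd_continuous _ _).
- move=> z; have : range j (j z) by exists z.
  by rewrite rj.
- move=> x y xy; have : range j (x, y) by rewrite rj.
  by move=> [z _ jz]; exists z; rewrite /= jz.
Qed.

(** The required Borel lift is [b] composed with a Borel section of the surjection [a]. *)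
Lemma hom_of_span X Y (P : polishGroupType R)
    (a : {multiplicative P -> cover X}) (b : {multiplicative P -> cover Y}) :
  continuous a -> continuous b -> (forall x, exists z, a z = x) ->
  (forall z, cover_ker X (a z) -> cover_ker Y (b z)) ->
  exists f : pc_hom X Y, forall z, f (quot_pi X (a z)) = quot_pi Y (b z).
Proof.
move=> ca cb sa ab; have [s bs as_] := borel_section ca sa.
have well z z' : quot_pi X (a z) = quot_pi X (a z') ->
    quot_pi Y (b z) = quot_pi Y (b z').
  move=> /quot_piP; rewrite -multV -gmulfM => /ab.
  by rewrite gmulfM multV => /quot_piP.
pose phi (x : quotient X) : quotient Y := quot_pi Y (b (s (repr x))).
have phiE z : phi (quot_pi X (a z)) = quot_pi Y (b z).
  by apply: well; rewrite as_; exact: quot_piK.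
have phiM : {morph phi : x y / x * y}.
  move=> x y; have [g gx] := quot_pi_surj x; have [h hy] := quot_pi_surj y.
  have [z zg] := sa g; have [t th] := sa h.
  rewrite -gx -hy -zg -th -gmulfM -gmulfM !phiE.
  by rewrite gmulfM gmulfM.
pose phi' : {multiplicative quotient X -> quotient Y} :=
  HB.pack phi (isMultiplicative.Build _ _ phi phiM).
have bphi : borel_definable phi'.
  exists (b \o s); first exact: borel_comp bs (continuous_borel cb).
  by move=> g; rewrite -{1}[g]as_; exact: phiE.
by exists (PCHom bphi).
Qed.

(** * Definable subgroups, subobjects and quotients *)

Definition definable X (S : set (quotient X)) :=
  exists (P : polishGroupType R) (j : {multiplicative P -> cover X}),
  continuous j /\ range j = [set g | S (quot_pi X g)].

(** Two morphisms agree at the class of x exactly when some pair (x, y) lies in both graphs, so the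
    fibre product of the graphs over the product of the covers parametrizes the preimage. *)
Lemma definable_equalizer X Y (f g : pc_hom X Y)
  : definable [set x | f x = g x].
Proof.
have [P [a [b [ca cb ab sab]]]] := hom_graph f.
have [Q [c [d [cc cd cd_ scd]]]] := hom_graph g.
have [F [u [v [cu cv uv suv _]]]] := fiber_product
  (pairing_continuous ca cb) (pairing_continuous cc cd).
exists F, (a \o u); split; first exact: continuous_compose cu ca.
apply/seteqP; split=> [_ [z _ <-]|x /= fg] /=.
  have [e1 e2] := uv z.
  by rewrite ab {1}e1 cd_ e2.
have [y yx] := quot_pi_surj (f (quot_pi X x)).
have [z zx zy] := sab _ _ (esym yx).
have [|t tx ty] := scd x y; first by rewrite -fg.
have [|w wz wt] := suv z t; first by rewrite /= /pairing zx zy tx ty.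
by exists w => //=; rewrite wz.
Qed.

Lemma definable_image X Y (f : pc_hom X Y) (S : set (quotient X)) :
  definable S -> definable (f @` S).
Proof.
move=> [P [j [cj rj]]]; have [Q [a [b [ca cb ab sab]]]] := hom_graph f.
have [F [u [v [cu cv uv suv _]]]] := fiber_product cj ca.
exists F, (b \o v); split; first exact: continuous_compose cv cb.
have jS z : S (quot_pi X (j z)).
  by move/seteqP: rj => [+ _]; apply; exists z.
apply/seteqP; split=> [_ [z _ <-]|y [x Sx fxy]] /=.
  by exists (quot_pi X (j (u z))); [exact: jS|rewrite uv ab].
have [g gx] := quot_pi_surj x; rewrite -gx in fxy Sx.
have : range j g by rewrite rj.
move=> [z _ zg]; have [t tg ty] := sab _ _ fxy.
have [|w wz wt] := suv z t; first by rewrite zg tg.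
by exists w => //=; rewrite wt.
Qed.

Section SubCover.
Variables (X : polish_cover R) (P : polishGroupType R).
Variables (j : {multiplicative P -> cover X}) (cj : continuous j).

Lemma sub_cover_normal : normal_subgroup [set z : P | cover_ker X (j z)].
Proof.
have [N1 Nd NJ] := cover_ker_normal X; split=> /=.
- by rewrite mult1.
- by move=> x y Nx Ny; rewrite gmulfM multV; exact: Nd.
- by move=> x g Nx; rewrite /conjg !gmulfM multV; exact: NJ.
Qed.

Lemma sub_cover_polish : polish_subgroup [set z : P | cover_ker X (j z)].
Proof.
have [M [i [ii ci ri]]] := cover_ker_polish X.
have [F [u [v [cu cv uv suv inj]]]] := fiber_product ci cj.
exists F, v; split=> //.
  by move=> z z' e; apply: inj => //; apply: ii; rewrite !uv e.
apply/seteqP; split=> [_ [z _ <-]|x] /=; first by rewrite -ri -uv; exists (u z).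
by rewrite -ri => -[m _ mx]; have [z _ zx] := suv _ _ mx; exists z.
Qed.

(** [P] modulo the preimage of the kernel: by construction its quotient embeds into that of [X]. *)
Definition sub_cover : polish_cover R := PolishCover sub_cover_normal
  sub_cover_polish.

End SubCover.

Lemma sub_object X (S : set (quotient X)) : definable S ->
  exists (K : polish_cover R) (k : pc_hom K X), injective k /\ range k = S.
Proof.
move=> [P [j [cj rj]]].
have [|||k kE] := @hom_of_span (sub_cover cj) X P idfun j _ cj _ _.
- by move=> x; exact: cvg_id.
- by move=> x; exists x.
- by [].
exists (sub_cover cj), k; split.
  move=> x y; have [g <-] := quot_pi_surj x; have [h <-] := quot_pi_surj y.
  by rewrite !kE => /quot_piP; rewrite -multV -gmulfM => H; apply/quot_piP.
apply/seteqP; split=> [_ [x _ <-]|x Sx].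
  have [g <-] := quot_pi_surj x; rewrite kE.
  by move/seteqP: rj => [+ _]; apply; exists g.
have [g gx] := quot_pi_surj x; rewrite -gx in Sx *.
have : range j g by rewrite rj.
by move=> [z _ <-]; exists (quot_pi (sub_cover cj) z) => //; rewrite kE.
Qed.

(** The covering group is kept and the kernel is enlarged to the preimage of [S], which is a Polish
    subgroup as a continuous homomorphic image. *)
Lemma quotient_object X (S : set (quotient X)) : definable S ->
  normal_subgroup S ->
  exists (Q : polish_cover R) (q : pc_hom X Q),
  (forall y, exists x, q x = y) /\ forall x, q x = 1 <-> S x.
Proof.
move=> [P [j [cj rj]]] [S1 Sd SJ].
have nS : normal_subgroup [set g | S (quot_pi X g)].
  split=> /=; first exact: S1.
  - by move=> x y Sx Sy; rewrite gmulfM multV; exact: Sd.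
  - by move=> x g Sx; rewrite /conjg !gmulfM multV; exact: SJ.
have pS : polish_subgroup [set g | S (quot_pi X g)].
  by rewrite -rj; exact: polish_subgroup_range.
pose Q := PolishCover nS pS.
have [||||q qE] := @hom_of_span X Q (cover X) idfun idfun.
- by move=> x; exact: cvg_id.
- by move=> x; exact: cvg_id.
- by move=> x; exists x.
- move=> z Nz; suff : S (quot_pi X z) by [].
  by have -> : quot_pi X z = 1 by apply/quot_pi1.
exists Q, q; split.
  by move=> y; have [g <-] := quot_pi_surj y; exists (quot_pi X g); exact: qE.
by move=> x; have [g <-] := quot_pi_surj x; rewrite qE quot_pi1.
Qed.

(** The fibre product of the graphs of [u] and [m] over the cover of [X] is a span from [W] to [L];
    its left leg is onto because [u] takes values in the image of [m]. *)
Lemma factor_injective X W L (m : pc_hom L X) (u : pc_hom W X) : injective m ->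
  (forall w, exists l, m l = u w) -> exists v : pc_hom W L, pc_comp m v = u.
Proof.
move=> im um.
have [P [a [b [ca cb ab sab]]]] := hom_graph u.
have [Q [c [d [cc cd cd_ scd]]]] := hom_graph m.
have [F [s [t [cs ct st sst _]]]] := fiber_product cb cd.
have sF g : exists z, a (s z) = g.
  have [x xg] := quot_pi_surj (u (quot_pi W g)).
  have [l lx] := um (quot_pi W g); have [l' ll] := quot_pi_surj l.
  have [z zg zx] := sab _ _ (esym xg).
  have [|z' zl zx'] := scd l' x; first by rewrite ll lx xg.
  have [|w wz wz'] := sst z z'; first by rewrite zx zx'.
  by exists w; rewrite wz.
have uE z : u (quot_pi W (a (s z))) = m (quot_pi L (c (t z))).
  by rewrite ab cd_ st.
have [||||v vE] := @hom_of_span W L F (a \o s) (c \o t).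
- exact: continuous_compose cs ca.
- exact: continuous_compose ct cc.
- exact: sF.
- move=> z /quot_pi1 az; apply/quot_pi1; apply: im.
  by rewrite -uE az !mult1.
exists v; apply: pc_hom_ext => w; have [g <-] := quot_pi_surj w.
by have [z <-] := sF g; rewrite /= (vE z) uE.
Qed.

(** The dual span: the fibre product of the two graphs over the cover of [B], with surjectivity of
    [q] making the leg to [Q] onto. *)
Lemma factor_surjective (B Q W : polish_cover R) (q : pc_hom B Q)
  (u : pc_hom B W) :
  (forall y, exists x, q x = y) -> (forall x, q x = 1 -> u x = 1) ->
  exists v : pc_hom Q W, pc_comp v q = u.
Proof.
move=> sq qu.
have [P [a [b [ca cb ab sab]]]] := hom_graph q.
have [P' [c [d [cc cd cd_ scd]]]] := hom_graph u.
have [F [s [t [cs ct st sst _]]]] := fiber_product ca cc.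
have sF (g : cover B) y w : q (quot_pi B g) = quot_pi Q y -> u (quot_pi B g)
  = quot_pi W w ->
    exists z, [/\ a (s z) = g, b (s z) = y & d (t z) = w].
  move=> qg ug; have [z zg zy] := sab _ _ qg; have [z' zg' zw] := scd _ _ ug.
  have [|r rz rz'] := sst z z'; first by rewrite zg zg'.
  by exists r; rewrite rz rz'.
have [||||v vE] := @hom_of_span Q W F (b \o s) (d \o t).
- exact: continuous_compose cs cb.
- exact: continuous_compose ct cd.
- move=> y; have [x xy] := sq (quot_pi Q y); have [g gx] := quot_pi_surj x.
  have [w wg] := quot_pi_surj (u x).
  by have [||z [_ zy _]] := sF g y w; rewrite ?gx //; exists z.
- move=> z /= /quot_pi1 bz; apply/quot_pi1.
  by rewrite -cd_ -st; apply: qu; rewrite ab.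
exists v; apply: pc_hom_ext => x; have [g <-] := quot_pi_surj x.
have [y yg] := quot_pi_surj (q (quot_pi B g)).
have [w wg] := quot_pi_surj (u (quot_pi B g)).
have [||z [_ zy zw]] := sF g y w => //.
by rewrite /= -yg -zy (vE z) -wg -zw.
Qed.

(** Lifting the identity through [f] gives a right inverse with a Borel lift; it is also a left
    inverse because [f] can be cancelled. *)
Lemma bijective_iso X Y (f : pc_hom X Y) : injective f ->
  (forall y, exists x, f x = y) -> @is_iso (PC R) X Y f.
Proof.
move=> fi fs; have [v vE] := factor_injective (u := pc_id Y) fi fs.
exists v; split=> //; apply: pc_hom_ext => x; apply: fi.
exact: (congr1 (fun h : pc_hom Y Y => h (f x)) vE).
Qed.

End Quotients.

Local Open Scope cat_scope.

(** * Finite limits *)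

Lemma finite_list (T : Type) : finite_set [set: T] ->
  exists s : list T, forall x, List.In x s.
Proof.
move=> [n /card_set_bijP[f [fn fi _]]].
have H k : exists s : list T, forall x, (f x < k)%N -> List.In x s.
  elim: k => [|k [s sP]]; first by exists nil.
  have [[x fx]|nx] := pselect (exists x, f x = k).
    exists (x :: s) => y; rewrite ltnS leq_eqVlt => /orP[/eqP fy|/sP];
      last by right.
    by left; apply: fi; rewrite ?inE// fx fy.
  exists s => y; rewrite ltnS leq_eqVlt => /orP[/eqP fy|/sP//].
  by case: nx; exists y.
by have [s sP] := H n; exists s => x; apply: sP; exact: fn.
Qed.

Section FiniteLimits.
Variable C : category.
Hypothesis some_hom : forall A B : C, hom A B.
Hypothesis terminal : exists T : C, is_terminal T.
Hypothesis products : forall A B : C, exists (P : C) (p : hom P A)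
  (q : hom P B),
  forall (W : C) (u : hom W A) (v : hom W B),
    exists! h : hom W P, p ∘ h = u /\ q ∘ h = v.
Hypothesis equalizers : forall (A B : C) (f g : hom A B),
  exists (E : C) (e : hom E A), f ∘ e = g ∘ e /\
  forall (W : C) (u : hom W A), f ∘ u = g ∘ u -> exists! h : hom W E, e ∘ h = u.

Variables (J : category) (D : functor J C).

(* Projections [l j] outside the list [s] are junk. *)
Lemma list_product (s : list J) : exists (P : C) (l : forall j, hom P (D j)),
  (forall (W : C) (k : forall j, hom W (D j)),
    exists h : hom W P, forall j, List.In j s -> l j ∘ h = k j) /\
  (forall (W : C) (h h' : hom W P),
    (forall j, List.In j s -> l j ∘ h = l j ∘ h') -> h = h').
Proof.
elim: s => [|i s [P [l [lU lM]]]].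
  have [T tT] := terminal; exists T, (fun j => some_hom T (D j)); split.
    by move=> W k; exists (some_hom W T).
  by move=> W h h' _; have [z [_ zU]] := tT W; rewrite -(zU h)// -(zU h').
(* Projections are indexed by objects and not by positions: a repeated object would contribute a
   second factor seen by no projection, so it is skipped. *)
have [si|nsi] := pselect (List.In i s).
  exists P, l; split=> [W k|W h h' hh'].
    by have [h hE] := lU W k; exists h => j [<-|]; apply: hE.
  by apply: lM => j js; apply: hh'; right.
have [Q [p [q pqU]]] := products P (D i).
pose l' j : hom Q (D j) := match pselect (i = j) with
  | left e => eq_rect i (fun z => hom Q (D z)) q j e
  | right _ => l j ∘ p end.
have l'i : l' i = q.
  rewrite /l'; case: pselect => [e|[]//].
  by rewrite (Prop_irrelevance e erefl).
have l'j j : i <> j -> l' j = l j ∘ p by rewrite /l'; case: pselect.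
exists Q, l'; split.
  move=> W k; have [h hE] := lU W k; have [g [[g1 g2] _]] := pqU W h (k i).
  exists g => j js; have [<-|ij] := pselect (i = j); first by rewrite l'i.
  by rewrite l'j// -compA g1; apply: hE; case: js.
move=> W h h' hh'.
have e2 : q ∘ h = q ∘ h' by have := hh' i (or_introl erefl); rewrite l'i.
have e1 : p ∘ h = p ∘ h'.
  apply: lM => j js; have ij : i <> j by move=> ij; apply: nsi; rewrite ij.
  by have := hh' j (or_intror js); rewrite !l'j// !compA.
have [z [_ zU]] := pqU W (p ∘ h') (q ∘ h').
by rewrite -(zU h) ?(zU h').
Qed.

Definition arrow := {ij : J * J & hom ij.1 ij.2}.

Definition commutes (P : C) (l : forall j, hom P (D j)) (a : arrow) :=
  fmor D (tagged a) ∘ l (tag a).1 = l (tag a).2.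

(** Start from the product of all objects and impose the commutation conditions one arrow at a time
    by equalizers. *)
Lemma list_limit (o : list J) (s : list arrow) : (forall j, List.In j o) ->
  exists (P : C) (l : forall j, hom P (D j)),
  [/\ forall a, List.In a s -> commutes l a,
    forall (W : C) (k : forall j, hom W (D j)),
      (forall a, List.In a s -> commutes k a) ->
      exists h : hom W P, forall j, l j ∘ h = k j &
    forall (W : C) (h h' : hom W P), (forall j, l j ∘ h = l j ∘ h') -> h = h'].
Proof.
move=> oP; elim: s => [|a s [P [l [lC lU lM]]]].
  have [P [l [lU lM]]] := list_product o; exists P, l; split=> // W.
    by move=> k _; have [h hE] := lU W k; exists h => j; exact: hE.
  by move=> h h' hh'; apply: lM.
have [E [e [eC eU]]] := equalizers (fmor D (tagged a) ∘ l (tag a).1)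
  (l (tag a).2).
exists E, (fun j => l j ∘ e); split.
- move=> b [<-|/lC bC]; rewrite /commutes compA; first exact: eC.
  by rewrite bC.
- move=> W k kC; have [|h hE] := lU W k; first by move=> b bs; apply: kC; right.
  have [|g [gE _]] := eU W h.
    by rewrite -compA !hE; apply: kC; left.
  by exists g => j; rewrite -compA gE.
- move=> W h h' hh'; have eh : e ∘ h = e ∘ h'.
    by apply: lM => j; rewrite !compA.
  have [|g [_ gU]] := eU W (e ∘ h'); first by rewrite !compA eC.
  by rewrite -(gU h) ?(gU h').
Qed.

End FiniteLimits.

Lemma finitely_complete_of_products_equalizers (C : category) :
  (forall A B : C, hom A B) -> (exists T : C, is_terminal T) ->
  (forall A B : C, exists (P : C) (p : hom P A) (q : hom P B),
    forall (W : C) (u : hom W A) (v : hom W B),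
      exists! h : hom W P, p ∘ h = u /\ q ∘ h = v) ->
  (forall (A B : C) (f g : hom A B), exists (E : C) (e : hom E A),
    f ∘ e = g ∘ e /\
    forall (W : C) (u : hom W A), f ∘ u = g ∘ u -> exists! h : hom W E,
      e ∘ h = u) ->
  finitely_complete C.
Proof.
move=> some_hom terminal products equalizers J [fJ fhom] D.
have [o oP] := finite_list fJ.
pose s_ (ij : J * J) := projT1 (cid (finite_list (fhom ij.1 ij.2))).
have sP ij u : List.In u (s_ ij) := projT2 (cid (finite_list (fhom ij.1 ij.2)))
  u.
pose s : list (arrow J) := List.flat_map
  (fun ij => List.map (fun u => Tagged (fun ij => hom ij.1 ij.2) u) (s_ ij))
  (List.list_prod o o).
have sall a : List.In a s.
  case: a => ij u; apply/List.in_flat_map; exists ij; split.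
    by case: ij u => i j u; apply: List.in_prod.
  exact/List.in_map/sP.
have [P [l [lC lU lM]]] :=
  list_limit some_hom terminal products equalizers D s oP.
have ln i j (u : hom i j) : fmor D u ∘ l i = l j.
  exact: (lC (Tagged (fun ij : J * J => hom ij.1 ij.2) (u : hom (i, j).1 (i,
    j).2)) (sall _)).
exists (Cone ln) => K.
have [|h hE] := lU (apex K) (leg K); first by move=> [[i j] u] _;
  exact: leg_nat.
exists h; split=> // h' h'E; apply: lM => j; rewrite hE; exact: esym (h'E j).
Qed.

(** * The category of groups with a Polish cover *)

Definition trivial_group : Type := unit.

Section TrivialGroup.
Local Notation T := trivial_group.

HB.instance Definition _ := Choice.copy T unit.

Definition trivial_mul (x y : T) : T := tt.
Definition trivial_inv (x : T) : T := tt.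

Let mulA : associative trivial_mul. Proof. by []. Qed.
Let mul1 : left_id (tt : T) trivial_mul. Proof. by case. Qed.
Let mulr1 : right_id (tt : T) trivial_mul. Proof. by case. Qed.
Let mulV : left_inverse (tt : T) trivial_inv trivial_mul. Proof. by []. Qed.
Let mulrV : right_inverse (tt : T) trivial_inv trivial_mul. Proof. by []. Qed.

HB.instance Definition _ := isGroup.Build T mulA mul1 mulr1 mulV mulrV.

Let trivial_open : set_system T := setT.

HB.instance Definition _ := isOpenTopological.Build T
  (I : trivial_open setT) (fun _ _ _ _ => I) (fun _ _ _ => I).

Lemma trivial_groupE (x y : T) : x = y. Proof. by case: x; case: y. Qed.

Let trivial_mulg_continuous : continuous (fun x : T * T => x.1 * x.2).
Proof.
have -> : (fun x : T * T => x.1 * x.2) = fun=> 1.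
  by apply/funext => x; exact: trivial_groupE.
by move=> x; exact: cvg_cst.
Qed.

Let trivial_invg_continuous : continuous (fun x : T => x^-1).
Proof.
have -> : (fun x : T => x^-1) = fun=> 1.
  by apply/funext => x; exact: trivial_groupE.
by move=> x; apply: cvg_cst; exact: nbhs_filter.
Qed.

HB.instance Definition _ := isTopologicalGroup.Build T
  trivial_mulg_continuous trivial_invg_continuous.

Lemma trivial_polish_space : polish_space T.
Proof.
split; first by move=> x y _; exact: trivial_groupE.
  apply: (@second_countable_of_basis T unit (fun=> setT)) => [_|x O xO].
    exact: openT.
  exists tt; split=> // y _; rewrite (trivial_groupE y x);
    exact: nbhs_singleton.
exists (fun _ _ => True); split=> //.
  move=> n x O xO; exists setT; split=> //.
  move=> y _; rewrite (trivial_groupE y x); exact: nbhs_singleton.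
move=> W _ _ _; exists 1 => O O1; exists 0%N => y _.
by rewrite (trivial_groupE y 1); exact: nbhs_singleton.
Qed.

HB.instance Definition _ (R : realType) := isPolish.Build R T
  (polish_space_separable trivial_polish_space)
  (polish_space_metrizable_group R trivial_polish_space).

End TrivialGroup.

Section PCcategory.
Variable R : realType.
Local Notation PC := (PC R).

Definition ev (A B : PC) (f : hom A B) (x : quotient A) : quotient B :=
  pc_fun (f : pc_hom A B) x.

Lemma ev_ext (A B : PC) (f g : hom A B) : ev f =1 ev g -> f = g.
Proof. exact: pc_hom_ext. Qed.

Lemma ev_comp (A B E : PC) (g : hom B E) (f : hom A B) x :
  ev (g ∘ f) x = ev g (ev f x).
Proof. by []. Qed.

Lemma ev_id (A : PC) x : ev (idm A) x = x.
Proof. by []. Qed.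

Lemma evM (A B : PC) (f : hom A B) x y : ev f (x * y) = ev f x * ev f y.
Proof. exact: gmulfM. Qed.

Lemma ev1 (A B : PC) (f : hom A B) : ev f 1 = 1.
Proof. exact: mult1. Qed.

Lemma evV (A B : PC) (f : hom A B) x : ev f x^-1 = (ev f x)^-1.
Proof. exact: multV. Qed.

Lemma ev_injective (A B : PC) (f : hom A B) :
  (forall x, ev f x = 1 -> x = 1) -> injective (ev f).
Proof.
move=> H x y xy; have : x * y^-1 = 1 by apply: H; rewrite evM evV xy mulgV.
by move=> /(congr1 (fun z => z * y)); rewrite mulgVK mul1g.
Qed.

Lemma zero_hom (A B : PC) : exists f : hom A B, forall x, ev f x = 1.
Proof.
pose phi := (fun=> 1) : quotient A -> quotient B.
have phiM : {morph phi : x y / x * y} by move=> x y; rewrite mulg1.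
pose phi' : {multiplicative quotient A -> quotient B} :=
  HB.pack phi (isMultiplicative.Build _ _ phi phiM).
have bphi : borel_definable phi'.
  by exists (fun=> 1) => //; apply: continuous_borel => x; exact: cvg_cst.
by exists (PCHom bphi).
Qed.

Lemma zero_object : exists Z : PC, forall x : quotient Z, x = 1.
Proof.
have sN : subgroup_set [set: trivial_group] by [].
have nN : normal_subgroup [set: trivial_group] by [].
pose Z : polish_cover R := @PolishCover R trivial_group setT nN
  (@polish_subgroup_closed R trivial_group setT sN closedT).
exists Z => x; have [g <-] := quot_pi_surj x; exact/quot_pi1.
Qed.

Lemma pc_product (A B : PC) : exists (P : PC) (p : hom P A) (q : hom P B),
  [/\ forall x y, exists z, ev p z = x /\ ev q z = y,
    forall z z', ev p z = ev p z' -> ev q z = ev q z' -> z = z' &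
    forall (W : PC) (u : hom W A) (v : hom W B),
      exists h : hom W P, p ∘ h = u /\ q ∘ h = v].
Proof.
pose G := cover (A : polish_cover R); pose H := cover (B : polish_cover R).
pose N := [set x : G * H | cover_ker (A : polish_cover R) x.1 /\
  cover_ker (B : polish_cover R) x.2].
have nN : normal_subgroup N.
  have [A1 Ad AJ] := cover_ker_normal (A : polish_cover R).
  have [B1 Bd BJ] := cover_ker_normal (B : polish_cover R).
  split=> [//|x y [? ?] [? ?]|x g [? ?]]; split=> /=.
  - exact: Ad.
  - exact: Bd.
  - exact: AJ.
  - exact: BJ.
have pN : polish_subgroup N.
  have [M [i [ii ci ri]]] := cover_ker_polish (A : polish_cover R).
  have [M' [i' [ii' ci' ri']]] := cover_ker_polish (B : polish_cover R).
  pose j : {multiplicative (M * M')%type -> (G * H)%type} :=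
    pairing (i \o (@fst M M')) (i' \o (@snd M M')).
  have cj : continuous j.
    apply: (pairing_continuous (f := i \o (@fst M M')) (g :=
      i' \o (@snd M M'))).
      exact: continuous_compose (@fst_continuous _ _) ci.
    exact: continuous_compose (@snd_continuous _ _) ci'.
  have <- : range j = N; last exact: polish_subgroup_range.
  apply/seteqP; split=> [_ [[m m'] _ <-]|[x y] []] /=.
    by split=> /=; [rewrite -ri; exists m|rewrite -ri'; exists m'].
  by rewrite -ri -ri' => -[m _ mx] [m' _ my]; exists (m, m') => //; congr (_,
    _).
pose P : polish_cover R := PolishCover nN pN.
have idc (S : topologicalType) : continuous (@idfun S) by move=> x;
  exact: cvg_id.
have [||||p pE] := @hom_of_span R P A (G * H)%type idfun fst.
- exact: idc.
- exact: fst_continuous.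
- by move=> x; exists x.
- by move=> z [].
have [||||q qE] := @hom_of_span R P B (G * H)%type idfun snd.
- exact: idc.
- exact: snd_continuous.
- by move=> x; exists x.
- by move=> z [].
exists P, p, q; split.
- move=> x y; have [g <-] := quot_pi_surj x; have [h <-] := quot_pi_surj y.
  by exists (quot_pi P (g, h)); split; [exact: (pE (g, h))|exact: (qE (g, h))].
- move=> z z'; have [g <-] := quot_pi_surj z; have [g' <-] := quot_pi_surj z'.
  rewrite /ev (pE g) (pE g') (qE g) (qE g') => /quot_piP N1 /quot_piP N2.
  by apply/quot_piP.
- move=> W u v.
  have [Q [a [b [ca cb ab sab]]]] := hom_graph (u : pc_hom W A).
  have [Q' [c [d [cc cd cd_ scd]]]] := hom_graph (v : pc_hom W B).
  have [F [s [t [cs ct st sst _]]]] := fiber_product ca cc.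
  (* The pairing of [u] and [v] is induced by the fibre product of their graphs over the cover of
     [W]. *)
  pose j : {multiplicative F -> (G * H)%type} := pairing (b \o s) (d \o t).
  have sF g : exists z, (a \o s) z = g.
    have [x xg] := quot_pi_surj ((u : pc_hom W A) (quot_pi W g)).
    have [y yg] := quot_pi_surj ((v : pc_hom W B) (quot_pi W g)).
    have [z zg _] := sab _ _ (esym xg); have [z' zg' _] := scd _ _ (esym yg).
    have [|w wz _] := sst z z'; first by rewrite zg zg'.
    by exists w; rewrite /= wz.
  have [||||h hE] := @hom_of_span R W P F (a \o s) j.
  + exact: continuous_compose cs ca.
  + apply: (pairing_continuous (f := b \o s) (g := d \o t)).
      exact: continuous_compose cs cb.
    exact: continuous_compose ct cd.
  + exact: sF.
  + move=> z /quot_pi1 az; split; apply/quot_pi1 => /=.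
      by rewrite -ab az mult1.
    by rewrite -cd_ -st az mult1.
  exists h; split; apply: ev_ext => w; have [g <-] := quot_pi_surj w;
    have [z <-] := sF g; rewrite ev_comp /ev (hE z).
    by rewrite (pE (j z)) ab.
  by rewrite (qE (j z)) /= st cd_.
Qed.

Lemma pc_pairing_unique (A B P : PC) (p : hom P A) (q : hom P B) :
  (forall z z', ev p z = ev p z' -> ev q z = ev q z' -> z = z') ->
  forall (W : PC) (h h' : hom W P), p ∘ h = p ∘ h' -> q ∘ h = q ∘ h' -> h = h'.
Proof.
move=> inj W h h' e1 e2; apply: ev_ext => w; apply: inj.
  by rewrite -!ev_comp e1.
by rewrite -!ev_comp e2.
Qed.

Lemma pc_equalizer (A B : PC) (f g : hom A B) : exists (K : PC) (k : hom K A),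
  [/\ injective (ev k), forall x, ev f x = ev g x <-> exists y, ev k y = x &
    forall (W : PC) (u : hom W A), f ∘ u = g ∘ u -> exists h : hom W K,
      k ∘ h = u].
Proof.
have [K [k [ik rk]]] := sub_object (definable_equalizer (f : pc_hom A B) g).
have kP x : ev f x = ev g x <-> exists y, ev k y = x.
  split=> [fg|[y <-]]; first by move/seteqP: rk => [_ /(_ x fg)[y _ <-]];
    exists y.
  by move/seteqP: rk => [+ _]; apply; exists y.
exists K, k; split=> // W u e.
apply: (factor_injective (m := k) (u := (u : pc_hom W A)) ik) => w.
by apply/kP; rewrite -/(ev u w) -!ev_comp e.
Qed.

Lemma injective_monic (A B : PC) (k : hom A B) : injective (ev k) ->
  forall (W : PC) (h h' : hom W A), k ∘ h = k ∘ h' -> h = h'.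
Proof.
by move=> ik W h h' e; apply: ev_ext => w; apply: ik; rewrite -!ev_comp e.
Qed.

Lemma surjective_epic (A B : PC) (k : hom A B) : (forall y, exists x,
  ev k x = y) ->
  forall (W : PC) (h h' : hom B W), h ∘ k = h' ∘ k -> h = h'.
Proof.
move=> sk W h h' e; apply: ev_ext => y; have [x <-] := sk y.
by rewrite -!ev_comp e.
Qed.

Lemma pc_finitely_complete : finitely_complete PC.
Proof.
apply: finitely_complete_of_products_equalizers.
- by move=> A B; exact: projT1 (cid (zero_hom A B)).
- have [Z Z1] := zero_object; exists Z => A; have [f f1] := zero_hom A Z.
  by exists f; split=> // g _; apply: ev_ext => x; rewrite (Z1 (ev f x))
    (Z1 (ev g x)).
- move=> A B; have [P [p [q [_ inj pq]]]] := pc_product A B.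
  exists P, p, q => W u v; have [h [h1 h2]] := pq W u v; exists h;
    split=> // h'.
  by move=> [h1' h2']; apply: (pc_pairing_unique inj); rewrite ?h1 ?h2.
- move=> A B f g; have [K [k [ik kP kU]]] := pc_equalizer f g.
  exists K, k; split; first by apply: ev_ext => x; apply/kP; exists x.
  move=> W u /kU[h hE]; exists h; split=> // h' h'E.
  by apply: (injective_monic ik); rewrite hE.
Qed.

Lemma pc_pointed : pointed PC.
Proof.
have [Z Z1] := zero_object; exists Z; split=> A.
  have [f f1] := zero_hom Z A; exists f; split=> // g _; apply: ev_ext => x.
  by rewrite (Z1 x) !ev1.
have [f f1] := zero_hom A Z; exists f; split=> // g _; apply: ev_ext => x.
by rewrite (Z1 (ev f x)) (Z1 (ev g x)).
Qed.

(** The kernel inclusion of the pairing S -> A x B has the same composites with [r1] and [r2] as the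
    zero map, so it is zero and the pairing is injective on elements. *)
Lemma pc_jointly_monic (S A B : PC) (r1 : hom S A) (r2 : hom S B) :
  jointly_monic r1 r2 ->
  forall x y, ev r1 x = ev r1 y -> ev r2 x = ev r2 y -> x = y.
Proof.
move=> jm; have [P [p [q [_ inj pq]]]] := pc_product A B.
have [h [h1 h2]] := pq S r1 r2; have [z z1] := zero_hom S P.
have [K [k [ik kP _]]] := pc_equalizer h z.
have [o o1] := zero_hom K S.
have hk w : ev h (ev k w) = 1 by rewrite -(z1 (ev k w)); apply/kP; exists w.
have ko : k = o.
  apply: jm; apply: ev_ext => w; rewrite !ev_comp o1 ev1.
    by rewrite -h1 ev_comp hk ev1.
  by rewrite -h2 ev_comp hk ev1.
have ih : injective (ev h).
  apply: ev_injective => x hx; have /kP[w <-] : ev h x = ev z x by rewrite hx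
    z1.
  by rewrite ko o1.
move=> x y e1 e2; apply: ih; apply: inj.
  by rewrite -!ev_comp h1.
by rewrite -!ev_comp h2.
Qed.

Lemma pc_pullback (A B I : PC) (f : hom A I) (g : hom B I) :
  exists (P : PC) (p : hom P A) (q : hom P B), is_pullback f g p q /\
  forall x y, ev f x = ev g y -> exists z, ev p z = x /\ ev q z = y.
Proof.
have [P [p [q [sP inj pq]]]] := pc_product A B.
have [K [k [ik kP kU]]] := pc_equalizer (f ∘ p) (g ∘ q).
exists K, (p ∘ k), (q ∘ k); split; last first.
  move=> x y fg; have [z [zx zy]] := sP x y.
  have /kP[w wz] : ev (f ∘ p) z = ev (g ∘ q) z by rewrite !ev_comp zx zy.
  by exists w; rewrite !ev_comp wz.
split; first by apply: ev_ext => x; rewrite !ev_comp -!ev_comp; apply/kP;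
  exists x.
move=> W u v uv; have [h [h1 h2]] := pq W u v.
have [|l lE] := kU W h; first by rewrite -!compA h1 h2.
exists l; split; first by rewrite -!compA lE.
move=> l' []; rewrite -!compA => e1 e2.
by apply: (injective_monic ik); apply: (pc_pairing_unique inj);
  rewrite lE ?h1 ?h2 ?e1 ?e2.
Qed.

(** The universal property maps the explicitly constructed pullback, where such elements exist, into
    the given one. *)
Lemma pullback_elements (A B I P : PC) (f : hom A I) (g : hom B I)
    (p : hom P A) (q : hom P B) : is_pullback f g p q ->
  forall x y, ev f x = ev g y -> exists z, ev p z = x /\ ev q z = y.
Proof.
move=> [_ pbU] x y fg; have [P' [p' [q' [[e _] el]]]] := pc_pullback f g.
have [h [[h1 h2] _]] := pbU P' p' q' e; have [z [zx zy]] := el x y fg.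
by exists (ev h z); rewrite -!ev_comp h1 h2.
Qed.

Lemma pullback_jointly_monic (C : category) (A B I P : C) (f : hom A I)
    (g : hom B I) (p : hom P A) (q : hom P B) :
  is_pullback f g p q -> jointly_monic p q.
Proof.
move=> [e pbU] W u v e1 e2.
have [|h [_ hU]] := pbU W (p ∘ v) (q ∘ v); first by rewrite !compA e.
by rewrite -(hU u) ?(hU v).
Qed.

(** The kernel pair of [f] contains a pair (x, 1) whenever f x = 1, so a map that equalizes [r1] and
    [r2] kills the kernel of [f], which is also that of [q], and factors through [q]. *)
Lemma pc_coequalizer_kernel_pair (A B S W : PC) (f : hom A B) (r1 r2 : hom S A)
    (q : hom A W) : is_pullback f f r1 r2 -> (forall y, exists x, ev q x = y) ->
  (forall x, ev q x = 1 <-> ev f x = 1) -> is_coequalizer r1 r2 q.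
Proof.
move=> pb sq qf; split.
  apply: ev_ext => r; rewrite !ev_comp.
  suff : ev q (ev r1 r * (ev r2 r)^-1) = 1.
    rewrite evM evV => /(congr1 (fun z => z * ev q (ev r2 r))).
    by rewrite mulgVK mul1g.
  by apply/qf; rewrite evM evV -!ev_comp pb.1 mulgV.
move=> V u e; have [|h hE] := factor_surjective (q := (q : pc_hom A W))
    (u := (u : pc_hom A V)) sq.
  move=> x /qf fx.
  have [|r [<- r2r]] := pullback_elements pb (x := x) (y := 1).
    by rewrite fx ev1.
  by rewrite -/(ev u _) -ev_comp e ev_comp r2r ev1.
by exists h; split=> // h' h'E; apply: (surjective_epic sq); rewrite h'E;
  exact: hE.
Qed.

(** The image is realized as the quotient of [A] by the kernel of [f]. *)
Lemma pc_image (A B : PC) (f : hom A B) : exists (Q : PC) (q : hom A Q)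
  (m : hom Q B),
  [/\ forall y, exists x, ev q x = y, injective (ev m), m ∘ q = f &
   forall x, ev q x = 1 <-> ev f x = 1].
Proof.
have [z z1] := zero_hom A B.
have dS := definable_equalizer (f : pc_hom A B) z.
have SE x : [set x | (f : pc_hom A B) x = (z : pc_hom A B) x] x <-> ev f x = 1.
  by rewrite /= -/(ev f x) -/(ev z x) z1.
have nS : normal_subgroup [set x | (f : pc_hom A B) x = (z : pc_hom A B) x].
  split; first by apply/SE; exact: ev1.
  - by move=> x y /SE fx /SE fy; apply/SE; rewrite evM evV fx fy mulgV.
  - by move=> x g /SE fx; apply/SE; rewrite /conjg !evM evV fx mul1g mulVg.
have [Q [q [sq qE]]] := quotient_object dS nS.
have qf x : ev q x = 1 <-> ev f x = 1 by rewrite -SE; exact: qE.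
have [|m mE] := factor_surjective (q := q) (u := (f : pc_hom A B)) sq.
  by move=> x /qf.
exists Q, q, m; split=> //; apply: ev_injective => y; have [x <-] := sq y.
by move=> mq; apply/qf; rewrite -mE.
Qed.

(** Given a coequalizer [q], write q = m e with e onto and m injective. The map e factors as h q by
    the universal property, and m h = 1 follows by uniqueness, so an element mapped by e to h y is
    mapped by q to y. *)
Lemma regular_epi_surjective (B Q : PC) (q : hom B Q) :
  regular_epi q <-> forall y, exists x, ev q x = y.
Proof.
split=> [[A [f [g [qfg qU]]]]|sq]; last first.
  have [S [r1 [r2 [pb _]]]] := pc_pullback q q.
  by exists S, r1, r2; apply: (pc_coequalizer_kernel_pair pb).
have [E [e [m [se im me _]]]] := pc_image q.
have efg : e ∘ f = e ∘ g by apply: (injective_monic im); rewrite !compA me.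
have [h [hE _]] := qU E e efg.
have mh : m ∘ h = idm Q.
  have [l [_ lU]] := qU Q q qfg.
  by rewrite -(lU (m ∘ h)) ?(lU (idm Q))// ?comp_idl// -compA hE.
move=> y; have [x xy] := se (ev h y); exists x.
by rewrite -me ev_comp xy -ev_comp mh.
Qed.

Lemma pc_regular : regular PC.
Proof.
split; first exact: pc_finitely_complete.
- move=> A B S f r1 r2 pb; have [Q [q [m [sq _ _ qf]]]] := pc_image f.
  by exists Q, q; exact: pc_coequalizer_kernel_pair pb sq qf.
- move=> A B I P f g p q pb /regular_epi_surjective sf.
  apply/regular_epi_surjective => y; have [x xy] := sf (ev g y).
  by have [z [_ zy]] := pullback_elements pb xy; exists z.
Qed.

(* A reflexive relation [S] on a group is a congruence: it is determined by the
   normal subgroup of the elements related to [1]. *)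
Lemma pc_exact : barr_exact PC.
Proof.
split; first exact: pc_regular.
move=> S X r1 r2 [jm [d [d1 d2]] _ _].
have dr1 x : ev r1 (ev d x) = x by rewrite -ev_comp d1.
have dr2 x : ev r2 (ev d x) = x by rewrite -ev_comp d2.
have [z z1] := zero_hom S X.
pose N := (r2 : pc_hom S X) @` [set r | (r1 : pc_hom S X) r = (z : pc_hom S X)
  r].
have dN : definable N by apply/definable_image/definable_equalizer.
have NE y : N y <-> exists2 r, ev r1 r = 1 & ev r2 r = y.
  split=> [[r r1r <-]|[r r1r <-]]; exists r => //.
    by rewrite /= -(z1 r).
  by rewrite /= -/(ev z r) z1.
have nN : normal_subgroup N.
  split; first by apply/NE; exists 1; exact: ev1.
  - move=> x y /NE[r e1 <-] /NE[r' e1' <-]; apply/NE; exists (r * r'^-1).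
      by rewrite evM evV e1 e1' mulgV.
    by rewrite evM evV.
  - move=> x g /NE[r e1 <-]; apply/NE; exists (r ^ ev d g).
      by rewrite /conjg !evM evV e1 mul1g mulVg.
    by rewrite /conjg !evM evV dr2.
have [Y [f [sf fN]]] := quotient_object dN nN.
exists Y, f; split.
  apply: ev_ext => r; rewrite !ev_comp.
  suff : ev f ((ev r1 r)^-1 * ev r2 r) = 1.
    rewrite evM evV => /(congr1 (fun z => ev f (ev r1 r) * z)).
    by rewrite mulVKg mulg1 => ->.
  apply/fN/NE; exists ((ev d (ev r1 r))^-1 * r).
    by rewrite evM evV dr1 mulVg.
  by rewrite evM evV dr2.
have [P [p [q [_ inj pq]]]] := pc_product X X.
have [rho [rho1 rho2]] := pq S r1 r2.
have irho : injective (ev rho).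
  by move=> x y e; apply: (pc_jointly_monic jm);
    rewrite -?rho1 -?rho2 !ev_comp e.
move=> W u v uv; have [w [w1 w2]] := pq W u v.
(* The pairing of [u] and [v] lands in the relation: if [r] relates 1 to u(t)^-1 v(t), then
   multiplying [r] by the diagonal element at u(t) relates u(t) to v(t). *)
have [|h hE] := factor_injective (m := (rho : pc_hom S P)) (u :=
  (w : pc_hom W P)) irho.
  move=> t.
  have /fN/NE[r e1 e2] : ev f ((ev u t)^-1 * ev v t) = 1.
    by rewrite evM evV -!ev_comp uv mulVg.
  exists (ev d (ev u t) * r); apply: inj.
    by rewrite -!ev_comp rho1 w1 evM dr1 e1 mulg1.
  by rewrite -!ev_comp rho2 w2 evM dr2 e2 mulVKg.
have hE' : rho ∘ h = w := hE.
exists h; split.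
  by rewrite -rho1 -rho2 -!compA hE'.
move=> h' [e1 e2]; apply: jm; rewrite ?e1 ?e2 -?rho1 -?rho2 -compA hE' //.
Qed.

Lemma is_iso_bijective (A B : PC) (f : hom A B) :
  is_iso f <-> injective (ev f) /\ forall y, exists x, ev f x = y.
Proof.
split=> [[g [gf fg]]|[fi fs]]; last exact: bijective_iso.
split=> [x y e|y].
  by rewrite -[x]ev_id -[y]ev_id -gf !ev_comp e.
by exists (ev g y); rewrite -ev_comp fg.
Qed.

Lemma point_iso (C : category) (I : C) (X Y : Pt I) (h : hom X Y) :
  is_iso (pt_mor h) -> is_iso h.
Proof.
move=> [g [gh hg]].
have gp : pt_proj X ∘ g = pt_proj Y.
  by rewrite -(pt_mor_proj h) -compA hg comp_idr.
have gs : g ∘ pt_sect Y = pt_sect X.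
  by rewrite -(pt_mor_sect h) compA gh comp_idl.
exists (PointHom gp gs); split; apply: point_hom_ext; [exact: gh|exact: hg].
Qed.

(** The split short five lemma, argued on elements: the fibre of the pullback over the identity of
    [J] is the kernel of the split epimorphism, so an isomorphism after pullback is already
    bijective on kernels. *)
Lemma pc_protomodular : protomodular PC.
Proof.
split.
  move=> A I J p f _; have [P [a [b [pb _]]]] := pc_pullback p f.
  by constructor; exact: Pullback pb.
move=> I J f pb X Y h [g [gk kg]]; apply: point_iso.
have : is_iso (pt_mor (fmor (inverse_image pb) h)).
  exists (pt_mor g); split; first exact: (congr1 (@pt_mor _ _ _ _) gk).
  exact: (congr1 (@pt_mor _ _ _ _) kg).
set k := pt_mor _ => /is_iso_bijective[ik sk].
have k1 : pb_fst (pb Y) ∘ k = pt_mor h ∘ pb_fst (pb X) by exact: pb_lift_fst.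
have k2 : pb_snd (pb Y) ∘ k = pb_snd (pb X) by exact: pb_lift_snd.
have elX := pullback_elements (pb_spec (pb X)).
have elY := pullback_elements (pb_spec (pb Y)).
have injX := pc_jointly_monic (pullback_jointly_monic (pb_spec (pb X))).
have injY := pc_jointly_monic (pullback_jointly_monic (pb_spec (pb Y))).
have hp x : ev (pt_proj Y) (ev (pt_mor h) x) = ev (pt_proj X) x.
  by rewrite -ev_comp pt_mor_proj.
have hs i : ev (pt_mor h) (ev (pt_sect X) i) = ev (pt_sect Y) i.
  by rewrite -ev_comp pt_mor_sect.
apply/is_iso_bijective; split.
  apply: ev_injective => x hx.
  have [|z [zx z1]] := elX x 1; first by rewrite -hp hx !ev1.
  rewrite -zx (_ : z = 1) ?ev1//; apply: ik; apply: injY.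
    by rewrite -!ev_comp k1 !ev_comp zx hx !ev1.
  by rewrite -!ev_comp k2 !ev1.
(* Dividing [y] by the section value at its projection moves it into the kernel, where the pulled
   back map is onto; the section of [X] restores the removed part. *)
move=> y; pose y' := y * (ev (pt_sect Y) (ev (pt_proj Y) y))^-1.
have [|z [zy z1]] := elY y' 1.
  by rewrite /y' evM evV -[ev _ (ev (pt_sect Y)
    _)]ev_comp pt_split ev_id mulgV ev1.
have [z0 zz0] := sk z.
exists (ev (pb_fst (pb X)) z0 * ev (pt_sect X) (ev (pt_proj Y) y)).
by rewrite evM hs -[ev (pt_mor h) _]ev_comp -k1 ev_comp zz0 zy mulgVK.
Qed.

End PCcategory.

Theorem corollary4p10 (R : realType) : exact_homological (PC R).
Proof.
split; last exact: pc_exact.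
split; [exact: pc_pointed|exact: pc_regular|exact: pc_protomodular].
Qed.
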